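(* Let $\Phi:\mathbb R\to\mathbb C$ be a $2\pi$-periodic bounded function that is differentiable a.e. Then $$\lim_{z\to\zeta}\ \mathbb C_{\Phi}(z)\ =\ \frac12\,\bigl\{\Phi'(\arg\zeta)+i\cdot\mathbb H_{\Phi}(\arg\zeta)\bigr\}$$ for a.e. $\zeta\in\partial\mathbb D$ along all nontangential paths in $\mathbb D$ to the point $\zeta$.
   Context: $\mathbb D=\{z\in\mathbb C:|z|<1\}$; for $|\zeta|=1$, $\arg\zeta$ is the unique $\tau\in(-\pi,\pi]$ with $\zeta=e^{i\tau}$. For arbitrary (complex-valued) functions $g,f$ on a compact interval $[a,b]$, the Riemann--Stieltjes integral $\int_a^b g\,df$ is the limit, as $\delta:=\max_k|t_k-t_{k-1}|\to0$, of the sums $\sum_{k=1}^p g(\tau_k)\,(f(t_k)-f(t_{k-1}))$ over partitions $a=t_0\le t_1\le\dots\le t_p=b$ and points $\tau_k\in[t_{k-1},t_k]$, provided a finite limit exists, uniform with respect to the partitions and the intermediate points (no bounded variation is assumed). For a $2\pi$-periodic bounded $\Phi:\mathbb R\to\mathbb C$ whose set of discontinuities has measure zero, the Cauchy--Stieltjes integral is $$\mathbb C_\Phi(z):=\frac1{2\pi}\int_{-\pi}^{\pi}\frac{e^{it}\,d\Phi(t)}{e^{it}-z},\qquad z\in\mathbb D .$$ The Hilbert--Stieltjes integral of $\Phi$ at $\tau$ is the principal value $$\mathbb H_\Phi(\tau):=\frac1{2\pi}\lim_{\varepsilon\to+0}\int_{\varepsilon\le|\tau-t|\le\pi}\frac{d\Phi(t)}{\tan\frac{\tau-t}{2}},$$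 where the integral is the sum of the Riemann--Stieltjes integrals over $[\tau-\pi,\tau-\varepsilon]$ and $[\tau+\varepsilon,\tau+\pi]$, and $1/\tan(\pm\pi/2)$ is read as $\cot(\pm\pi/2)=0$. A path in $\mathbb D$ terminating at $\zeta\in\partial\mathbb D$ is nontangential if its part in a neighborhood of $\zeta$ lies inside an angle in $\mathbb D$ with vertex at $\zeta$. *)

(* Defs.v *)
From HB Require Import structures.
From mathcomp Require Import all_boot all_order all_algebra.
From mathcomp Require Import complex.
From mathcomp Require Import all_classical all_reals all_analysis.

Set Implicit Arguments.
Unset Strict Implicit.
Unset Printing Implicit Defensive.

Import Order.TTheory GRing.Theory Num.Theory.
Import numFieldNormedType.Exports.
Local Open Scope classical_set_scope.
Local Open Scope ring_scope.
Local Open Scope complex_scope.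

(* The library's topology on a numFieldType is not found by unification on the
   concrete type R[i]; these instances make it available there. *)
HB.instance Definition _ (R : rcfType) := PseudoPointedMetric.copy R[i] R[i]^o.
HB.instance Definition _ (R : rcfType) := NormedModule.copy R[i] R[i]^o.

Section RiemannStieltjes.
Variable R : realType.
Implicit Types (a b delta : R) (t tau : nat -> R) (g f : R -> R[i]) (I : R[i]).

(* a = t 0 <= t 1 <= ... <= t p = b; the tag tau k lies in the k-th subinterval
   [t k, t k.+1], 0 <= k < p.  Values of t beyond p and of tau from p on are
   irrelevant. *)
Definition tagged_partition a b (p : nat) t tau :=
  [/\ t 0%N = a, t p = b & forall k, (k < p)%N -> t k <= tau k <= t k.+1].

Definition mesh (p : nat) t : R :=
  \big[Num.max/0]_(k < p) `|t k.+1 - t k|.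

Definition RS_sum g f (p : nat) t tau : R[i] :=
  \sum_(k < p) g (tau k) * (f (t k.+1) - f (t k)).

Definition is_RS_integral a b g f I :=
  forall eps : R, 0 < eps -> exists delta, 0 < delta /\
    forall (p : nat) t tau, tagged_partition a b p t tau ->
      mesh p t < delta -> `|RS_sum g f p t tau - I| < eps%:C.

Definition RS_integrable a b g f := exists I, is_RS_integral a b g f I.

(* Meaningful only under RS_integrable (the value is then unique for a <= b). *)
Definition RS_integral a b g f : R[i] := get (is_RS_integral a b g f).

End RiemannStieltjes.

Section CauchyHilbert.
Variable R : realType.
Implicit Types (Phi : R -> R[i]) (z zeta : R[i]) (t tau eps : R).

Definition expi t : R[i] := cos t +i* sin t.

Definition arg zeta : R := get [set t | - pi < t <= pi /\ zeta = expi t].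

(* A property of points of the unit circle holding almost everywhere with
   respect to arc length. *)
Definition ae_circle (P : R[i] -> Prop) :=
  {ae (@lebesgue_measure R), forall t, - pi < t <= pi -> P (expi t)}.

(* The library's derive needs domain and codomain over the same field, which
   rules out maps from R to R[i]. *)
Definition diff_quotient Phi t (h : R) : R[i] :=
  (Phi (t + h) - Phi t) / h%:C.

Definition differentiable_at Phi t := cvg (diff_quotient Phi t h @[h --> 0^']).

Definition derivative Phi t : R[i] := lim (diff_quotient Phi t h @[h --> 0^']).

Definition cauchy_kernel z t : R[i] := expi t / (expi t - z).

Definition cauchy_stieltjes Phi z : R[i] :=
  ((2 * pi)^-1)%:C * RS_integral (- pi) pi (cauchy_kernel z) Phi.

(* For |tau - t| = pi the convention 0^-1 = 0 gives tan (+-pi/2) = 0 and then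
   (tan (+-pi/2))^-1 = 0, which is the intended value cot (+-pi/2) = 0. *)
Definition hilbert_kernel tau t : R[i] := ((tan ((tau - t) / 2))^-1)%:C.

Definition hilbert_truncated Phi tau eps : R[i] :=
  ((2 * pi)^-1)%:C *
  (RS_integral (tau - pi) (tau - eps) (hilbert_kernel tau) Phi +
   RS_integral (tau + eps) (tau + pi) (hilbert_kernel tau) Phi).

Definition hilbert_stieltjes Phi tau : R[i] :=
  lim (hilbert_truncated Phi tau eps @[eps --> 0^'+]).

Definition hilbert_stieltjes_exists Phi tau :=
  (forall eps, 0 < eps <= pi ->
     RS_integrable (tau - pi) (tau - eps) (hilbert_kernel tau) Phi /\
     RS_integrable (tau + eps) (tau + pi) (hilbert_kernel tau) Phi) /\
  cvg (hilbert_truncated Phi tau eps @[eps --> 0^'+]).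

Definition unit_disc : set R[i] := [set z | `|z| < 1].

Definition angle zeta (alpha beta rho : R) : set R[i] :=
  [set z | exists r theta : R, [/\ 0 < r < rho, alpha < theta < beta &
                                   z = zeta + r%:C * expi theta]].

(* A path in the disc terminating at zeta, parametrized by [0, 1). *)
Definition disc_path_to (gamma : R -> R[i]) zeta :=
  [/\ {within `[0%R, 1%R[%classic, continuous gamma},
      forall s, 0 <= s < 1 -> unit_disc (gamma s) &
      gamma s @[s --> 1^'-] --> zeta].

(* An angle of vertex zeta, cut off at some radius, that is included in the disc
   is bounded by rays making an angle < pi/2 with the inner normal at zeta. *)
Definition nontangential (gamma : R -> R[i]) zeta :=
  exists alpha beta rho : R,
    [/\ alpha < beta, 0 < rho, angle zeta alpha beta rho `<=` unit_disc &
        \forall w \near zeta, forall s, 0 <= s < 1 -> gamma s = w ->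
          angle zeta alpha beta rho w].

End CauchyHilbert.

(* Main.v *)
(* Integration by parts turns the Cauchy-Stieltjes integral at z = w e^(i tau) into
   -1/(2 pi) times the integral over [-pi, pi] of f(tau + s) k_w(s), where
   k_w(s) = - i w e^(is) / (e^(is) - w)^2 is the derivative of the kernel and f is
   a bounded Borel function equal to Phi almost everywhere; the truncated
   Hilbert-Stieltjes integral becomes, up to o(1), -1/pi times the integral over
   eps <= |s| <= pi of (f(tau + s) - f(tau)) / (4 sin^2(s/2)), and i / (4 sin^2(s/2))
   is k_1(s).  For w in a Stolz angle at 1, |s| times the difference between k_w and
   k_1 truncated at eps = |1 - w| is bounded by a Poisson kernel.  Hence, for f real
   and differentiable at tau, the real part of the integral against k_w tends to
   - pi f'(tau), while the imaginary part differs by o(1) from the truncated integral.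
   It remains to show that the imaginary part has a radial limit for a.e. tau.

   If f is Lipschitz, Bessel's inequality shows that the Fourier series conjugate to f
   converges uniformly to the primitive of an L^1 function, which is differentiable
   a.e.; the imaginary part for f is the real part for this conjugate function.
   In general, at every point tau of differentiability there is an integer M with
   |f(y) - f(tau)| <= M |y - tau| for all y.  At such tau, f coincides with the largest
   M-Lipschitz function G below it and |f(y) - G(y)| <= 2 M |y - tau|.  By Marcinkiewicz's
   integral, |f(tau + s) - G(tau + s)| / s^2 is then integrable for a.e. such tau, and
   dominated convergence gives the radial limit for f - G. *)
Require Import Defs.
From HB Require Import structures.
From mathcomp Require Import all_boot all_order all_algebra.
From mathcomp Require Import complex.
From mathcomp Require Import all_classical all_reals all_analysis.
From mathcomp Require Import measurable_realfun ring lra.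
Import Order.TTheory GRing.Theory Num.Theory.
Import numFieldNormedType.Exports.
Set Implicit Arguments.
Unset Strict Implicit.
Unset Printing Implicit Defensive.
Local Open Scope classical_set_scope.
Local Open Scope ring_scope.
Local Open Scope complex_scope.
Local Notation Re := (@complex.Re _).
Local Notation Im := (@complex.Im _).

(** * Integrals of bounded measurable functions *)

Section BoundedMeasurable.
Variable R : realType.
Notation mu := (@lebesgue_measure R).
Implicit Types (a b c x M : R) (f g : R -> R).

(** No bounded variation is assumed, so [Phi] carries no measure and differentiability a.e. is all
    there is to work with. Three obstacles shape the proof. First, [Phi] need not be Borel; the
    envelope of its real or imaginary part is, and keeps value and derivative wherever [Phi] is
    differentiable. Second, k_1 has size 1/s^2 while differentiability gives only f(tau + s) -
    f(tau) = O(s), so the singular integral need not converge absolutely. The linear term is removed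
    by subtracting D sin s rather than D s: the pairing of the sine with k_w is exactly - pi w, and
    its pairing with the truncated kernel vanishes by parity. Third, the principal value must be
    shown to exist; as M runs over the integers, only countably many exceptional null sets occur.
    One comparison estimate is then used in both directions: on the radius it turns radial limits
    into principal values, and in a general Stolz angle it turns principal values into nontangential
    limits. *)

Lemma ae_mono (P Q : R -> Prop) :
  (forall x, P x -> Q x) -> {ae mu, forall x, P x} -> {ae mu, forall x, Q x}.
Proof. by move=> PQ; apply: filterS; first exact: (ae_filter_ringOfSetsType mu). Qed.

Lemma ae_and (P Q : R -> Prop) : {ae mu, forall x, P x} -> {ae mu, forall x, Q x} ->
  {ae mu, forall x, P x /\ Q x}.
Proof. by apply: filterI; exact: (ae_filter_ringOfSetsType mu). Qed.

Lemma ae_everywhere (P : R -> Prop) : (forall x, P x) -> {ae mu, forall x, P x}.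
Proof. by move=> HP; exists set0; split => // x /(_ (HP x)). Qed.

(** Stable under sums and products, which integrability is not, so that every integrability
    condition below reduces to closure properties. *)
Definition bounded_measurable a b f :=
  measurable_fun (`[a, b]%classic : set R) f /\
  exists M, forall x, a <= x <= b -> `|f x| <= M.
Notation bm := bounded_measurable.

(** Not an oriented integral: for b < a the interval is empty and the value is 0. *)
Definition intg a b f : R := \int[mu]_(x in `[a, b]) f x.

Lemma bm_integrable a b f : bm a b f -> mu.-integrable `[a, b] (EFin \o f).
Proof.
move=> [mf [M fM]]; apply: measurable_bounded_integrable => //.
  by rewrite /= lebesgue_measure_itv/=; case: ifP => // _; rewrite ltry.
exists M; split; first exact: num_real.
move=> y My x /=; rewrite in_itv/= => abx.
by rewrite (le_trans (fM _ abx))// ltW.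
Qed.

Lemma bm_eq a b f g : (forall x, a <= x <= b -> f x = g x) -> bm a b f -> bm a b g.
Proof.
move=> fg [mf [M fM]]; split.
  apply: eq_measurable_fun mf => x; rewrite inE/= in_itv/=; exact: fg.
by exists M => x abx; rewrite -fg ?fM.
Qed.

Lemma bm_cst a b c : bm a b (fun=> c).
Proof. by split; [exact: measurable_cst|exists `|c|]. Qed.

Lemma bmD a b f g : bm a b f -> bm a b g -> bm a b (fun x => f x + g x).
Proof.
move=> [mf [M fM]] [mg [N gN]]; split; first exact: measurable_funD.
by exists (M + N) => x abx; rewrite (le_trans (ler_normD _ _))// lerD ?fM ?gN.
Qed.

Lemma bmN a b f : bm a b f -> bm a b (fun x => - f x).
Proof.
move=> [mf [M fM]]; split; first exact: measurable_funN.
by exists M => x abx; rewrite normrN fM.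
Qed.

Lemma bmB a b f g : bm a b f -> bm a b g -> bm a b (fun x => f x - g x).
Proof. by move=> bf /bmN; exact: bmD. Qed.

Lemma bmM a b f g : bm a b f -> bm a b g -> bm a b (fun x => f x * g x).
Proof.
move=> [mf [M fM]] [mg [N gN]]; split; first exact: measurable_funM.
by exists (M * N) => x abx; rewrite normrM ler_pM ?fM ?gN.
Qed.

Lemma bmZ a b c f : bm a b f -> bm a b (fun x => c * f x).
Proof. by move=> bf; apply: bmM => //; exact: bm_cst. Qed.

Lemma bm_norm a b f : bm a b f -> bm a b (fun x => `|f x|).
Proof.
move=> [mf [M fM]]; split; first exact: measurableT_comp.
by exists M => x abx; rewrite normr_id fM.
Qed.

Lemma bm_sub a b a' b' f : a <= a' -> b' <= b -> bm a b f -> bm a' b' f.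
Proof.
move=> aa' bb' [mf [M fM]]; split.
  apply: measurable_funS mf => // x /=; rewrite !in_itv/= => /andP[ax xb].
  by rewrite (le_trans aa')//= (le_trans xb).
by exists M => x /andP[ax xb]; rewrite fM// (le_trans aa')//= (le_trans xb).
Qed.

Lemma bm_sum a b (I : Type) (r : seq I) (P : pred I) (F : I -> R -> R) :
  (forall i, P i -> bm a b (F i)) -> bm a b (fun x => \sum_(i <- r | P i) F i x).
Proof.
move=> bF; elim: r => [|i r IH].
  by apply: (@bm_eq _ _ (fun=> 0)) (bm_cst _ _ _) => x _; rewrite big_nil.
case: (boolP (P i)) => Pi.
  by apply: (@bm_eq _ _ (fun x => F i x + \sum_(i <- r | P i) F i x)) => [x _|];
    [rewrite big_cons Pi|apply: bmD => //; exact: bF].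
by apply: bm_eq IH => x _; rewrite big_cons (negbTE Pi).
Qed.

Lemma bm_continuous a b f :
  (forall x, a <= x <= b -> {for x, continuous f}) -> bm a b f.
Proof.
move=> cf.
have cwf : {within `[a, b], continuous f}.
  by apply: continuous_subspace_itv => x; rewrite in_itv/= => /cf.
split; first exact: subspace_continuous_measurable_fun.
have [ab|ab] := leP a b; last by exists 0 => x /andP[ax /(le_trans ax)]; rewrite leNgt ab.
have cnf : {within `[a, b], continuous (fun x => `|f x|)}.
  apply: continuous_subspace_itv => x; rewrite in_itv/= => /cf cfx.
  by apply: continuous_comp => //; exact: norm_continuous.
have [c _ cM] := EVT_max ab cnf.
by exists `|f c| => x abx; apply: cM; rewrite in_itv.
Qed.

Lemma eq_intg a b f g : (forall x, a <= x <= b -> f x = g x) -> intg a b f = intg a b g.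
Proof. by move=> fg; apply: eq_Rintegral => x; rewrite inE/= in_itv/= => /fg. Qed.

Lemma intgD a b f g : bm a b f -> bm a b g ->
  intg a b (fun x => f x + g x) = intg a b f + intg a b g.
Proof. by move=> bf bg; rewrite /intg RintegralD//; exact: bm_integrable. Qed.

Lemma intgB a b f g : bm a b f -> bm a b g ->
  intg a b (fun x => f x - g x) = intg a b f - intg a b g.
Proof. by move=> bf bg; rewrite /intg RintegralB//; exact: bm_integrable. Qed.

Lemma intgZ a b c f : bm a b f -> intg a b (fun x => c * f x) = c * intg a b f.
Proof. by move=> bf; rewrite /intg RintegralZl//; exact: bm_integrable. Qed.

Lemma intgN a b f : bm a b f -> intg a b (fun x => - f x) = - intg a b f.
Proof.
move=> bf; rewrite -mulN1r -intgZ//; apply: eq_intg => x _; by rewrite mulN1r.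
Qed.

Lemma intg_sum a b (I : Type) (r : seq I) (P : pred I) (F : I -> R -> R) :
  (forall i, P i -> bm a b (F i)) ->
  intg a b (fun x => \sum_(i <- r | P i) F i x) = \sum_(i <- r | P i) intg a b (F i).
Proof.
move=> bF; elim: r => [|i r IH].
  rewrite big_nil (@eq_intg _ _ _ (fun=> 0)) => [|x _]; last by rewrite big_nil.
  by rewrite /intg /Rintegral integral0.
rewrite big_cons; case: ifPn => Pi; last first.
  by rewrite -IH; apply: eq_intg => x _; rewrite big_cons (negbTE Pi).
rewrite -IH -intgD; [|exact: bF|exact: bm_sum].
by apply: eq_intg => x _; rewrite big_cons Pi.
Qed.

Lemma le_intg a b f g : bm a b f -> bm a b g ->
  (forall x, a <= x <= b -> f x <= g x) -> intg a b f <= intg a b g.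
Proof.
by move=> bf bg fg; apply: le_Rintegral => //; exact: bm_integrable.
Qed.

Lemma intg_ge0 a b f : (forall x, a <= x <= b -> 0 <= f x) -> 0 <= intg a b f.
Proof. by move=> f0; apply: Rintegral_ge0. Qed.

Lemma intg_norm a b f : bm a b f -> `|intg a b f| <= intg a b (fun x => `|f x|).
Proof. by move=> bf; apply: le_normr_Rintegral => //; exact: bm_integrable. Qed.

Lemma intg_norm_le a b f g : bm a b f -> bm a b g ->
  (forall x, a <= x <= b -> `|f x| <= g x) -> `|intg a b f| <= intg a b g.
Proof.
by move=> bf bg fg; rewrite (le_trans (intg_norm bf))// le_intg//; exact: bm_norm.
Qed.

Lemma intg_cst a b c : a <= b -> intg a b (fun=> c) = c * (b - a).
Proof.
move=> ab; rewrite /intg Rintegral_cst//= lebesgue_measure_itv/=.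
by move: ab; rewrite le_eqVlt lte_fin => /predU1P[->|->]//=; rewrite ltxx subrr.
Qed.

Lemma intg_split a c b f : a <= c <= b -> bm a b f ->
  intg a b f = intg a c f + intg c b f.
Proof.
move=> /andP[ac cb] bf; apply/eqP; rewrite addrC -subr_eq; apply/eqP.
rewrite /intg (@Rintegral_itvB R f (BLeft a) (BRight b)) ?bnd_simp//.
  apply: Rintegral_itv_obnd_cbnd; apply: integrableS (bm_integrable bf) => //.
  by apply: subset_itvr; rewrite bnd_simp.
exact: bm_integrable.
Qed.

Lemma intg_point a f : intg a a f = 0.
Proof. by rewrite /intg set_itv1 Rintegral_set1. Qed.

Lemma intg_FTC a b f F : a <= b ->
  (forall x, a <= x <= b -> is_derive x 1 F (f x)) ->
  (forall x, a <= x <= b -> {for x, continuous f}) -> intg a b f = F b - F a.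
Proof.
rewrite le_eqVlt => /predU1P[<- _ _|ab dF cf]; first by rewrite intg_point subrr.
have cF x : a <= x <= b -> {for x, continuous F}.
  move=> /dF dFx; apply: differentiable_continuous.
  by apply/derivable1_diffP; exact: ex_derive.
rewrite /intg /Rintegral (@continuous_FTC2 _ _ F)//.
- by apply: continuous_subspace_itv => x; rewrite in_itv/= => /cf.
- split.
  + move=> x; rewrite in_itv/= => /andP[ax xb].
    by have dFx := dF x; apply: ex_derive; apply: dFx; rewrite !ltW.
  + by apply: cvg_at_right_filter; apply: cF; rewrite lexx ltW.
  + by apply: cvg_at_left_filter; apply: cF; rewrite lexx ltW.
- move=> x; rewrite in_itv/= => /andP[ax xb]; rewrite derive1E.
  have dFx : is_derive x 1 F (f x) by apply: dF; rewrite !ltW.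
  by rewrite derive_val.
Qed.

Let measurable_shift c :
  measurable_fun setT (fun x : R => (x + c : measurableTypeR R)).
Proof. exact: measurable_funD. Qed.

Lemma lebesgue_measure_shift c (A : set R) : measurable A ->
  pushforward mu (fun x : R => (x + c : measurableTypeR R)) A = mu A.
Proof.
move=> mA; apply/esym.
pose nu := [the measure _ _ of pushforward mu (fun x : R => (x + c : measurableTypeR R))].
apply: (@lebesgue_measure_unique _ (nu (measurable_shift c))) => // _ [[u v]] _ <-.
rewrite /nu /= /pushforward.
have -> : (fun x : R => x + c) @^-1` `]u, v] = `]u - c, v - c]%classic.
  by apply/seteqP; split => x /=; rewrite !in_itv/= ltrBlDr lerBrDr.
rewrite !lebesgue_measure_itv/= !lte_fin ltrD2r; case: ifP => // _.
by rewrite -!EFinD; congr EFin; ring.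
Qed.

Lemma intg_shift a b c f : measurable_fun setT f ->
  bm (a + c) (b + c) f -> intg a b (fun x => f (x + c)) = intg (a + c) (b + c) f.
Proof.
move=> mf bf; rewrite /intg /Rintegral; congr fine.
have pre : (fun x : R => x + c) @^-1` `[a + c, b + c] = `[a, b]%classic.
  by apply/seteqP; split => x /=; rewrite !in_itv/= !lerD2r.
have <- : (\int[pushforward mu (fun x : R => (x + c)%R : measurableTypeR R)]_(y in `[(a + c)%R, (b + c)%R])
            (f y)%:E = \int[mu]_(x in `[(a + c)%R, (b + c)%R]) (f x)%:E)%E.
  apply: (@eq_measure_integral _ _ _ _ mu); first exact: measurable_shift.
  move=> mshift A mA _ .
  exact: lebesgue_measure_shift.
rewrite integral_pushforward ?pre//.
- exact: measurable_shift.
- exact/measurable_EFinP.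
- apply: (@bm_integrable _ _ (fun x => f (x + c))); split.
    by apply: measurable_funTS; apply: measurableT_comp => //; exact: measurable_shift.
  have [_ [M fM]] := bf; exists M => x /andP[ax xb].
  by rewrite fM// !lerD2r ax.
Qed.

(** The version on the whole line is the one that is stable under translation. *)
Definition bounded_borel f := measurable_fun setT f /\ exists M, forall x, `|f x| <= M.

Lemma bounded_borel_bm a b f : bounded_borel f -> bm a b f.
Proof.
by move=> [mf [M fM]]; split; [exact: measurable_funTS|exists M => x _].
Qed.

Lemma bounded_borel_shift c f : bounded_borel f -> bounded_borel (fun x => f (x + c)).
Proof.
move=> [mf [M fM]]; split; last by exists M => x.
by apply: measurableT_comp => //; exact: measurable_shift.
Qed.

Lemma bounded_borelM f g : bounded_borel f -> bounded_borel g -> bounded_borel (fun x => f x * g x).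
Proof.
move=> [mf [M fM]] [mg [N gN]]; split; first exact: measurable_funM.
by exists (M * N) => x; rewrite normrM ler_pM.
Qed.

Lemma intg_borel_shift a b c f : bounded_borel f ->
  intg a b (fun x => f (x + c)) = intg (a + c) (b + c) f.
Proof. by move=> bf; apply: intg_shift; [case: bf|exact: bounded_borel_bm]. Qed.

(** Splitting [a, a + T + c] at a + c and at a + T leaves two outer pieces, [a, a + c] and
    [a + T, a + T + c], that are translates of each other by a period. *)
Lemma intg_periodic a T c f : 0 <= T -> bounded_borel f -> periodic f T ->
  intg a (a + T) (fun x => f (x + c)) = intg a (a + T) f.
Proof.
move=> T0 bf pf; rewrite intg_borel_shift//.
(* A negative shift is undone by a positive shift of the translated function. *)
wlog c0 : c f bf pf / 0 <= c.
  move=> H; have [|/ltW c0] := leP 0 c; first exact: H.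
  have pf' : periodic (fun x => f (x + c)) T by move=> x; rewrite addrAC pf.
  have := H (- c) _ (bounded_borel_shift c bf) pf'.
  by rewrite oppr_ge0 !intg_borel_shift// !subrK => /(_ c0) ->.
have bfb a' b' : bm a' b' f by exact: bounded_borel_bm.
have e1 := @intg_split a (a + c) (a + T + c) f _ (bfb _ _).
have e2 := @intg_split a (a + T) (a + T + c) f _ (bfb _ _).
have e3 : intg a (a + c) f = intg (a + T) (a + T + c) f.
  rewrite (addrAC a T c) -intg_borel_shift//; apply: eq_intg => x _.
  by rewrite pf.
have h1 : a <= a + c <= a + T + c by rewrite lerDl c0 lerD2r lerDl.
have h2 : a <= a + T <= a + T + c by rewrite !lerDl T0.
move: (e1 h1); rewrite (e2 h2) -e3 addrC => /addrI ->//.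
Qed.

End BoundedMeasurable.
Notation bm := bounded_measurable.

(** * Semicontinuous envelopes and Riemann-Stieltjes integrals *)

Section Envelope.
Variable R : realType.
Notation mu := (@lebesgue_measure R).
Implicit Types (a b c x y t u M B : R) (f g phi : R -> R) (n : nat).

Lemma intg_dominated_cvg a b (F : nat -> R -> R) (F0 : R -> R) M :
  (forall n, measurable_fun (`[a, b]%classic : set R) (F n)) -> bm a b F0 ->
  (forall n x, a <= x <= b -> `|F n x| <= M) ->
  {ae mu, forall x, a <= x <= b -> F n x @[n --> \oo] --> F0 x} ->
  intg a b (F n) @[n --> \oo] --> intg a b F0.
Proof.
move=> mF bF0 FM FF0.
have bF n : bm a b (F n) by split=> //; exists M => x; exact: FM.
have [|||||_ _] := @dominated_convergence _ _ _ mu `[a, b]%classic (measurable_itv _)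
  (fun n x => (F n x)%:E) (fun x => (F0 x)%:E) (fun=> M%:E).
- by move=> n; apply/measurable_EFinP; exact: mF.
- by apply/measurable_EFinP; case: bF0.
- apply: ae_mono FF0 => x H; rewrite /= in_itv/= => /H {}H.
  by apply: cvg_EFin => //; exact: nearW.
- exact: (bm_integrable (bm_cst a b M)).
- apply: ae_everywhere => x n; rewrite /= in_itv/= => abx.
  by rewrite lee_fin FM.
move=> H; have : (\int[mu]_(x in `[a, b]) (F n x)%:E)%E @[n --> \oo] -->
   (intg a b F0)%:E.
  rewrite /intg /Rintegral fineK//.
  exact: (integrable_fin_num _ (bm_integrable bF0)).
by move/fine_cvgP => [_].
Qed.

Definition sup_env phi n t : R := sup [set phi u | u in [set u | `|u - t| < n.+1%:R^-1]].

Definition inf_env phi n t : R := - sup_env (fun u => - phi u) n t.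

(* A function that is continuous a.e. need not be Borel; its upper semicontinuous
   envelope is, and coincides with it wherever it is continuous. *)
Definition usc_env phi t : R := infs (sup_env phi ^~ t) 0%N.

Section Bounded.
Variables (phi : R -> R) (B : R).
Hypothesis phiB : forall t, `|phi t| <= B.

Let ubE n t : has_ubound [set phi u | u in [set u | `|u - t| < n.+1%:R^-1]].
Proof. by exists B => _ [u _ <-]; rewrite (le_trans (ler_norm _)). Qed.

Lemma sup_env_ge n t u : `|u - t| < n.+1%:R^-1 -> phi u <= sup_env phi n t.
Proof. by move=> ut; apply: ub_le_sup => //; exists u. Qed.

Lemma sup_env_le n t c :
  (forall u, `|u - t| < n.+1%:R^-1 -> phi u <= c) -> sup_env phi n t <= c.
Proof.
move=> H; apply: ge_sup; last by move=> _ [u /= ut <-]; exact: H.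
by exists (phi t); exists t => //=; rewrite subrr normr0 invr_gt0.
Qed.

Lemma sup_env_bound n t : `|sup_env phi n t| <= B.
Proof.
rewrite ler_norml; apply/andP; split.
  apply: (@le_trans _ _ (phi t)); first by have := phiB t; rewrite ler_norml => /andP[].
  by apply: sup_env_ge; rewrite subrr normr0 invr_gt0.
by apply: sup_env_le => u _; rewrite (le_trans (ler_norm _)).
Qed.

(** Lower semicontinuity: the ball is open, so a point [u] at which [phi] exceeds c stays in the
    ball around every y close to x. *)
Lemma measurable_sup_env n : measurable_fun setT (sup_env phi n).
Proof.
apply/measurable_EFinP; apply: lower_semicontinuous_measurable; move=> x c /=.
rewrite lte_fin => /sup_gt[]; first by exists (phi x); exists x => //=; rewrite subrr normr0 invr_gt0.
move=> _ [u /= ux <-] cu.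
exists (ball x (n.+1%:R^-1 - `|u - x|)); first by apply: nbhsx_ballx; rewrite subr_gt0.
move=> y; rewrite -ball_normE /= => xy; rewrite lte_fin (lt_le_trans cu)//.
apply: sup_env_ge; rewrite (_ : u - y = (u - x) + (x - y)); last by ring.
by rewrite (le_lt_trans (ler_normD _ _))// addrC -ltrBrDr.
Qed.

Let lbU t : has_lbound (range (sup_env phi ^~ t)).
Proof.
by exists (- B) => _ [n _ <-]; have := sup_env_bound n t; rewrite ler_norml => /andP[].
Qed.

Lemma usc_env_le n t : usc_env phi t <= sup_env phi n t.
Proof. by apply: ge_inf; [rewrite /sdrop/=; case: (lbU t) => y H; exists y => _ [k _ <-]; apply: H; exists k|exists n]. Qed.

Lemma usc_env_ge t c : (forall n, c <= sup_env phi n t) -> c <= usc_env phi t.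
Proof.
move=> H; apply: lb_le_inf; last by move=> _ [n _ <-].
by exists (sup_env phi 0 t); exists 0%N.
Qed.

Lemma usc_env_gephi t : phi t <= usc_env phi t.
Proof. by apply: usc_env_ge => n; apply: sup_env_ge; rewrite subrr normr0 invr_gt0. Qed.

Lemma usc_env_borel : bounded_borel (usc_env phi).
Proof.
split.
  apply: measurable_fun_infs => [t _|n]; first exact: lbU.
  exact: measurable_sup_env.
exists B => x; rewrite ler_norml; apply/andP; split.
  by apply: usc_env_ge => n; have := sup_env_bound n x; rewrite ler_norml => /andP[].
by apply: le_trans (usc_env_le 0 x) _; have := sup_env_bound 0 x; rewrite ler_norml => /andP[].
Qed.

End Bounded.

Lemma usc_env_periodic phi T : periodic phi T -> periodic (usc_env phi) T.
Proof.
move=> pphi t; rewrite /usc_env; congr infs; apply/funext => n.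
rewrite /sup_env; congr sup; apply/seteqP; split=> _ [u /= ut <-].
  by exists (u - T); [rewrite (_ : u - T - t = u - (t + T)) //; ring|rewrite -(pphi (u - T)) subrK].
by exists (u + T); [rewrite (_ : u + T - (t + T) = u - t) //; ring|rewrite pphi].
Qed.

Section Oscillation.
Variables (phi : R -> R) (B : R).
Hypothesis phiB : forall t, `|phi t| <= B.
Let phiNB t : `|- phi t| <= B. Proof. by rewrite normrN. Qed.

Definition osc n t : R := sup_env phi n t - inf_env phi n t.

(** Both numbers lie between [inf_env phi n t] and [sup_env phi n t]. *)
Lemma osc_le n t u : `|u - t| < n.+1%:R^-1 -> `|usc_env phi t - phi u| <= osc n t.
Proof.
move=> ut; have l := sup_env_ge phiB ut; have l' := sup_env_ge phiNB ut.
have l1 := usc_env_le phiB n t; have l2 := usc_env_gephi phiB t.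
have l3 : - phi t <= sup_env (fun u => - phi u) n t.
  by apply: (sup_env_ge phiNB); rewrite subrr normr0 invr_gt0.
by rewrite /osc /inf_env opprK ler_norml; apply/andP; split; lra.
Qed.

Lemma measurable_osc n : measurable_fun setT (osc n).
Proof.
apply: measurable_funB; first exact: measurable_sup_env phiB n.
by apply: measurable_funN; exact: measurable_sup_env phiNB n.
Qed.

Lemma osc_bound n t : `|osc n t| <= B + B.
Proof.
rewrite /osc (le_trans (ler_normB _ _))// lerD//; first exact: sup_env_bound.
by rewrite normrN; exact: (sup_env_bound phiNB).
Qed.

Lemma osc_borel n : bounded_borel (osc n).
Proof. by split; [exact: measurable_osc|exists (B + B); exact: osc_bound]. Qed.

Lemma osc_cvg0 t : {for t, continuous phi} -> osc n t @[n --> \oo] --> 0.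
Proof.
move=> ct; apply/cvgrPdist_le => e e0.
have /cvgrPdist_lt/(_ (e / 2)) := ct; rewrite divr_gt0// => /(_ isT).
move=> /nbhs_ballP[d /= d0 H].
near=> n; rewrite sub0r normrN.
have nd : n.+1%:R^-1 < d by near: n; exact: near_infty_natSinv_lt (PosNum d0).
have Hn u : `|u - t| < n.+1%:R^-1 -> `|phi t - phi u| < e / 2.
  by move=> ut; apply: H; rewrite -ball_normE /= distrC (lt_trans ut).
have h1 : sup_env phi n t <= phi t + e / 2.
  by apply: sup_env_le => // u /Hn; rewrite ltr_norml => /andP[? ?]; lra.
have h2 : sup_env (fun u => - phi u) n t <= - phi t + e / 2.
  by apply: (@sup_env_le (fun u => - phi u)) => // u /Hn; rewrite ltr_norml => /andP[? ?]; lra.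
have h3 : phi t <= sup_env phi n t by apply: (sup_env_ge phiB); rewrite subrr normr0 invr_gt0.
have h4 : - phi t <= sup_env (fun u => - phi u) n t.
  by apply: (sup_env_ge phiNB); rewrite subrr normr0 invr_gt0.
by rewrite /osc /inf_env opprK ger0_norm; lra.
Unshelve. all: by end_near. Qed.

(** The quantitative side of Lebesgue's criterion for Riemann integrability. It does not mention
    partitions, and thus gives limits of Riemann-Stieltjes sums that are uniform in them. *)
Lemma intg_osc_cvg0 a b : {ae mu, forall t, {for t, continuous phi}} ->
  intg a b (osc n) @[n --> \oo] --> 0.
Proof.
move=> cphi; have -> : 0 = intg a b (fun=> 0) :> R by rewrite /intg /Rintegral integral0.
apply: (@intg_dominated_cvg a b osc (fun=> 0) (B + B)).
- by move=> n; apply: measurable_funTS; exact: measurable_osc.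
- exact: bm_cst.
- by move=> n x _; exact: osc_bound.
- by apply: ae_mono cphi => x cx _; exact: osc_cvg0.
Qed.

End Oscillation.
End Envelope.

(** * Integration by parts for real Riemann-Stieltjes sums *)

Section RealStieltjes.
Variable R : realType.
Notation mu := (@lebesgue_measure R).
Implicit Types (a b c x y M B C : R) (f g dg phi : R -> R) (n p : nat) (t tau : nat -> R).

Definition real_RS_sum g phi p t tau : R :=
  \sum_(k < p) g (tau k) * (phi (t k.+1) - phi (t k)).

Lemma mesh_ge p t k : (k < p)%N -> `|t k.+1 - t k| <= mesh p t.
Proof.
move=> kp; rewrite /mesh.
exact: (@le_bigmax _ _ _ 0 (fun k : 'I_p => `|t k.+1 - t k|) (Ordinal kp)).
Qed.

Section Parts.
Variables (phi g dg : R -> R) (a b B C : R).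
Hypothesis phiB : forall x, `|phi x| <= B.
Hypothesis dgP : forall x, a <= x <= b -> is_derive x 1 g (dg x).
Hypothesis cdg : forall x, a <= x <= b -> {for x, continuous dg}.
Hypothesis dgC : forall x, a <= x <= b -> `|dg x| <= C.
Let f := usc_env phi.

Let bm_f u v : bm u v f.
Proof. exact/bounded_borel_bm/(usc_env_borel phiB). Qed.

Let bm_osc n u v : bm u v (osc phi n).
Proof. exact/bounded_borel_bm/(osc_borel phiB). Qed.

Let bm_dg u v : a <= u -> v <= b -> bm u v dg.
Proof.
move=> au vb; apply: bm_continuous => x /andP[ux xv].
by apply: cdg; rewrite (le_trans au)//= (le_trans xv).
Qed.

(** Writing g v - g u as the integral of [dg] turns the left side into the integral of (phi w - f)
    dg, and [osc] bounds the first factor because w is close to all of [u, v]. *)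
Let piece n u v w : a <= u -> u <= v -> v <= b ->
  (forall x, u <= x <= v -> `|w - x| < n.+1%:R^-1) ->
  `|phi w * (g v - g u) - intg u v (fun x => f x * dg x)| <=
    C * intg u v (osc phi n).
Proof.
move=> au uv vb H.
have sub x : u <= x <= v -> a <= x <= b.
  by move=> /andP[ux xv]; rewrite (le_trans au)//= (le_trans xv).
rewrite -(intg_FTC uv (fun x h => dgP (sub x h)) (fun x h => cdg (sub x h))).
have bdg := bm_dg au vb.
rewrite -!intgZ// -intgB; [|exact: bmZ|exact: bmM].
apply: intg_norm_le; [by apply: bmB; [exact: bmZ|exact: bmM]|exact: bmZ|].
move=> x uxv; rewrite -mulrBl normrM mulrC ler_pM ?dgC ?sub//.
by rewrite distrC; apply: osc_le => //; exact: H.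
Qed.

(** Abel summation on each subinterval [t, t'] with tag tau: g(tau) (phi(t') - phi(t)) is g(t')
    phi(t') - g(t) phi(t) minus phi(t) (g(tau) - g(t)) minus phi(t') (g(t') - g(tau)), and [piece]
    applies to the last two terms. The error is additive over subintervals, so it does not depend on
    their number. *)
Lemma real_RS_error n p t tau : tagged_partition a b p t tau ->
  mesh p t < n.+1%:R^-1 ->
  `|real_RS_sum g phi p t tau - (g b * phi b - g a * phi a - intg a b (fun x => f x * dg x))|
   <= C * intg a b (osc phi n).
Proof.
move=> [t0 tp tk] hmesh.
have mono k : (k < p)%N -> t k <= t k.+1.
  by move=> /tk /andP[] /le_trans; apply.
have mono0 k : (k <= p)%N -> a <= t k.
  elim: k => [_|k IH kp]; first by rewrite t0.
  by rewrite (le_trans (IH (ltnW kp)))// mono.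
have monop k : (k <= p)%N -> t k <= b.
  move=> kp; rewrite -tp; move: kp; elim: p mono {hmesh tk tp mono0} => [|q IH] mono.
    by rewrite leqn0 => /eqP ->.
  rewrite leq_eqVlt => /predU1P[->//|]; rewrite ltnS => /IH H.
  by rewrite (le_trans (H _))// => [k' k'q|]; apply: mono => //; rewrite ltnS ltnW.
have step k : (k < p)%N ->
   `|g (tau k) * (phi (t k.+1) - phi (t k)) - (g (t k.+1) * phi (t k.+1) - g (t k) * phi (t k)
      - intg (t k) (t k.+1) (fun x => f x * dg x))| <= C * intg (t k) (t k.+1) (osc phi n).
  move=> kp; have /andP[l1 l2] := tk _ kp.
  have au := mono0 _ (ltnW kp); have vb := monop _ kp.
  have d : t k.+1 - t k < n.+1%:R^-1.
    rewrite (le_lt_trans (ler_norm _))// (le_lt_trans _ hmesh)//; exact: mesh_ge.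
  have split1 h : bm (t k) (t k.+1) h -> intg (t k) (t k.+1) h =
      intg (t k) (tau k) h + intg (tau k) (t k.+1) h.
    by move=> bh; apply: intg_split => //; rewrite l1.
  rewrite !split1//; last exact: bmM (bm_f _ _) (bm_dg au vb).
  rewrite [C * (_ + _)]mulrDr.
  have p1 : `|phi (t k) * (g (tau k) - g (t k)) - intg (t k) (tau k) (fun x => f x * dg x)|
      <= C * intg (t k) (tau k) (osc phi n).
    apply: piece => //; first exact: le_trans vb.
    move=> x /andP[l3 l4]; rewrite distrC ger0_norm ?subr_ge0//.
    by apply: le_lt_trans d; lra.
  have p2 : `|phi (t k.+1) * (g (t k.+1) - g (tau k)) - intg (tau k) (t k.+1) (fun x => f x * dg x)|
      <= C * intg (tau k) (t k.+1) (osc phi n).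
    apply: piece => //; first exact: le_trans l1.
    move=> x /andP[l3 l4]; rewrite ger0_norm ?subr_ge0//.
    by apply: le_lt_trans d; lra.
  rewrite -normrN; apply: le_trans (lerD p1 p2); apply: le_trans (ler_normD _ _).
  by rewrite le_eqVlt; apply/orP; left; apply/eqP; congr (`| _ |); ring.
have all k : (k <= p)%N ->
  `|real_RS_sum g phi k t tau - (g (t k) * phi (t k) - g a * phi a - intg a (t k) (fun x => f x * dg x))|
   <= C * intg a (t k) (osc phi n).
  elim: k => [_|k IH kp].
    by rewrite /real_RS_sum big_ord0 t0 !intg_point !subrr normr0 mulr0.
  have l := mono0 _ (ltnW kp); have l' := mono _ kp.
  have split2 h : bm a (t k.+1) h -> intg a (t k.+1) h = intg a (t k) h + intg (t k) (t k.+1) h.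
    by move=> bh; apply: intg_split => //; rewrite l.
  rewrite /real_RS_sum big_ord_recr/= -/(real_RS_sum g phi k t tau).
  rewrite !split2//; last by apply: bmM => //; apply: bm_dg => //; exact: monop.
  rewrite [C * (_ + _)]mulrDr; apply: le_trans (lerD (IH (ltnW kp)) (step _ kp)).
  apply: le_trans (ler_normD _ _).
  by rewrite le_eqVlt; apply/orP; left; apply/eqP; congr (`| _ |); ring.
by have := all p (leqnn p); rewrite tp.
Qed.

End Parts.

(** The value found by parts, with [dg] the derivative of g. The boundary terms need the values of
    [phi] itself, which may differ from those of the envelope; under the integral the difference is
    invisible. *)
Definition real_RS a b g dg phi : R :=
  g b * phi b - g a * phi a - intg a b (fun x => usc_env phi x * dg x).

Lemma real_RS_cvg a b g dg phi B : (forall x, `|phi x| <= B) ->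
  {ae mu, forall x, {for x, continuous phi}} ->
  (forall x, a <= x <= b -> is_derive x 1 g (dg x)) ->
  (forall x, a <= x <= b -> {for x, continuous dg}) ->
  forall e, 0 < e -> exists delta, 0 < delta /\ forall p t tau,
    tagged_partition a b p t tau -> mesh p t < delta ->
    `|real_RS_sum g phi p t tau - real_RS a b g dg phi| < e.
Proof.
move=> phiB cphi dgP cdg e e0.
have [_ [C0 dgC0]] := bm_continuous cdg.
pose C := `|C0| + 1; have C_gt0 : 0 < C by rewrite ltr_wpDl.
have dgC x : a <= x <= b -> `|dg x| <= C.
  by move=> /dgC0 /le_trans; apply; rewrite (le_trans (ler_norm _))// lerDl.
have /cvgrPdist_lt/(_ (e / C)) := intg_osc_cvg0 phiB a b cphi.
rewrite divr_gt0// => /(_ isT)[n _ /(_ n (leqnn n))/=]; rewrite sub0r normrN => hn.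
exists n.+1%:R^-1; split; first by rewrite invr_gt0.
move=> p t tau tp hm; apply: le_lt_trans (real_RS_error phiB dgP cdg dgC tp hm) _.
by rewrite mulrC -ltr_pdivlMr//; exact: le_lt_trans (ler_norm _) hn.
Qed.

End RealStieltjes.

(** * Complex-valued functions of a real variable *)

Section ComplexParts.
Variable R : realType.
Implicit Types (z w : R[i]) (x y t : R).

(** The norm on [R[i]] takes its values in [R[i]]; this is the same modulus as a real number. *)
Definition cabs z : R := ComplexField.Normc.normc z.

Lemma normE z : `|z| = (cabs z)%:C.
Proof. by rewrite normc_def; case: z. Qed.

Lemma ReD z w : Re (z + w) = Re z + Re w.
Proof. by move: z w => [a b] [c d]. Qed.
Lemma ImD z w : Im (z + w) = Im z + Im w.
Proof. by move: z w => [a b] [c d]. Qed.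
Lemma ReN z : Re (- z) = - Re z. Proof. by case: z. Qed.
Lemma ImN z : Im (- z) = - Im z. Proof. by case: z. Qed.
Lemma ReB z w : Re (z - w) = Re z - Re w.
Proof. by move: z w => [a b] [c d]. Qed.
Lemma ImB z w : Im (z - w) = Im z - Im w.
Proof. by move: z w => [a b] [c d]. Qed.
Lemma ReM z w : Re (z * w) = Re z * Re w - Im z * Im w.
Proof. by move: z w => [a b] [c d]. Qed.
Lemma ImM z w : Im (z * w) = Re z * Im w + Im z * Re w.
Proof. by move: z w => [a b] [c d]. Qed.
Lemma ReC x : Re (x%:C) = x. Proof. by []. Qed.
Lemma ImC x : Im (x%:C) = 0. Proof. by []. Qed.
Definition partsE := (ReD, ImD, ReB, ImB, ReN, ImN, ReM, ImM, ReC, ImC).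

Lemma parts_eq z w : Re z = Re w -> Im z = Im w -> z = w.
Proof. by case: z; case: w => ? ? ? ? /= -> ->. Qed.

Lemma Re_sum (I : Type) (r : seq I) (P : pred I) (F : I -> R[i]) :
  Re (\sum_(i <- r | P i) F i) = \sum_(i <- r | P i) Re (F i).
Proof. by elim/big_rec2: _ => // i x z _ <-; rewrite ReD. Qed.

Lemma Im_sum (I : Type) (r : seq I) (P : pred I) (F : I -> R[i]) :
  Im (\sum_(i <- r | P i) F i) = \sum_(i <- r | P i) Im (F i).
Proof. by elim/big_rec2: _ => // i x z _ <-; rewrite ImD. Qed.

Lemma cabs_ge0 z : 0 <= cabs z.
Proof. by rewrite -ler0c -normE. Qed.

Lemma cabsM z w : cabs (z * w) = cabs z * cabs w.
Proof. exact: ComplexField.Normc.normcM. Qed.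

Lemma cabsV z : cabs z^-1 = (cabs z)^-1.
Proof. exact: ComplexField.Normc.normcV. Qed.

Lemma cabsX z n : cabs (z ^+ n) = cabs z ^+ n.
Proof.
elim: n => [|n IH]; first exact: ComplexField.Normc.normc1.
by rewrite !exprS cabsM IH.
Qed.

Lemma cabsN z : cabs (- z) = cabs z.
Proof. by apply: (@complexI R); rewrite -!normE normrN. Qed.

Lemma cabsBC z w : cabs (z - w) = cabs (w - z).
Proof. by rewrite -cabsN opprB. Qed.

Lemma cabsD z w : cabs (z + w) <= cabs z + cabs w.
Proof. by rewrite -lecR rmorphD/= -!normE ler_normD. Qed.

Lemma cabs_real x : cabs x%:C = `|x|.
Proof. by rewrite /cabs /= expr0n/= addr0 sqrtr_sqr. Qed.

Lemma cabs_i : cabs 'i%C = 1.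
Proof. by rewrite /cabs/= expr0n expr1n add0r sqrtr1. Qed.

Lemma cabs_eq0 z : (cabs z == 0) = (z == 0).
Proof.
apply/eqP/eqP; first exact: ComplexField.Normc.eq0_normc.
by move=> ->; exact: ComplexField.Normc.normc0.
Qed.

Lemma cabs_sqr z : cabs z ^+ 2 = Re z ^+ 2 + Im z ^+ 2.
Proof. by case: z => a b /=; rewrite sqr_sqrtr// addr_ge0 ?sqr_ge0. Qed.

Lemma Re_le_cabs z : `|Re z| <= cabs z.
Proof.
rewrite -(@ler_pXn2r _ 2)// ?nnegrE ?cabs_ge0// cabs_sqr real_normK ?num_real//.
by rewrite lerDl sqr_ge0.
Qed.

Lemma Im_le_cabs z : `|Im z| <= cabs z.
Proof.
rewrite -(@ler_pXn2r _ 2)// ?nnegrE ?cabs_ge0// cabs_sqr real_normK ?num_real//.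
by rewrite lerDr sqr_ge0.
Qed.

Lemma cabs_le_parts z : cabs z <= `|Re z| + `|Im z|.
Proof.
rewrite -(@ler_pXn2r _ 2)// ?nnegrE ?cabs_ge0 ?addr_ge0// cabs_sqr.
rewrite sqrrD !real_normK ?num_real// -addrA [_ *+ 2 + _]addrC addrA lerDl.
by rewrite mulrn_wge0// mulr_ge0.
Qed.

Lemma cvg_parts (T : Type) (F : set_system T) {FF : Filter F} (f : T -> R[i]) (l : R[i]) :
  f x @[x --> F] --> l <->
  Re (f x) @[x --> F] --> Re l /\ Im (f x) @[x --> F] --> Im l.
Proof.
split.
  move=> /cvgrPdist_lt H; split; apply/cvgrPdist_lt => e e0.
    have := H e%:C; rewrite ltcR => /(_ e0); apply: filterS => x.
    by rewrite normE ltcR -ReB; exact: le_lt_trans (Re_le_cabs _).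
  have := H e%:C; rewrite ltcR => /(_ e0); apply: filterS => x.
  by rewrite normE ltcR -ImB; exact: le_lt_trans (Im_le_cabs _).
move=> [/cvgrPdist_lt Hr /cvgrPdist_lt Hi]; apply/cvgrPdist_lt => -[e e'].
(* A positive element of [R[i]] has imaginary part 0, so the tolerance is a real number. *)
rewrite ltcE/= => /andP[/eqP -> e0].
have e20 : 0 < e / 2 by rewrite divr_gt0.
apply: filterS2 (Hr _ e20) (Hi _ e20) => x.
rewrite -ReB -ImB => h1 h2; rewrite normE ltcR (le_lt_trans (cabs_le_parts _))//.
by rewrite (splitr e) ltrD.
Qed.

Lemma expiD x y : expi (x + y) = expi x * expi y.
Proof. by rewrite /expi cosD sinD; apply: parts_eq => /=; ring. Qed.

Lemma cabs_expi x : cabs (expi x) = 1.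
Proof. by rewrite /cabs /= cos2Dsin2 sqrtr1. Qed.

Lemma expi0 : expi (0 : R) = 1.
Proof. by rewrite /expi cos0 sin0. Qed.

Lemma expiN x : expi (- x) = (expi x)^-1.
Proof.
have e1 : expi (- x) * expi x = 1 by rewrite -expiD addNr expi0.
have e0 : expi x != 0 by rewrite -cabs_eq0 cabs_expi oner_eq0.
by apply: (mulIf e0); rewrite e1 mulVf.
Qed.

Lemma expi_neq0 x : expi x != 0.
Proof. by rewrite -cabs_eq0 cabs_expi oner_eq0. Qed.

Lemma expiX x n : expi x ^+ n = expi (x *+ n).
Proof.
elim: n => [|n IH]; first by rewrite mulr0n expi0.
by rewrite exprS mulrS expiD IH.
Qed.

End ComplexParts.

Section PointwiseDerivative.
Variable R : realType.
Implicit Types (f g : R -> R) (x df dg c : R).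

Lemma isdD f g x df dg : is_derive x 1 f df -> is_derive x 1 g dg ->
  is_derive x 1 (fun y => f y + g y) (df + dg).
Proof. exact: is_deriveD. Qed.

Lemma isdB f g x df dg : is_derive x 1 f df -> is_derive x 1 g dg ->
  is_derive x 1 (fun y => f y - g y) (df - dg).
Proof. exact: is_deriveB. Qed.

Lemma isdN f x df : is_derive x 1 f df -> is_derive x 1 (fun y => - f y) (- df).
Proof. exact: is_deriveN. Qed.

Lemma isdM f g x df dg : is_derive x 1 f df -> is_derive x 1 g dg ->
  is_derive x 1 (fun y => f y * g y) (df * g x + f x * dg).
Proof.
move=> hf hg; have h := is_deriveM hf hg.
by apply: is_derive_eq h _; rewrite /GRing.scale/=; ring.
Qed.

Lemma isdZ f x df c : is_derive x 1 f df -> is_derive x 1 (fun y => c * f y) (c * df).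
Proof.
move=> hf; have h := isdM (is_derive_cst c x 1) hf.
by apply: is_derive_eq h _; rewrite mul0r add0r.
Qed.

Lemma isdV f x df : f x != 0 -> is_derive x 1 f df ->
  is_derive x 1 (fun y => (f y)^-1) (- df / f x ^+ 2).
Proof.
move=> f0 hf; have h := is_deriveV f0 hf.
by apply: is_derive_eq h _; rewrite /GRing.scale/=; ring.
Qed.

Lemma isd_affine x c d : is_derive x 1 (fun y => c * y + d) c.
Proof.
have h := isdD (isdZ c (is_derive_id x 1)) (is_derive_cst d x 1).
by apply: is_derive_eq h _; rewrite mulr1 addr0.
Qed.

Lemma is_derive_continuous f x df : is_derive x 1 f df -> {for x, continuous f}.
Proof.
by move=> h; apply: differentiable_continuous; apply/derivable1_diffP; exact: ex_derive.
Qed.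

End PointwiseDerivative.

Section ComplexDerivative.
Variable R : realType.
Implicit Types (f g df dg : R -> R[i]) (t : R) (d e : R[i]).

(* The derivative of a complex-valued function of a real variable, taken on the
   real and imaginary parts since [derive] needs a common field of scalars. *)
Definition is_cderive t f d :=
  is_derive t (1 : R) (Re \o f) (Re d) /\ is_derive t (1 : R) (Im \o f) (Im d).

Lemma is_cderive_eq t f d e : is_cderive t f d -> d = e -> is_cderive t f e.
Proof. by move=> ? <-. Qed.

Lemma is_cderive_cst t (c : R[i]) : is_cderive t (fun=> c) 0.
Proof. by split; exact: is_derive_cst. Qed.

Lemma is_cderiveD t f g d e : is_cderive t f d -> is_cderive t g e ->
  is_cderive t (fun x => f x + g x) (d + e).
Proof.
move=> [f1 f2] [g1 g2]; split.
  by rewrite ReD (_ : _ \o _ = fun x => Re (f x) + Re (g x));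
    [exact: isdD|apply/funext => x /=; rewrite ReD].
by rewrite ImD (_ : _ \o _ = fun x => Im (f x) + Im (g x));
  [exact: isdD|apply/funext => x /=; rewrite ImD].
Qed.

Lemma is_cderiveM t f g d e : is_cderive t f d -> is_cderive t g e ->
  is_cderive t (fun x => f x * g x) (d * g t + f t * e).
Proof.
move=> [f1 f2] [g1 g2]; split.
  rewrite (_ : _ \o _ = fun x => Re (f x) * Re (g x) - Im (f x) * Im (g x)); last first.
    by apply/funext => x /=; rewrite ReM.
  by apply: is_derive_eq (isdB (isdM f1 g1) (isdM f2 g2)) _; rewrite /= !partsE; ring.
rewrite (_ : _ \o _ = fun x => Re (f x) * Im (g x) + Im (f x) * Re (g x)); last first.
  by apply/funext => x /=; rewrite ImM.
by apply: is_derive_eq (isdD (isdM f1 g2) (isdM f2 g1)) _; rewrite /= !partsE; ring.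
Qed.

Lemma is_cderiveV t f d : f t != 0 -> is_cderive t f d ->
  is_cderive t (fun x => (f x)^-1) (- d / f t ^+ 2).
Proof.
move=> f0 [f1 f2].
have ReV (z : R[i]) : Re z^-1 = Re z / (Re z * Re z + Im z * Im z) by case: z.
have ImV (z : R[i]) : Im z^-1 = - (Im z / (Re z * Re z + Im z * Im z)) by case: z.
have N0 : Re (f t) * Re (f t) + Im (f t) * Im (f t) != 0.
  by rewrite -!expr2 -cabs_sqr sqrf_eq0 cabs_eq0.
have dN := isdV (f := fun x => Re (f x) * Re (f x) + Im (f x) * Im (f x)) N0
  (isdD (isdM f1 f1) (isdM f2 f2)).
have -> : - d / f t ^+ 2 = - d * ((f t)^-1 * (f t)^-1) by rewrite [f t ^+ 2]expr2 invfM.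
split.
  rewrite (_ : _ \o _ = fun x => Re (f x) / (Re (f x) * Re (f x) + Im (f x) * Im (f x))); last first.
    by apply/funext => x /=; rewrite ReV.
  apply: is_derive_eq (isdM f1 dN) _.
  rewrite !(ReM, ImM, ReV, ImV, ReN, ImN) /comp.
  move: (complex.Re (f t)) (complex.Im (f t)) (complex.Re d) (complex.Im d) N0 => a b u v N0.
  by field.
rewrite (_ : _ \o _ = fun x => - (Im (f x) / (Re (f x) * Re (f x) + Im (f x) * Im (f x)))); last first.
  by apply/funext => x /=; rewrite ImV.
apply: is_derive_eq (isdN (isdM f2 dN)) _.
rewrite !(ReM, ImM, ReV, ImV, ReN, ImN) /comp.
move: (complex.Re (f t)) (complex.Im (f t)) (complex.Re d) (complex.Im d) N0 => a b u v N0.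
by field.
Qed.

Lemma is_cderive_expi t : is_cderive t (@expi R) ('i%C * expi t).
Proof.
split.
  by apply: is_derive_eq (is_derive_cos t) _; rewrite ReM/=; ring.
by apply: is_derive_eq (is_derive_sin t) _; rewrite ImM/=; ring.
Qed.

Definition dcauchy_kernel (z : R[i]) t : R[i] := - 'i%C * z * expi t / (expi t - z) ^+ 2.

Lemma is_cderive_cauchy_kernel z t : expi t != z ->
  is_cderive t (cauchy_kernel z) (dcauchy_kernel z t).
Proof.
rewrite -subr_eq0 => h.
have dden : is_cderive t (fun x => expi x - z) ('i%C * expi t).
  by apply: is_cderive_eq (is_cderiveD (is_cderive_expi t) (is_cderive_cst t (- z))) _; rewrite addr0.
apply: is_cderive_eq (is_cderiveM (is_cderive_expi t) (is_cderiveV h dden)) _.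
by rewrite /dcauchy_kernel; field.
Qed.

Lemma is_cderive_continuous t f d : is_cderive t f d ->
  {for t, continuous (fun x => Re (f x))} /\ {for t, continuous (fun x => Im (f x))}.
Proof. by move=> [f1 f2]; split; [exact: is_derive_continuous f1|exact: is_derive_continuous f2]. Qed.

Lemma continuous_dcauchy_kernel z t : expi t != z ->
  {for t, continuous (fun x => Re (dcauchy_kernel z x))} /\
  {for t, continuous (fun x => Im (dcauchy_kernel z x))}.
Proof.
rewrite -subr_eq0 => h.
have dden := is_cderiveD (is_cderive_expi t) (is_cderive_cst t (- z)).
have h2 : (expi t - z) ^+ 2 != 0 by rewrite sqrf_eq0.
have dsq := is_cderiveV h2 (is_cderiveM dden dden).
exact: is_cderive_continuous (is_cderiveM
  (is_cderiveM (is_cderive_cst t (- 'i%C * z)) (is_cderive_expi t)) dsq).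
Qed.

End ComplexDerivative.

(** * Uniqueness and existence of complex Riemann-Stieltjes integrals *)

Section ComplexStieltjes.
Variable R : realType.
Notation mu := (@lebesgue_measure R).
Implicit Types (a b : R) (g f dg Phi : R -> R[i]) (t tau : nat -> R) (I J : R[i]).

Lemma is_RS_integral_unique a b g f I J : a <= b ->
  is_RS_integral a b g f I -> is_RS_integral a b g f J -> I = J.
Proof.
move=> ab HI HJ; apply/eqP; rewrite -subr_eq0 -cabs_eq0.
have [//|n0] := eqVneq (cabs (I - J)) 0.
have e0 : 0 < cabs (I - J) / 2 by rewrite divr_gt0// lt_def n0 cabs_ge0.
have [d1 [d10 H1]] := HI _ e0; have [d2 [d20 H2]] := HJ _ e0.
pose d := Num.min d1 d2; have d0 : 0 < d by rewrite lt_min d10.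
(* More than (b - a) / d equal steps, so that each is shorter than d and one partition serves both
   limits. *)
pose p := (Num.truncn ((b - a) / d)).+1.
pose t k : R := a + (b - a) * k%:R / p%:R.
have p0 : 0 < p%:R :> R by rewrite ltr0n.
have step k : t k.+1 - t k = (b - a) / p%:R.
  by rewrite /t -natr1; field; rewrite gt_eqF.
have tp : tagged_partition a b p t t.
  split=> [||k _]; first by rewrite /t mulr0 mul0r addr0.
    by rewrite /t mulfK ?gt_eqF//; ring.
  by rewrite lexx/= -subr_ge0 step divr_ge0 ?subr_ge0// ltW.
have md : mesh p t < d.
  rewrite /mesh; apply: bigmax_lt => // k _.
  rewrite step ger0_norm ?divr_ge0 ?subr_ge0 ?(ltW p0)//.
  rewrite ltr_pdivrMr// mulrC -ltr_pdivrMr//.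
  by rewrite /p; apply: truncnS_gt.
have := H1 _ _ _ tp (lt_le_trans md _); rewrite ge_min lexx => /(_ isT) h1.
have := H2 _ _ _ tp (lt_le_trans md _); rewrite ge_min lexx orbT => /(_ isT) h2.
move: h1 h2; rewrite !normE !ltcR => h1 h2.
have := cabsD (I - RS_sum g f p t t) (RS_sum g f p t t - J).
rewrite addrA subrK cabsBC => h3.
by have := le_lt_trans h3 (ltrD h1 h2); rewrite -splitr ltxx.
Qed.

Lemma RS_integralE a b g f I : a <= b -> is_RS_integral a b g f I -> RS_integral a b g f = I.
Proof.
move=> ab HI; apply: (is_RS_integral_unique ab _ HI).
by apply: (getPex (P := is_RS_integral a b g f)); exists I.
Qed.

Definition complex_RS a b g dg Phi : R[i] :=
  let J k dk phi := real_RS a b k dk phi in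
  let rp h := fun x : R => Re (h x) in let ip h := fun x : R => Im (h x) in
  (J (rp g) (rp dg) (rp Phi) - J (ip g) (ip dg) (ip Phi)) +i*
  (J (rp g) (rp dg) (ip Phi) + J (ip g) (ip dg) (rp Phi)).

Lemma complex_RS_integral a b g dg Phi B :
  (forall x, cabs (Phi x) <= B) ->
  {ae mu, forall x, {for x, continuous (fun x => Re (Phi x))}} ->
  {ae mu, forall x, {for x, continuous (fun x => Im (Phi x))}} ->
  (forall x, a <= x <= b -> is_cderive x g (dg x)) ->
  (forall x, a <= x <= b -> {for x, continuous (fun x => Re (dg x))} /\
     {for x, continuous (fun x => Im (dg x))}) ->
  is_RS_integral a b g Phi (complex_RS a b g dg Phi).
Proof.
move=> PhiB cr ci dgP cdg e e0.
have Br x : `|Re (Phi x)| <= B by exact: le_trans (Re_le_cabs _) (PhiB x).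
have Bi x : `|Im (Phi x)| <= B by exact: le_trans (Im_le_cabs _) (PhiB x).
have e4 : 0 < e / 4 by rewrite divr_gt0.
have [d1 [d10 H1]] := real_RS_cvg Br cr (fun x h => (dgP x h).1) (fun x h => (cdg x h).1) e4.
have [d2 [d20 H2]] := real_RS_cvg Bi ci (fun x h => (dgP x h).2) (fun x h => (cdg x h).2) e4.
have [d3 [d30 H3]] := real_RS_cvg Bi ci (fun x h => (dgP x h).1) (fun x h => (cdg x h).1) e4.
have [d4 [d40 H4]] := real_RS_cvg Br cr (fun x h => (dgP x h).2) (fun x h => (cdg x h).2) e4.
exists (Num.min (Num.min d1 d2) (Num.min d3 d4)); split; first by rewrite !lt_min d10 d20 d30.
move=> p t tau tp; rewrite !lt_min => /andP[/andP[m1 m2] /andP[m3 m4]].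
have {}H1 := H1 _ _ _ tp m1; have {}H2 := H2 _ _ _ tp m2.
have {}H3 := H3 _ _ _ tp m3; have {}H4 := H4 _ _ _ tp m4.
rewrite normE ltcR (le_lt_trans (cabs_le_parts _))//.
have Er : Re (RS_sum g Phi p t tau) =
    real_RS_sum (fun x => Re (g x)) (fun x => Re (Phi x)) p t tau -
    real_RS_sum (fun x => Im (g x)) (fun x => Im (Phi x)) p t tau.
  rewrite /RS_sum Re_sum -sumrB; apply: eq_bigr => k _.
  by rewrite ReM ReB ImB.
have Ei : Im (RS_sum g Phi p t tau) =
    real_RS_sum (fun x => Re (g x)) (fun x => Im (Phi x)) p t tau +
    real_RS_sum (fun x => Im (g x)) (fun x => Re (Phi x)) p t tau.
  rewrite /RS_sum Im_sum -big_split; apply: eq_bigr => k _.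
  by rewrite ImM ReB ImB.
rewrite ReB ImB Er Ei /complex_RS.
set J1 := real_RS _ _ _ _ _ in H1 *; set J2 := real_RS _ _ _ _ _ in H2 *.
set J3 := real_RS _ _ _ _ _ in H3 *; set J4 := real_RS _ _ _ _ _ in H4 *.
move: H1 H2 H3 H4; set S1 := real_RS_sum _ _ _ _ _; set S2 := real_RS_sum _ _ _ _ _.
set S3 := real_RS_sum _ _ _ _ _; set S4 := real_RS_sum _ _ _ _ _ => H1 H2 H3 H4.
have -> : S1 - S2 - (J1 - J2) = (S1 - J1) - (S2 - J2) by ring.
have -> : S3 + S4 - (J3 + J4) = (S3 - J3) + (S4 - J4) by ring.
have := ler_normB (S1 - J1) (S2 - J2); have := ler_normD (S3 - J3) (S4 - J4).
move: H1 H2 H3 H4; move: (S1 - J1) (S2 - J2) (S3 - J3) (S4 - J4) => {}S1 {}S2 {}S3 {}S4.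
by clear; lra.
Qed.

End ComplexStieltjes.

(** * Kernel estimates *)

Section Trig.
Variable R : realType.
Implicit Types (x y s h a b : R) (n m : nat).

Lemma continuousP (f df : R -> R) : (forall x, is_derive x 1 f (df x)) -> continuous f.
Proof. by move=> H x; exact: is_derive_continuous (H x). Qed.

Lemma sin_nat_pi n : sin (n%:R * pi) = 0 :> R.
Proof.
elim: n => [|n IH]; first by rewrite mul0r sin0.
by rewrite -natr1 mulrDl mul1r sinDpi IH oppr0.
Qed.

Lemma is_derive_sin_lin c x : is_derive x 1 (fun y : R => sin (c * y)) (c * cos (c * x)).
Proof.
have h := is_derive1_comp (is_derive_sin (c * x)) (isdZ c (is_derive_id x 1)).
by apply: is_derive_eq h _; rewrite mulr1 mulrC.
Qed.

Lemma is_derive_cos_lin c x : is_derive x 1 (fun y : R => cos (c * y)) (- (c * sin (c * x))).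
Proof.
have h := is_derive1_comp (is_derive_cos (c * x)) (isdZ c (is_derive_id x 1)).
by apply: is_derive_eq h _; rewrite mulr1 mulrC mulrN.
Qed.

Lemma continuous_sin_lin c : continuous (fun y : R => sin (c * y)).
Proof. exact: continuousP (is_derive_sin_lin c). Qed.

Lemma continuous_cos_lin c : continuous (fun y : R => cos (c * y)).
Proof. exact: continuousP (is_derive_cos_lin c). Qed.

Lemma norm_sin_le x : `|sin x| <= `|x|.
Proof.
wlog x0 : x / 0 <= x.
  move=> H; have [/H//|/ltW x0] := leP 0 x.
  by rewrite -normrN -sinN -[`|x|]normrN H// oppr_ge0.
have [c _] := @MVT_segment R sin cos 0 x x0 (fun y _ => is_derive_sin y)
  (continuous_subspaceT (@continuous_sin R)).
rewrite sin0 !subr0 => ->; rewrite normrM ler_piMl//; exact: cos_max.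
Qed.

Lemma cos_ge_quadratic x : 1 - x ^+ 2 / 2 <= cos x.
Proof.
have -> : cos x = 1 - sin (x / 2) ^+ 2 *+ 2.
  have {1}-> : x = (x / 2) *+ 2 by rewrite mulr2n -splitr.
  by rewrite cos_mulr2n cos2sin2; ring.
have := norm_sin_le (x / 2); rewrite -(@ler_pXn2r _ 2)// ?nnegrE// !real_normK ?num_real//.
rewrite exprMn => h; rewrite lerD2l lerN2 -mulr_natr; lra.
Qed.

(** By the mean value theorem x - sin x = (1 - cos c) x for some c between 0 and x, and 1 - cos c <=
    c^2 / 2. *)
Lemma norm_subr_sin_le x : `|x - sin x| <= `|x| ^+ 3.
Proof.
wlog x0 : x / 0 <= x.
  move=> H; have [/H//|/ltW x0] := leP 0 x.
  have := H (- x); rewrite oppr_ge0 => /(_ x0); rewrite sinN opprK normrN.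
  by rewrite (_ : x - sin x = - (- x + sin x)) ?normrN//; ring.
have [c] := @MVT_segment R sin cos 0 x x0 (fun y _ => is_derive_sin y)
  (continuous_subspaceT (@continuous_sin R)).
rewrite in_itv/= => /andP[c0 cx]; rewrite sin0 !subr0 => ->.
have -> : x - cos c * x = (1 - cos c) * x by ring.
rewrite normrM ger0_norm; last by rewrite subr_ge0 cos_le1.
rewrite exprSr ler_wpM2r// ger0_norm//.
have := cos_ge_quadratic c; have : c ^+ 2 <= x ^+ 2 by rewrite ler_pXn2r.
by have := sqr_ge0 c; lra.
Qed.

(* Far from sharp (Jordan's inequality gives 2/pi), but any constant will do. *)
Lemma sin_ge_quarter x : 0 <= x <= pi / 2 -> x / 4 <= sin x.
Proof.
move=> /andP[x0 xpi]; have /andP[_ pi2] := pihalf_02 R.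
have y1 : x / 2 <= 1 by lra.
have y0 : 0 <= x / 2 by lra.
(* Half the angle is at most 1, where the cosine is at least 1/2; this gives sin(x/2) >= x/4, and
   doubling the angle costs only the factor 2 cos(x/2) >= 1. *)
have cy z : 0 <= z <= x / 2 -> 1 / 2 <= cos z.
  move=> /andP[z0 zx]; have := cos_ge_quadratic z.
  have : z ^+ 2 <= 1 by rewrite expr_le1// (le_trans zx).
  by lra.
have sy : x / 2 / 2 <= sin (x / 2).
  have [c] := @MVT_segment R sin cos 0 (x / 2) y0 (fun y _ => is_derive_sin y)
    (continuous_subspaceT (@continuous_sin R)).
  rewrite in_itv/= sin0 !subr0 => /cy h ->.
  by rewrite mulrC ler_wpM2r//; lra.
have {2}-> : x = (x / 2) *+ 2 by rewrite mulr2n -splitr.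
rewrite sin_mulr2n -mulr_natr.
have h2 : 1 / 2 <= cos (x / 2) by apply: cy; rewrite y0 lexx.
have h3 : 0 <= sin (x / 2) by apply: le_trans sy; lra.
have : 1 / 2 * (x / 2 / 2) <= cos (x / 2) * sin (x / 2) by apply: ler_pM => //; lra.
by lra.
Qed.

Lemma expi_sub1 s : expi s - 1 = 2 * (sin (s / 2))%:C * 'i%C * expi (s / 2) :> R[i].
Proof.
have c2 : cos s = 1 - sin (s / 2) * sin (s / 2) * 2.
  have {1}-> : s = (s / 2) *+ 2 by rewrite mulr2n -splitr.
  by rewrite cos_mulr2n cos2sin2; ring.
have s2 : sin s = sin (s / 2) * cos (s / 2) * 2.
  have {1}-> : s = (s / 2) *+ 2 by rewrite mulr2n -splitr.
  by rewrite sin_mulr2n -mulr_natr; ring.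
have Re_i : Re ('i%C : R[i]) = 0 by [].
have Im_i : Im ('i%C : R[i]) = 1 by [].
have Re_2 : Re (2 : R[i]) = 2 by [].
have Im_2 : Im (2 : R[i]) = 0 by rewrite /= addr0.
have Re_e x : Re (expi x) = cos x :> R by [].
have Im_e x : Im (expi x) = sin x :> R by [].
have Re_1 : Re (1 : R[i]) = 1 by [].
have Im_1 : Im (1 : R[i]) = 0 by [].
by apply: parts_eq; rewrite !(Re_i, Im_i, Re_2, Im_2, Re_e, Im_e, Re_1, Im_1, partsE) ?c2 ?s2; ring.
Qed.

Lemma le_cabs_expi_sub1 s : `|s| <= pi -> `|s| <= 4 * cabs (expi s - 1).
Proof.
move=> spi.
have -> : cabs (expi s - 1) = 2 * `|sin (s / 2)|.
  rewrite expi_sub1 !cabsM cabs_expi mulr1 cabs_real.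
  rewrite cabs_i.
  have -> : cabs 2 = 2 :> R by rewrite (_ : 2 = 2%:C) ?cabs_real ?ger0_norm// rmorph_nat.
  by rewrite mulr1.
have h : `|s / 2| / 4 <= `|sin (s / 2)|.
  wlog s0 : s spi / 0 <= s.
    move=> H; have [/H->//|/ltW s0] := leP 0 s.
    have := H (- s); rewrite normrN oppr_ge0 => /(_ spi s0).
    by rewrite mulNr sinN !normrN.
  rewrite ger0_norm ?divr_ge0// (le_trans _ (ler_norm _))//.
  apply: sin_ge_quarter; rewrite ger0_norm// in spi; lra.
have -> : `|s| = 2 * `|s / 2| by rewrite normrM [`|2^-1|]ger0_norm//; field.
lra.
Qed.

(** This is 1 / |e^(is) - 1|^2, read as 0 at the pole. *)
Definition inv_4sin2 s : R := (4 * sin (s / 2) ^+ 2)^-1.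

Lemma dcauchy_kernel1 s : dcauchy_kernel 1 s = 'i%C * (inv_4sin2 s)%:C.
Proof.
rewrite /dcauchy_kernel expi_sub1 /inv_4sin2.
have [s0|s0] := eqVneq (sin (s / 2)) 0.
  rewrite s0 !expr0n /= !(mulr0, invr0, rmorph0, mul0r).
  by rewrite expr0n/= invr0 !mulr0.
have e2 : expi s = expi (s / 2) ^+ 2 :> R[i].
  by rewrite expr2 -expiD -splitr.
rewrite e2 (fmorphV (real_complex R)) rmorphM rmorphXn/= rmorph_nat.
have i2 : 'i%C * 'i%C = -1 :> R[i] by rewrite -expr2 sqr_i.
have sc0 : (sin (s / 2))%:C != 0 :> R[i] by rewrite -cabs_eq0 cabs_real normr_eq0.
have ei0 := @expi_neq0 R (s / 2).
have ii0 : 'i%C != 0 :> R[i] by apply: contra_eq_neq i2 => ->; rewrite mul0r eq_sym oppr_eq0 oner_eq0.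
move: i2 ii0 ei0 sc0; set I := 'i%C; set E := expi _; set S := (sin _)%:C => i2 ii0 ei0 sc0.
(* [field] ignores that i^2 = -1; inserting (-1) / (i i), which equals 1, leaves an identity between
   rational functions. *)
transitivity (I * ((-1) / (I * I)) * (4 * S ^+ 2)^-1); last first.
  by rewrite i2 divff ?mulr1// oppr_eq0 oner_eq0.
by field; rewrite sc0 ei0 ii0.
Qed.

End Trig.

Section KernelBounds.
Variable R : realType.
Implicit Types (q s x y : R) (z : R[i]).

Section Stolz.
Variables (q : R) (z : R[i]) (s : R).
Hypotheses (q0 : 0 <= q) (z1 : cabs z < 1) (zq : cabs (z - 1) <= q * (1 - cabs z)).
Hypothesis spi : `|s| <= pi.

Let b_ge : 1 - cabs z <= cabs (expi s - z).
Proof.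
have := cabsD (expi s - z) z; rewrite subrK cabs_expi; lra.
Qed.

Lemma Stolz_dist : cabs (z - 1) <= q * cabs (expi s - z).
Proof. by rewrite (le_trans zq)// ler_wpM2l. Qed.

(** In a Stolz angle the pole at z may be replaced by the pole at 1, uniformly in z; this is the
    only way the angle enters the kernel estimates, together with [Stolz_dist]. *)
Lemma Stolz_cmp : cabs (expi s - 1) <= (1 + q) * cabs (expi s - z).
Proof.
have h := cabsD (expi s - z) (z - 1); rewrite addrA subrK in h.
by rewrite (le_trans h)// mulrDl mul1r lerD2l Stolz_dist.
Qed.

Let b_gt0 : 0 < cabs (expi s - z).
Proof. by rewrite (lt_le_trans _ b_ge)// subr_gt0. Qed.

Lemma cabs_dcauchy_kernel : cabs (dcauchy_kernel z s) <= (cabs (expi s - z) ^+ 2)^-1.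
Proof.
rewrite /dcauchy_kernel cabsM cabsV cabsX !cabsM cabs_expi cabsN.
rewrite cabs_i.
by rewrite mul1r mulr1 ler_piMl// ?invr_ge0 ?exprn_ge0 ?cabs_ge0// ltW.
Qed.

(** A bound independent of z, made for dominated convergence; 16 is the square of the 4 in |s| <= 4
    |e^(is) - 1|. *)
Lemma sqr_dcauchy_kernel_bound : s ^+ 2 * cabs (dcauchy_kernel z s) <= 16 * (1 + q) ^+ 2.
Proof.
apply: (@le_trans _ _ (s ^+ 2 * (cabs (expi s - z) ^+ 2)^-1)).
  by rewrite ler_wpM2l ?sqr_ge0 ?cabs_dcauchy_kernel.
rewrite ler_pdivrMr ?exprn_gt0// -real_normK ?num_real//.
have h : `|s| <= 4 * ((1 + q) * cabs (expi s - z)).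
  by rewrite (le_trans (le_cabs_expi_sub1 spi))// ler_wpM2l// Stolz_cmp.
have : `|s| ^+ 2 <= (4 * ((1 + q) * cabs (expi s - z))) ^+ 2.
  by rewrite ler_pXn2r ?nnegrE// (le_trans _ h).
by move=> /le_trans; apply; rewrite !exprMn mulrA; lra.
Qed.

(** Up to the factor - i the numerator of the difference is e^(is) (z - 1) (e^(2is) - z), and
    e^(2is) - z = e^(is) (e^(is) - 1) + (e^(is) - z) has modulus at most (2 + q) |e^(is) - z|. A
    factor z - 1 is gained against one more power of 1/|s|. *)
Lemma dcauchy_kernel_sub1 : s != 0 ->
  cabs (dcauchy_kernel z s - dcauchy_kernel 1 s) * `|s| ^+ 3 <=
    64 * (2 + q) ^+ 2 * cabs (z - 1).
Proof.
move=> s0.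
have a4 := le_cabs_expi_sub1 spi.
have a_gt0 : 0 < cabs (expi s - 1).
  by rewrite -(@pmulr_rgt0 _ 4)// (lt_le_trans _ a4)// normr_gt0.
have wz0 : expi s - z != 0 by rewrite -cabs_eq0 gt_eqF.
have w10 : expi s - 1 != 0 by rewrite -cabs_eq0 gt_eqF.
have -> : dcauchy_kernel z s - dcauchy_kernel 1 s =
   - 'i%C * expi s * (z - 1) * (expi s * (expi s - 1) + (expi s - z)) /
     ((expi s - z) ^+ 2 * (expi s - 1) ^+ 2).
  by rewrite /dcauchy_kernel; field; rewrite wz0 w10.
rewrite !(cabsM, cabsV, cabsX, cabs_expi, cabsN).
rewrite cabs_i.
have num : cabs (expi s * (expi s - 1) + (expi s - z)) <= (2 + q) * cabs (expi s - z).
  rewrite (le_trans (cabsD _ _))// cabsM cabs_expi mul1r.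
  by have := Stolz_cmp; lra.
have cmp := Stolz_cmp.
move: num cmp a4 a_gt0 b_gt0 (cabs_ge0 (z - 1)).
set N := cabs (_ * _ + _); set a := cabs (_ - 1); set b := cabs (_ - z).
set e := cabs (z - 1); set S := `|s| => num cmp a4 a0 b0 e0.
have S0 : 0 <= S by exact: normr_ge0.
have S3 : S ^+ 3 <= 64 * a ^+ 3.
  by rewrite (_ : 64 * a ^+ 3 = (4 * a) ^+ 3); [rewrite ler_pXn2r// nnegrE (le_trans S0)|ring].
have N0 : 0 <= N by exact: cabs_ge0.
have h1 : S ^+ 3 * N <= 64 * a ^+ 3 * ((2 + q) * b) by apply: ler_pM => //; rewrite exprn_ge0.
have h2 : 64 * a ^+ 3 * ((2 + q) * b) <= 64 * (2 + q) ^+ 2 * (b ^+ 2 * a ^+ 2).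
  have h3 : (64 * a ^+ 2 * (2 + q) * b) * a <= (64 * a ^+ 2 * (2 + q) * b) * ((2 + q) * b).
    have h4 : 0 <= 64 * a ^+ 2 * (2 + q) * b.
      by rewrite !mulr_ge0 ?exprn_ge0 ?addr_ge0 ?(ltW a0) ?(ltW b0).
    by rewrite ler_wpM2l// (le_trans cmp)// ler_pM2r//; lra.
  rewrite (_ : 64 * a ^+ 3 * _ = (64 * a ^+ 2 * (2 + q) * b) * a); last by ring.
  by apply: (le_trans h3); rewrite le_eqVlt; apply/orP; left; apply/eqP; ring.
have ba0 : 0 < b ^+ 2 * a ^+ 2 by rewrite mulr_gt0 ?exprn_gt0.
rewrite (_ : _ * S ^+ 3 = (S ^+ 3 * N / (b ^+ 2 * a ^+ 2)) * e); last by ring.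
by rewrite ler_wpM2r// ler_pdivrMr// (le_trans h1).
Qed.

Definition truncated_kernel s : R[i] :=
  if cabs (z - 1) <= `|s| then dcauchy_kernel 1 s else 0.

(** Put eps = |z - 1|. For |s| >= eps the difference estimate applies, and eps^2 + s^2 <= 2 s^2
    doubles its constant 64. For |s| < eps nothing is subtracted, and |k_z| <= 1 / |e^(is) - z|^2 <=
    q^2 / eps^2. *)
Lemma truncated_kernel_bound : `|s| * cabs (dcauchy_kernel z s - truncated_kernel s) <=
  128 * (2 + q) ^+ 2 * (cabs (z - 1) / (cabs (z - 1) ^+ 2 + s ^+ 2)).
Proof.
have e0 : 0 < cabs (z - 1).
  rewrite lt_def cabs_ge0 andbT cabs_eq0 subr_eq0; apply: contraTneq z1 => ->.
  by rewrite (_ : cabs 1 = 1) ?ltxx// /cabs ComplexField.Normc.normc1.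
rewrite -[s ^+ 2]real_normK ?num_real// /truncated_kernel.
have S0 := normr_ge0 s.
case: ifPn => [es|]; last rewrite -ltNge => se.
  have s0 : s != 0 by rewrite -normr_gt0 (lt_le_trans e0).
  have := dcauchy_kernel_sub1 s0.
  move: es e0 S0; set e := cabs (z - 1); set S := `|s|; set C := cabs _ => es e0 S0 h.
  have S1 : 0 < S by exact: lt_le_trans es.
  have es2 : e ^+ 2 <= S ^+ 2 by rewrite ler_pXn2r ?nnegrE// ltW.
  have d0 : 0 < e ^+ 2 + S ^+ 2 by rewrite addr_gt0 ?exprn_gt0.
  rewrite mulrA ler_pdivlMr//.
  apply: (@le_trans _ _ (2 * (C * S ^+ 3))); last by lra.
  have C0 : 0 <= C by exact: cabs_ge0.
  rewrite (_ : 2 * (C * S ^+ 3) = S * C * (S ^+ 2 + S ^+ 2)); last by ring.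
  by rewrite ler_wpM2l ?mulr_ge0// lerD2r.
rewrite subr0; have h1 := cabs_dcauchy_kernel; have h2 := Stolz_dist.
move: se e0 S0 h1 h2 b_gt0; set e := cabs (z - 1); set S := `|s|; set b := cabs (_ - z).
set C := cabs _ => se e0 S0 h1 h2 b0.
have d0 : 0 < e ^+ 2 + S ^+ 2 by rewrite ltr_wpDr ?exprn_ge0 ?exprn_gt0.
rewrite mulrA ler_pdivlMr//.
have C0 : 0 <= C by exact: cabs_ge0.
have h3 : C * e ^+ 2 <= q ^+ 2.
  apply: (@le_trans _ _ ((b ^+ 2)^-1 * (q * b) ^+ 2)).
    by rewrite ler_pM ?exprn_ge0 ?(ltW e0)// ler_pXn2r ?nnegrE ?(ltW e0)// mulr_ge0// ltW.
  by rewrite exprMn mulrCA mulVf ?mulr1// expf_neq0// gt_eqF.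
have h4 : S * C * (e ^+ 2 + S ^+ 2) <= e * C * (e ^+ 2 + e ^+ 2).
  apply: ler_pM; rewrite ?mulr_ge0 ?(ltW d0)//; first by rewrite ler_wpM2r// ltW.
  by rewrite lerD2l ler_pXn2r ?nnegrE ?(ltW e0)// ltW.
apply: (le_trans h4); rewrite (_ : e * C * _ = 2 * (C * e ^+ 2) * e); last by ring.
rewrite ler_wpM2r ?(ltW e0)//.
have h5 : q ^+ 2 <= (2 + q) ^+ 2.
  by rewrite -subr_ge0 (_ : _ - _ = 4 + 4 * q); [have := q0; lra|ring].
have h6 : 0 <= q ^+ 2 by exact: sqr_ge0.
by lra.
Qed.

End Stolz.
End KernelBounds.

(** * Comparison of the Cauchy and Hilbert kernels *)

Section MeasurableTools.
Variable R : realType.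
Notation mu := (@lebesgue_measure R).
Implicit Types (a b c e : R) (f g : R -> R).

Lemma measurable_invr : measurable_fun setT (fun x : R => x^-1).
Proof.
have -> : (fun x : R => x^-1) = (fun x : R => if x == 0 then 0 else x^-1).
  by apply/funext => x; case: eqVneq => // ->; rewrite invr0.
apply: measurable_fun_if => //.
  by apply: measurable_fun_eqr => //; exact: measurable_cst.
rewrite setTI (_ : _ @^-1` _ = [set x : R | x != 0]); last first.
  by apply/seteqP; split => x /=; case: eqVneq.
apply: open_continuous_measurable_fun.
  rewrite (_ : [set x : R | x != 0] = ~` [set 0]); last first.
    by apply/seteqP; split => x /= /eqP.
  by rewrite openC; exact: closed_eq.
by move=> x; rewrite inE/= => x0; exact: inv_continuous.
Qed.

Lemma intg_opp a f : measurable_fun setT f -> bm (- a) a f ->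
  intg (- a) a (fun x => f (- x)) = intg (- a) a f.
Proof.
move=> mf bf; rewrite /intg /Rintegral; congr fine.
have mopp : measurable_fun setT (fun x : R => (- x : measurableTypeR R)) by exact: oppr_measurable.
have pre : (fun x : R => - x) @^-1` `[- a, a] = `[- a, a]%classic.
  by apply/seteqP; split => x /=; rewrite !in_itv/= lerN2 andbC lerNl.
have <- : (\int[pushforward mu (fun x : R => (- x)%R : measurableTypeR R)]_(y in `[(- a)%R, a])
            (f y)%:E = \int[mu]_(x in `[(- a)%R, a]) (f x)%:E)%E.
  apply: (@eq_measure_integral _ _ _ _ mu) => A mA _.
  exact: lebesgue_measureN.
rewrite integral_pushforward ?pre//.
- exact/measurable_EFinP.
- apply: (@bm_integrable R (- a) a (fun x => f (- x))); split.
    by apply: measurable_funTS; exact: (measurableT_comp mf mopp).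
  have [_ [M fM]] := bf; exists M => x /andP[ax xb].
  by rewrite fM// lerN2 xb lerNl.
Qed.

Lemma intg_odd a f : measurable_fun setT f -> bm (- a) a f ->
  (forall x, f (- x) = - f x) -> intg (- a) a f = 0.
Proof.
move=> mf bf fodd; have := intg_opp mf bf.
rewrite (@eq_intg _ _ _ _ (fun x => - f x)) => [|x _]; last exact: fodd.
by rewrite intgN// => /eqP; rewrite eqNr => /eqP.
Qed.

Lemma eq_intg_oo a b f g : a <= b -> bm a b f -> bm a b g ->
  (forall x, a < x < b -> f x = g x) -> intg a b f = intg a b g.
Proof.
move=> ab bf bg fg.
have sub h : bm a b h -> intg a b h = \int[mu]_(x in `]a, b[) h x.
  move=> bh; rewrite /intg -Rintegral_itv_obnd_cbnd; last first.
    apply: integrableS (bm_integrable bh) => //.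
    by apply: subset_itvr; rewrite bnd_simp.
  rewrite -Rintegral_itv_bndo_bndc//.
  apply: integrableS (bm_integrable bh) => //.
  by move=> x /=; rewrite !in_itv/= => /andP[/ltW -> /ltW ->].
rewrite !sub//; apply: eq_Rintegral => x; rewrite inE/= in_itv/=; exact: fg.
Qed.

End MeasurableTools.

(** * Orthogonality of the trigonometric system *)

Section Orthogonality.
Variable R : realType.
Implicit Types (c : R) (n m : nat).
Local Notation pi := (@pi R).
Local Notation I := (intg (- pi) pi).

Lemma bm_cos_lin a b c : bm a b (fun s : R => cos (c * s)).
Proof. by apply: bm_continuous => x _; exact: continuous_cos_lin. Qed.

Lemma bm_sin_lin a b c : bm a b (fun s : R => sin (c * s)).
Proof. by apply: bm_continuous => x _; exact: continuous_sin_lin. Qed.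

Let pipi : - pi <= pi. Proof. by have := pi_ge0 R; lra. Qed.

Lemma intg_cos_lin c : c != 0 -> sin (c * pi) = 0 -> I (fun s => cos (c * s)) = 0.
Proof.
move=> c0 sc0.
have dF x : - pi <= x <= pi -> is_derive x 1 (fun s => c^-1 * sin (c * s)) (cos (c * x)).
  move=> _; apply: is_derive_eq (isdZ c^-1 (is_derive_sin_lin c x)) _.
  by rewrite mulrA mulVf// mul1r.
rewrite (intg_FTC pipi dF (fun x _ => @continuous_cos_lin R c x)).
by rewrite mulrN sinN sc0 oppr0 subrr.
Qed.

Let sinD0 n m : sin ((n%:R + m%:R) * pi) = 0.
Proof. by rewrite -natrD sin_nat_pi. Qed.

Let sinB0 n m : sin ((n%:R - m%:R) * pi) = 0.
Proof. by rewrite mulrBl sinB !sin_nat_pi mul0r mulr0 subrr. Qed.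

Let cosD_sum n m : I (fun s => cos ((n%:R + m%:R) * s)) = 2 * pi *+ (n + m == 0)%N.
Proof.
have [nm0|nm0] := eqVneq (n + m)%N 0%N.
  rewrite (@eq_intg _ _ _ _ (fun=> 1)) => [|s _]; last by rewrite -natrD nm0 mul0r cos0.
  by rewrite intg_cst//= mul1r mulr1n; ring.
by rewrite intg_cos_lin//= -natrD pnatr_eq0.
Qed.

Let cosB_sum n m : I (fun s => cos ((n%:R - m%:R) * s)) = 2 * pi *+ (n == m)%N.
Proof.
have [->|nm] := eqVneq n m.
  rewrite (@eq_intg _ _ _ _ (fun=> 1)) => [|s _]; last by rewrite subrr mul0r cos0.
  by rewrite intg_cst//= mul1r mulr1n; ring.
by rewrite intg_cos_lin//= subr_eq0 eqr_nat.
Qed.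

Lemma intg_cos_cos n m : I (fun s => cos (n%:R * s) * cos (m%:R * s)) =
  pi *+ (n == m)%N + pi *+ (n + m == 0)%N.
Proof.
rewrite (@eq_intg _ _ _ _ (fun s => 2^-1 * (cos ((n%:R - m%:R) * s) + cos ((n%:R + m%:R) * s)))); last first.
  by move=> s _; rewrite mulrBl mulrDl cosB cosD; field.
rewrite intgZ ?intgD ?cosB_sum ?cosD_sum; try exact: bm_cos_lin.
  by case: eqP => _; case: eqP => _ /=; rewrite ?mulr1n ?mulr0n; field.
by apply: bmD; exact: bm_cos_lin.
Qed.

Lemma intg_sin_sin n m : I (fun s => sin (n%:R * s) * sin (m%:R * s)) =
  pi *+ (n == m)%N - pi *+ (n + m == 0)%N.
Proof.
rewrite (@eq_intg _ _ _ _ (fun s => 2^-1 * (cos ((n%:R - m%:R) * s) - cos ((n%:R + m%:R) * s)))); last first.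
  by move=> s _; rewrite mulrBl mulrDl cosB cosD; field.
rewrite intgZ ?intgB ?cosB_sum ?cosD_sum; try exact: bm_cos_lin.
  by case: eqP => _; case: eqP => _ /=; rewrite ?mulr1n ?mulr0n; field.
by apply: bmB; exact: bm_cos_lin.
Qed.

Lemma intg_sin_cos n m : I (fun s => sin (n%:R * s) * cos (m%:R * s)) = 0.
Proof.
have bsc : bm (- pi) pi (fun s => sin (n%:R * s) * cos (m%:R * s)).
  by apply: bmM; [exact: bm_sin_lin|exact: bm_cos_lin].
apply: intg_odd => //; last by move=> x; rewrite !mulrN sinN cosN mulNr.
apply: measurable_funM; apply: continuous_measurable_fun.
  exact: continuous_sin_lin.
exact: continuous_cos_lin.
Qed.

End Orthogonality.

(** * The pairing with the kernel as a power series *)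

Section Moments.
Variable R : realType.
Local Notation pi := (@pi R).
Implicit Types (f g : R -> R) (h k : R -> R[i]) (z c : R[i]) (n M : nat).

Definition cintg f h : R[i] :=
  intg (- pi) pi (fun s => f s * Re (h s)) +i* intg (- pi) pi (fun s => f s * Im (h s)).

Definition cbm h := bm (- pi) pi (fun s => Re (h s)) /\ bm (- pi) pi (fun s => Im (h s)).

Definition cos_coef f n : R := intg (- pi) pi (fun s => f s * cos (n%:R * s)).
Definition sin_coef f n : R := intg (- pi) pi (fun s => f s * sin (n%:R * s)).

Let pipi : - pi <= pi. Proof. by have := pi_ge0 R; lra. Qed.

Lemma cintgZ f h c : bm (- pi) pi f -> cbm h -> cintg f (fun s => c * h s) = c * cintg f h.
Proof.
move=> bf [h1 h2]; have b1 := bmM bf h1; have b2 := bmM bf h2.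
apply: parts_eq; rewrite ?ReM ?ImM /=.
  rewrite -!intgZ// -intgB; try exact: bmZ.
  by apply: eq_intg => s _; rewrite ReM; ring.
rewrite -!intgZ// -intgD; try exact: bmZ.
by apply: eq_intg => s _; rewrite ImM; ring.
Qed.

Lemma cintgB f h k : bm (- pi) pi f -> cbm h -> cbm k ->
  cintg f (fun s => h s - k s) = cintg f h - cintg f k.
Proof.
move=> bf [h1 h2] [k1 k2]; apply: parts_eq; rewrite ?ReB ?ImB /=.
  rewrite -intgB; [|exact: bmM..].
  by apply: eq_intg => s _; rewrite ReB; ring.
rewrite -intgB; [|exact: bmM..].
by apply: eq_intg => s _; rewrite ImB; ring.
Qed.

Lemma cbmZ h c : cbm h -> cbm (fun s => c * h s).
Proof.
move=> [h1 h2]; split.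
  apply: (@bm_eq _ _ _ (fun s => Re c * Re (h s) - Im c * Im (h s))) => [s _|].
    by rewrite ReM.
  by apply: bmB; exact: bmZ.
apply: (@bm_eq _ _ _ (fun s => Re c * Im (h s) + Im c * Re (h s))) => [s _|].
  by rewrite ImM.
by apply: bmD; exact: bmZ.
Qed.

Lemma cbm_sum (h : nat -> R -> R[i]) M : (forall n, cbm (h n)) ->
  cbm (fun s => \sum_(n < M) h n s).
Proof.
move=> hb; split.
  apply: (@bm_eq _ _ _ (fun s => \sum_(n < M) Re (h n s))) => [s _|]; first by rewrite Re_sum.
  by apply: bm_sum => i _; case: (hb i).
apply: (@bm_eq _ _ _ (fun s => \sum_(n < M) Im (h n s))) => [s _|]; first by rewrite Im_sum.
by apply: bm_sum => i _; case: (hb i).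
Qed.

Lemma cintg_sum f (h : nat -> R -> R[i]) M : bm (- pi) pi f -> (forall n, cbm (h n)) ->
  cintg f (fun s => \sum_(n < M) h n s) = \sum_(n < M) cintg f (h n).
Proof.
move=> bf hb; apply: parts_eq; rewrite ?Re_sum ?Im_sum /=.
  rewrite -intg_sum => [|i _]; last by apply: bmM => //; case: (hb i).
  by apply: eq_intg => s _; rewrite Re_sum mulr_sumr.
rewrite -intg_sum => [|i _]; last by apply: bmM => //; case: (hb i).
by apply: eq_intg => s _; rewrite Im_sum mulr_sumr.
Qed.

Lemma cabs_cintg_le f h (C : R) : bm (- pi) pi f -> cbm h ->
  (forall s, - pi <= s <= pi -> `|f s| * cabs (h s) <= C) -> cabs (cintg f h) <= C * (4 * pi).
Proof.
move=> bf [h1 h2] hC; apply: (le_trans (cabs_le_parts _)); rewrite /cintg/=.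
have -> : C * (4 * pi) = C * (pi - - pi) + C * (pi - - pi) by ring.
rewrite -intg_cst//; apply: lerD; apply: intg_norm_le => //.
1,4: exact: bmM.
1,3: exact: bm_cst.
all: move=> s sb; apply: le_trans (hC s sb); rewrite normrM ler_wpM2l//.
  exact: Re_le_cabs.
exact: Im_le_cabs.
Qed.

Lemma cbm_expi n : cbm (fun s => expi (- (n%:R * s))).
Proof.
split; apply: bm_continuous => x _.
  rewrite (_ : (fun _ => _) = (fun s => cos (n%:R * s))); first exact: continuous_cos_lin.
  by apply/funext => s /=; rewrite cosN.
rewrite (_ : (fun _ => _) = (fun s => sin (- n%:R * s))); first exact: continuous_sin_lin.
by apply/funext => s /=; rewrite mulNr.
Qed.

Lemma cintg_expi f n : bm (- pi) pi f ->
  cintg f (fun s => expi (- (n%:R * s))) = cos_coef f n -i* sin_coef f n.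
Proof.
move=> bf; apply: parts_eq => /=; first by apply: eq_intg => s _; rewrite cosN.
rewrite /sin_coef -intgN; last by apply: bmM => //; exact: bm_sin_lin.
by apply: eq_intg => s _; rewrite sinN mulrN.
Qed.

Lemma expi_neq z s : cabs z < 1 -> expi s != z.
Proof. by apply: contraTneq => <-; rewrite cabs_expi ltxx. Qed.

Lemma cbm_dcauchy_kernel z : cabs z < 1 -> cbm (dcauchy_kernel z).
Proof.
move=> z1; split; apply: bm_continuous => x _.
  exact: (continuous_dcauchy_kernel (expi_neq x z1)).1.
exact: (continuous_dcauchy_kernel (expi_neq x z1)).2.
Qed.

(** Partial sums of the Fourier series of [dcauchy_kernel z]: with y = z e^(-is) the kernel is - i y
    / (1 - y)^2, that is - i times the sum of n y^n. *)
Definition kernel_sum z M s : R[i] :=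
  \sum_(n < M) (- 'i%C * n%:R * z ^+ n) * expi (- (n%:R * s)).

Lemma cbm_kernel_sum z M : cbm (kernel_sum z M).
Proof.
apply: (@cbm_sum (fun n s => (- 'i%C * n%:R * z ^+ n) * expi (- (n%:R * s)))) => n.
by apply: cbmZ; exact: cbm_expi.
Qed.

Lemma nexp_sum (y : R[i]) M : (1 - y) ^+ 2 * \sum_(n < M) n%:R * y ^+ n =
  y - M%:R * y ^+ M + (M%:R - 1) * y ^+ M.+1.
Proof.
elim: M => [|M IH]; first by rewrite big_ord0 !expr1; ring.
by rewrite big_ord_recr/= mulrDr IH !exprS -natr1; ring.
Qed.

Lemma kernel_sum_error z M s : cabs z < 1 ->
  cabs (dcauchy_kernel z s - kernel_sum z M s) <=
  2 * (M%:R + 1) * cabs z ^+ M / (1 - cabs z) ^+ 2.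
Proof.
move=> z1; set e := expi s; pose y := z / e.
have e0 : e != 0 by exact: expi_neq0.
have ez0 : e - z != 0 by rewrite subr_eq0 expi_neq.
have cy : cabs y = cabs z by rewrite cabsM cabsV cabs_expi invr1 mulr1.
have y1 : 1 - y != 0.
  by rewrite -(mulfV e0) /y -mulrBl mulf_neq0// invr_neq0.
have y1b : 1 - cabs z <= cabs (1 - y).
  have := cabsD (1 - y) y; rewrite subrK cy /cabs ComplexField.Normc.normc1; lra.
have E1 : dcauchy_kernel z s = - 'i%C * (y / (1 - y) ^+ 2).
  by rewrite /dcauchy_kernel /y -/e; field; rewrite e0 ez0.
have E2 : kernel_sum z M s = - 'i%C * \sum_(n < M) n%:R * y ^+ n.
  rewrite mulr_sumr; apply: eq_bigr => n _.
  rewrite -!mulrA; congr (_ * (_ * _)); rewrite exprMn; congr (_ * _).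
  by rewrite expiN exprVn expiX mulr_natl.
have E3 : \sum_(n < M) n%:R * y ^+ n = (y - M%:R * y ^+ M + (M%:R - 1) * y ^+ M.+1) / (1 - y) ^+ 2.
  by rewrite -nexp_sum mulrC mulKf// expf_neq0.
clearbody y; rewrite E1 E2 E3 -mulrBr -mulrBl cabsM cabsN.
rewrite cabs_i.
rewrite mul1r cabsM cabsV cabsX.
have z0 := cabs_ge0 z.
have cM : cabs (M%:R : R[i]) = M%:R.
  by rewrite (_ : M%:R = (M%:R)%:C) ?cabs_real ?ger0_norm// rmorph_nat.
have num : cabs (y - (y - M%:R * y ^+ M + (M%:R - 1) * y ^+ M.+1)) <= 2 * (M%:R + 1) * cabs z ^+ M.
  rewrite (_ : y - _ = M%:R * y ^+ M + (1 - M%:R) * y * y ^+ M); last by rewrite exprS; ring.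
  rewrite (le_trans (cabsD _ _))// !cabsM cabsX cy cM.
  have : cabs (1 - M%:R) * cabs z <= M%:R + 1.
    have h : cabs (1 - M%:R : R[i]) <= M%:R + 1.
      rewrite (le_trans (cabsD _ _))// cabsN cM addrC lerD2l.
      by rewrite /cabs ComplexField.Normc.normc1.
    by rewrite (le_trans _ h)// ler_piMr ?cabs_ge0// ltW.
  move=> h; have : cabs (1 - M%:R) * cabs z * cabs z ^+ M <= (M%:R + 1) * cabs z ^+ M.
    by rewrite ler_wpM2r// exprn_ge0.
  have : M%:R * cabs z ^+ M <= (M%:R + 1) * cabs z ^+ M by rewrite ler_wpM2r ?exprn_ge0// lerDl.
  by lra.
apply: ler_pM => //; rewrite ?cabs_ge0 ?invr_ge0 ?exprn_ge0 ?cabs_ge0//.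
rewrite lef_pV2 ?posrE ?exprn_gt0 ?subr_gt0//; last by rewrite (lt_le_trans _ y1b)// subr_gt0.
by rewrite ler_pXn2r ?nnegrE ?cabs_ge0 ?subr_ge0// ltW.
Qed.

(** With y the square root of x, (M + 1) y^M stays below 1 / (1 - y), and a factor y^M is left
    over. *)
Lemma cvg_nexp (x : R) : 0 <= x < 1 -> (M%:R + 1) * x ^+ M @[M --> \oo] --> (0 : R).
Proof.
move=> /andP[x0 x1]; pose y := Num.sqrt x.
have y0 : 0 <= y by exact: sqrtr_ge0.
have yy : y ^+ 2 = x by rewrite sqr_sqrtr.
have y1 : y < 1 by rewrite -(@ltr_pXn2r _ 2)// ?nnegrE// yy expr1n.
have bd M : (M%:R + 1) * y ^+ M * (1 - y) <= 1.
  elim: M => [|M IH]; first by rewrite expr0 add0r !mul1r lerBlDl lerDr.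
  have h : y ^+ M.+1 <= 1 by rewrite exprn_ile1// ltW.
  rewrite -natr1 (_ : _ * (1 - y) = y * ((M%:R + 1) * y ^+ M * (1 - y)) + y ^+ M.+1 * (1 - y)); last first.
    by rewrite exprS; ring.
  have h1 : y * ((M%:R + 1) * y ^+ M * (1 - y)) <= y * 1 by rewrite ler_wpM2l.
  have h2 : y ^+ M.+1 * (1 - y) <= 1 * (1 - y) by rewrite ler_wpM2r// subr_ge0 ltW.
  by lra.
have y1' : 0 < 1 - y by rewrite subr_gt0.
apply: (@squeeze_cvgr _ _ _ _ (fun=> 0) (fun M => (1 - y)^-1 * y ^+ M)).
- near=> M; rewrite mulr_ge0 ?exprn_ge0 ?addr_ge0//=.
  rewrite -yy -exprM mulnC exprM expr2 mulrA ler_wpM2r ?exprn_ge0//.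
  by rewrite -[X in _ <= X]mul1r ler_pdivlMr.
- exact: cvg_cst.
- rewrite -[X in _ --> X](mulr0 (1 - y)^-1); apply: cvgM; first exact: cvg_cst.
  by apply: cvg_expr; rewrite ger0_norm.
Unshelve. all: by end_near. Qed.

(** This series gives the exact pairings of constants and of the sine, and later the passage to the
    conjugate function. *)
Lemma cintg_kernel_cvg f z : bm (- pi) pi f -> cabs z < 1 ->
  \sum_(n < M) (- 'i%C * n%:R * z ^+ n) * (cos_coef f n -i* sin_coef f n) @[M --> \oo] -->
  cintg f (dcauchy_kernel z).
Proof.
move=> bf z1; have [_ [B0 fB0]] := bf; pose B := `|B0|.
have fB s : - pi <= s <= pi -> `|f s| <= B.
  by move=> /fB0 /le_trans; apply; exact: ler_norm.
have E M : \sum_(n < M) (- 'i%C * n%:R * z ^+ n) * (cos_coef f n -i* sin_coef f n) =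
    cintg f (kernel_sum z M).
  have := @cintg_sum f (fun n s => (- 'i%C * n%:R * z ^+ n) * expi (- (n%:R * s))) M bf.
  rewrite /kernel_sum => -> => [|n]; last by apply: cbmZ; exact: cbm_expi.
  by apply: eq_bigr => n _; rewrite cintgZ ?cintg_expi//; exact: cbm_expi.
under eq_cvg do rewrite E.
have z0 := cabs_ge0 z.
have sq0 : 0 < (1 - cabs z) ^+ 2 by rewrite exprn_gt0// subr_gt0.
pose K : R := B * 2 / (1 - cabs z) ^+ 2 * (4 * pi).
have bound M : cabs (cintg f (dcauchy_kernel z) - cintg f (kernel_sum z M)) <=
    K * ((M%:R + 1) * cabs z ^+ M).
  rewrite -cintgB//; [|exact: cbm_dcauchy_kernel|exact: cbm_kernel_sum].
  rewrite [X in _ <= X](_ : _ = (B * (2 * (M%:R + 1) * cabs z ^+ M / (1 - cabs z) ^+ 2)) * (4 * pi)); last first.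
    by rewrite /K; ring.
  apply: cabs_cintg_le => //.
    have [h1 h2] := cbm_dcauchy_kernel z1; have [k1 k2] := cbm_kernel_sum z M.
    split.
      by apply: bm_eq (bmB h1 k1) => s _; rewrite ReB.
    by apply: bm_eq (bmB h2 k2) => s _; rewrite ImB.
  move=> s sb; apply: ler_pM; rewrite ?cabs_ge0 ?fB//; exact: kernel_sum_error.
have cK : K * ((M%:R + 1) * cabs z ^+ M) @[M --> \oo] --> (0 : R).
  rewrite -[X in _ --> X](mulr0 K); apply: cvgM; first exact: cvg_cst.
  by apply: cvg_nexp; rewrite z0.
apply/cvgrPdist_lt => -[e e']; rewrite ltcE/= => /andP[/eqP -> e0].
have /cvgrPdist_lt/(_ _ e0) := cK; apply: filterS => M.
rewrite sub0r normrN => h; rewrite normE ltcR (le_lt_trans (bound M))//.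
by rewrite (le_lt_trans _ h)// ler_norm.
Qed.

End Moments.

Section Comparison.
Variable R : realType.
Local Notation pi := (@pi R).
Implicit Types (f g : R -> R) (z : R[i]) (s e q D eps : R) (n : nat).

Let pipi : - pi <= pi. Proof. by have := pi_ge0 R; lra. Qed.

Lemma cvg_parts_unique (u : nat -> R[i]) (a b : R[i]) :
  u @ \oo --> a -> u @ \oo --> b -> a = b.
Proof.
move=> /cvg_parts[a1 a2] /cvg_parts[b1 b2]; apply: parts_eq.
  exact: (cvg_unique _ a1 b1).
exact: (cvg_unique _ a2 b2).
Qed.

Lemma cintg_cst_kernel z : cabs z < 1 -> cintg (fun=> 1) (dcauchy_kernel z) = 0.
Proof.
move=> z1; apply: (cvg_parts_unique (cintg_kernel_cvg (bm_cst (- pi) pi 1) z1)).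
apply: (@cvg_trans _ ((fun=> 0 : R[i]) @ \oo)); last exact: cvg_cst.
apply: near_eq_cvg; near=> M; rewrite big1// => n _.
have -> : sin_coef (fun=> 1 : R) n = 0.
  transitivity (intg (- pi) pi (fun s : R => sin (n%:R * s) * cos (0%:R * s))).
    by apply: eq_intg => s _; rewrite mul0r cos0 mul1r mulr1.
  exact: intg_sin_cos.
have [->|n0] := eqVneq (val n) 0%N; first by rewrite mulr0 !mul0r.
have -> : cos_coef (fun=> 1 : R) n = 0.
  transitivity (intg (- pi) pi (fun s : R => cos (n%:R * s) * cos (0%:R * s))).
    by apply: eq_intg => s _; rewrite mul0r cos0 mul1r mulr1.
  by rewrite intg_cos_cos addn0 (negbTE n0) mulr0n addr0.
by rewrite oppr0 complexr0 mulr0.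
Unshelve. all: by end_near. Qed.

(** Only frequency 1 survives in the series; it contributes (- i z) (- i pi). *)
Lemma cintg_sin_kernel z : cabs z < 1 -> cintg sin (dcauchy_kernel z) = - pi%:C * z.
Proof.
move=> z1.
have bs : bm (- pi) pi sin.
  by apply: bm_eq (bm_sin_lin (- pi) pi 1) => s _; rewrite mul1r.
apply: (cvg_parts_unique (cintg_kernel_cvg bs z1)).
apply: (@cvg_trans _ ((fun=> - pi%:C * z : R[i]) @ \oo)); last exact: cvg_cst.
apply: near_eq_cvg; near=> M.
have M2 : (1 < M)%N by near: M; exact: nbhs_infty_gt.
rewrite (bigD1 (Ordinal M2))//= big1 ?addr0 => [|n n1].
  have -> : cos_coef (@sin R) 1 = 0.
    transitivity (intg (- pi) pi (fun s : R => sin (1%:R * s) * cos (1%:R * s))).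
      by apply: eq_intg => s _; rewrite !mul1r.
    exact: intg_sin_cos.
  have -> : sin_coef (@sin R) 1 = pi.
    transitivity (intg (- pi) pi (fun s : R => sin (1%:R * s) * sin (1%:R * s))).
      by apply: eq_intg => s _; rewrite !mul1r.
    by rewrite intg_sin_sin/= mulr1n subr0.
  by case: z {z1} => a b; apply: parts_eq; rewrite /= ?expr1 /=; ring.
have -> : cos_coef (@sin R) n = 0.
  transitivity (intg (- pi) pi (fun s : R => sin (1%:R * s) * cos (n%:R * s))).
    by apply: eq_intg => s _; rewrite mul1r.
  exact: intg_sin_cos.
have -> : sin_coef (@sin R) n = 0.
  transitivity (intg (- pi) pi (fun s : R => sin (1%:R * s) * sin (n%:R * s))).
    by apply: eq_intg => s _; rewrite mul1r.
  rewrite intg_sin_sin/=; case: eqP => [/esym n1'|_]; last by rewrite mulr0n subr0.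
  by move: n1; rewrite -val_eqE/= n1' eqxx.
by rewrite oppr0 complexr0 mulr0.
Unshelve. all: by end_near. Qed.

Definition trunc_inv_4sin2 eps s : R := if eps <= `|s| then inv_4sin2 s else 0.

(** The principal value after integration by parts, translated so that the boundary point is 0. The
    kernel is even and of order 1/s^2: a limit as [eps] tends to 0 rests on cancellation between s
    and - s. *)
Definition trunc_hilbert f eps : R :=
  intg (- pi) pi (fun s => (f s - f 0) * trunc_inv_4sin2 eps s).

Lemma measurable_inv_4sin2 : measurable_fun setT (@inv_4sin2 R).
Proof.
apply: (measurableT_comp (@measurable_invr R)); apply: measurable_funM.
  exact: measurable_cst.
apply: measurable_funX; apply: continuous_measurable_fun.
rewrite (_ : (fun _ => _) = (fun s => sin (2^-1 * s))); first exact: continuous_sin_lin.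
by apply/funext => s; rewrite mulrC.
Qed.

Lemma measurable_trunc eps : measurable_fun setT (trunc_inv_4sin2 eps).
Proof.
apply: measurable_fun_ifT; [|exact: measurable_inv_4sin2|exact: measurable_cst].
by apply: measurable_fun_ler; [exact: measurable_cst|exact: normr_measurable].
Qed.

Lemma inv_4sin2_ge0 s : 0 <= inv_4sin2 s.
Proof. by rewrite invr_ge0 mulr_ge0// sqr_ge0. Qed.

Lemma inv_4sin2_le s : `|s| <= pi -> s != 0 -> inv_4sin2 s <= 16 / s ^+ 2.
Proof.
move=> spi s0; have h := le_cabs_expi_sub1 spi.
have : cabs (dcauchy_kernel 1 s) = inv_4sin2 s.
  rewrite dcauchy_kernel1 cabsM cabs_real ger0_norm ?inv_4sin2_ge0//.
  by rewrite {1}/cabs/= expr0n expr1n add0r sqrtr1 mul1r.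
rewrite /dcauchy_kernel !(cabsM, cabsV, cabsX, cabs_expi, cabsN).
rewrite cabs_i.
rewrite (_ : cabs 1 = 1); last by rewrite /cabs ComplexField.Normc.normc1.
rewrite !mul1r => <-.
have a0 : 0 < cabs (expi s - 1).
  by rewrite -(@pmulr_rgt0 _ 4)// (lt_le_trans _ h)// normr_gt0.
have s2 : 0 < s ^+ 2 by rewrite exprn_even_gt0.
rewrite -[_^-1]mul1r ler_pdivrMr ?exprn_gt0// mulrAC ler_pdivlMr// mul1r.
have : `|s| ^+ 2 <= (4 * cabs (expi s - 1)) ^+ 2 by rewrite ler_pXn2r ?nnegrE// (le_trans _ h).
by rewrite real_normK ?num_real// exprMn; lra.
Qed.

Lemma bm_trunc eps : 0 < eps -> bm (- pi) pi (trunc_inv_4sin2 eps).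
Proof.
move=> e0; split; first by apply: measurable_funTS; exact: measurable_trunc.
exists (16 / eps ^+ 2) => s sb; rewrite /trunc_inv_4sin2.
have p0 : 0 < eps ^+ 2 by rewrite exprn_gt0.
case: ifPn => [es|_]; last by rewrite normr0 divr_ge0// ltW.
rewrite ger0_norm ?inv_4sin2_ge0//.
have s0 : s != 0 by rewrite -normr_gt0 (lt_le_trans e0).
rewrite (le_trans (inv_4sin2_le _ s0)) ?ler_norml//.
rewrite ler_wpM2l// lef_pV2 ?posrE ?exprn_even_gt0 ?(gt_eqF e0)//.
by rewrite -[s ^+ 2]real_normK ?num_real// ler_pXn2r ?nnegrE// ltW.
Qed.

Lemma truncated_kernelE z s :
  truncated_kernel z s = 'i%C * (trunc_inv_4sin2 (cabs (z - 1)) s)%:C.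
Proof.
rewrite /truncated_kernel /trunc_inv_4sin2; case: ifP => _; first exact: dcauchy_kernel1.
by rewrite rmorph0 mulr0.
Qed.

Lemma intg_sin_trunc eps : 0 < eps ->
  intg (- pi) pi (fun s => sin s * trunc_inv_4sin2 eps s) = 0.
Proof.
move=> e0.
have cs : continuous (@sin R) by exact: continuous_sin.
apply: intg_odd.
- by apply: measurable_funM; [exact: continuous_measurable_fun|exact: measurable_trunc].
- by apply: bmM; [apply: bm_continuous => x _; exact: cs|exact: bm_trunc].
- move=> s; rewrite sinN mulNr; congr (- (_ * _)).
  by rewrite /trunc_inv_4sin2 /inv_4sin2 normrN mulNr sinN sqrrN.
Qed.

(** Differentiability at 0 without a quotient, so that s = 0 is allowed; other points are reached by
    translating f. *)
Definition derivable_at0 f D :=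
  forall e, 0 < e -> exists d, 0 < d /\ forall s, `|s| < d -> `|f s - f 0 - D * s| <= e * `|s|.

(** For |s| < d this is differentiability and |s - sin s| <= |s|^3. For |s| >= d the left side is at
    most 2 M + |D|, which |s|^3 / d^3 absorbs. The linear term has an arbitrarily small coefficient,
    and the cubic one cancels the singularity. *)
Lemma sine_remainder_bound f D M eta : (forall x, `|f x| <= M) -> derivable_at0 f D ->
  0 < eta -> exists B, 0 <= B /\ forall s, `|f s - f 0 - D * sin s| <= `|s| * (eta + B * s ^+ 2).
Proof.
move=> fM fD eta0; have [d [d0 H]] := fD _ eta0.
have M0 : 0 <= M by rewrite (le_trans _ (fM 0)).
exists (`|D| + (M + M + `|D|) / d ^+ 3); split.
  by rewrite addr_ge0// divr_ge0 ?addr_ge0 ?exprn_ge0// ltW.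
move=> s; rewrite -[s ^+ 2]real_normK ?num_real//.
have S0 := normr_ge0 s; have D0 := normr_ge0 D.
have C0 : 0 <= (M + M + `|D|) / d ^+ 3 by rewrite divr_ge0 ?addr_ge0 ?exprn_ge0// ltW.
have S3 : 0 <= `|s| ^+ 3 by rewrite exprn_ge0.
have -> : `|s| * (eta + (`|D| + (M + M + `|D|) / d ^+ 3) * `|s| ^+ 2) =
  eta * `|s| + `|D| * `|s| ^+ 3 + (M + M + `|D|) / d ^+ 3 * `|s| ^+ 3 by ring.
have [sd|ds] := ltP `|s| d.
  have -> : f s - f 0 - D * sin s = (f s - f 0 - D * s) + D * (s - sin s) by ring.
  rewrite (le_trans (ler_normD _ _))// normrM.
  have h1 := H _ sd; have h2 := norm_subr_sin_le s.
  have h3 : `|D| * `|s - sin s| <= `|D| * `|s| ^+ 3 by rewrite ler_wpM2l.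
  have h4 : 0 <= (M + M + `|D|) / d ^+ 3 * `|s| ^+ 3 by rewrite mulr_ge0.
  by lra.
have h1 : `|f s - f 0 - D * sin s| <= M + M + `|D|.
  rewrite (le_trans (ler_normB _ _))// normrM lerD//.
    by rewrite (le_trans (ler_normB _ _))// lerD.
  by rewrite ler_piMr// sin_max.
have h2 : M + M + `|D| <= (M + M + `|D|) / d ^+ 3 * `|s| ^+ 3.
  rewrite -mulrA ler_peMr ?addr_ge0// mulrC ler_pdivlMr ?exprn_gt0// mul1r.
  by rewrite ler_pXn2r ?nnegrE// ltW.
have h3 : 0 <= eta * `|s| by rewrite mulr_ge0// ltW.
have h4 : 0 <= `|D| * `|s| ^+ 3 by rewrite mulr_ge0.
by lra.
Qed.

Lemma intg_poisson_bound eps : 0 < eps ->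
  bm (- pi) pi (fun s => eps / (eps ^+ 2 + s ^+ 2)) /\
  intg (- pi) pi (fun s => eps / (eps ^+ 2 + s ^+ 2)) <= pi.
Proof.
move=> e0.
have den s : 0 < eps ^+ 2 + s ^+ 2 by rewrite ltr_wpDr ?sqr_ge0 ?exprn_gt0.
have dF x : - pi <= x <= pi ->
    is_derive x 1 (fun s => atan (eps^-1 * s)) (eps / (eps ^+ 2 + x ^+ 2)).
  move=> _.
  have h := is_derive1_comp (is_derive1_atan (eps^-1 * x)) (isdZ eps^-1 (is_derive_id x 1)).
  apply: is_derive_eq h _; have := den x; rewrite mulr1 => dx.
  by field; rewrite !gt_eqF.
have cf x : - pi <= x <= pi -> {for x, continuous (fun s => eps / (eps ^+ 2 + s ^+ 2))}.
  move=> _; apply: cvgM; first exact: cvg_cst.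
  apply: cvgV; first by rewrite gt_eqF.
  apply: cvgD; first exact: cvg_cst.
  exact: exprn_continuous.
split; first exact: bm_continuous.
rewrite (intg_FTC pipi dF cf).
have := atan_ltpi2 (eps^-1 * pi); have := atan_gtNpi2 (eps^-1 * - pi).
by lra.
Qed.

(** In f = f 0 + D sin + F the first two terms are paired exactly, and F is paired with the
    difference between k_z and the truncated kernel. The truncated kernel is purely imaginary, so
    |Re k_z| is already bounded by that difference and no singular integral is left in the real
    part. *)
Lemma kernel_comparison f D q e : bounded_borel f -> derivable_at0 f D -> 0 <= q -> 0 < e ->
  exists d, 0 < d /\ forall z, cabs z < 1 -> cabs (z - 1) <= q * (1 - cabs z) ->
    cabs (z - 1) < d ->
    `|Re (cintg f (dcauchy_kernel z)) + pi * D| <= e /\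
    `|Im (cintg f (dcauchy_kernel z)) - trunc_hilbert f (cabs (z - 1))| <= e.
Proof.
move=> bf fD q0 e0; have [_ [M fM]] := bf.
pose K := 128 * (2 + q) ^+ 2.
have K0 : 0 < K by rewrite mulr_gt0// exprn_gt0// ltr_wpDr.
have KE : K = 128 * (2 + q) ^+ 2 by [].
clearbody K.
have pi0 := pi_gt0 R.
(* The Poisson integral is at most pi, so the linear part of the remainder contributes at most K eta
   pi = e / 2. *)
pose eta := e / (2 * (K * pi)).
have eta0 : 0 < eta by rewrite divr_gt0// mulr_gt0// mulr_gt0.
have Keta : K * (eta * pi) = e / 2.
  have gen (p : R) : 0 < p -> K * (e / (2 * (K * p)) * p) = e / 2 by move=> p0; field; rewrite !gt_eqF.
  exact: gen.
clearbody eta.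
have [B [B0 FB]] := sine_remainder_bound fM fD eta0.
(* A collects what is proportional to |z - 1|: the cubic part of the remainder, integrated over a
   length 2 pi, and the error of replacing z by 1 in the pairing of the sine. *)
pose A := 2 * pi * (K * B) + pi * `|D|.
have A0 : 0 <= A.
  by apply: addr_ge0; apply: mulr_ge0 => //; [apply: mulr_ge0 => //; exact: ltW|apply: mulr_ge0 => //; exact: ltW|exact: ltW].
exists (e / (2 * (A + 1))); split; first by rewrite divr_gt0// mulr_gt0// ltr_wpDl.
move=> z z1 zq zd; set eps := cabs (z - 1) in zq zd *.
have eps0 : 0 < eps.
  rewrite /eps lt_def cabs_ge0 andbT cabs_eq0 subr_eq0; apply: contraTneq z1 => ->.
  by rewrite (_ : cabs 1 = 1) ?ltxx// /cabs ComplexField.Normc.normc1.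
have [bp pp] := intg_poisson_bound eps0.
pose F s := f s - f 0 - D * sin s.
have bsin : bm (- pi) pi (fun s => sin s) by apply: bm_continuous => x _; exact: continuous_sin.
have bf' : bm (- pi) pi f by exact: bounded_borel_bm.
have bF : bm (- pi) pi F.
  by apply: bmB; [apply: bmB => //; exact: bm_cst|exact: bmZ].
have [k1 k2] := cbm_dcauchy_kernel z1.
have bt := bm_trunc eps0.
(* The second term uses s^2 / (eps^2 + s^2) <= 1. *)
pose m s := K * (eta * (eps / (eps ^+ 2 + s ^+ 2)) + B * eps).
have bmm : bm (- pi) pi m by apply: bmZ; apply: bmD; [exact: bmZ|exact: bm_cst].
have im : intg (- pi) pi m <= e / 2 + 2 * pi * (K * B) * eps.
  rewrite /m intgZ; last by apply: bmD; [exact: bmZ|exact: bm_cst].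
  rewrite intgD; [|exact: bmZ|exact: bm_cst].
  rewrite intgZ// intg_cst//.
  have : K * (eta * intg (- pi) pi (fun s => eps / (eps ^+ 2 + s ^+ 2))) <= K * (eta * pi).
    by rewrite ler_wpM2l ?(ltW K0)// ler_wpM2l ?(ltW eta0).
  rewrite Keta.
  by lra.
have Aeps : 2 * pi * (K * B) * eps + pi * `|D| * eps <= e / 2.
  rewrite -mulrDl -/A; have : eps * (2 * (A + 1)) <= e.
    by rewrite -ler_pdivlMr ?ltW// mulr_gt0// ltr_wpDl.
  by move: (ltW eps0); lra.
have Fm s : - pi <= s <= pi ->
    `|F s| * cabs (dcauchy_kernel z s - truncated_kernel z s) <= m s.
  move=> sb; have spi : `|s| <= pi by rewrite ler_norml.
  have := truncated_kernel_bound q0 z1 zq spi; rewrite -/eps -KE.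
  set C := cabs _ => hC; have C0 : 0 <= C by exact: cabs_ge0.
  apply: (@le_trans _ _ (`|s| * (eta + B * s ^+ 2) * C)); first by rewrite ler_wpM2r//; exact: FB.
  have s2 : 0 <= s ^+ 2 by exact: sqr_ge0.
  have d0 : 0 < eps ^+ 2 + s ^+ 2 by rewrite ltr_wpDr ?exprn_gt0.
  apply: (@le_trans _ _ ((eta + B * s ^+ 2) * (K * (eps / (eps ^+ 2 + s ^+ 2))))).
    by rewrite mulrAC mulrC ler_wpM2l//; apply: addr_ge0; [exact: ltW|exact: mulr_ge0].
  rewrite /m mulrCA ler_wpM2l ?(ltW K0)// mulrDl lerD2l -mulrA ler_wpM2l//.
  rewrite mulrCA ler_piMr ?(ltW eps0)// ler_pdivrMr// mul1r lerDr; apply: exprn_ge0; exact: ltW.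
have decomp k : bm (- pi) pi k -> intg (- pi) pi (fun s => f s * k s) =
    intg (- pi) pi (fun s => F s * k s) + f 0 * intg (- pi) pi (fun s => 1 * k s) +
    D * intg (- pi) pi (fun s => sin s * k s).
  move=> bk; rewrite -!intgZ; [|exact: bmM|by apply: bmM => //; exact: bm_cst].
  have b1 : bm (- pi) pi (fun s => F s * k s) by exact: bmM.
  have b2 : bm (- pi) pi (fun s => f 0 * (1 * k s)).
    by apply: bmZ; apply: bmM => //; exact: bm_cst.
  have b3 : bm (- pi) pi (fun s => D * (sin s * k s)) by apply: bmZ; exact: bmM.
  rewrite -intgD// -intgD//; last exact: bmD.
  by apply: eq_intg => s _; rewrite /F; ring.
have c1 := cintg_cst_kernel z1; have c2 := cintg_sin_kernel z1.
have Rez : `|1 - Re z| <= eps.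
  rewrite distrC; have -> : Re z - 1 = Re (z - 1) by rewrite ReB.
  exact: Re_le_cabs.
have Imz : `|Im z| <= eps.
  by rewrite (_ : Im z = Im (z - 1)); [exact: Im_le_cabs|rewrite ImB/= subr0].
split.
  rewrite [Re _]/= decomp//.
  have -> : intg (- pi) pi (fun s => 1 * Re (dcauchy_kernel z s)) = 0.
    by have := congr1 (@complex.Re R) c1.
  have -> : intg (- pi) pi (fun s => sin s * Re (dcauchy_kernel z s)) = - pi * Re z.
    by have := congr1 (@complex.Re R) c2; rewrite ReM /= => ->; ring.
  have -> : forall I, I + f 0 * 0 + D * (- pi * Re z) + pi * D = I + pi * D * (1 - Re z).
    by move=> I; ring.
  have h1 : `|intg (- pi) pi (fun s => F s * Re (dcauchy_kernel z s))| <= intg (- pi) pi m.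
    apply: intg_norm_le => //; first exact: bmM.
    move=> s sb; apply: le_trans (Fm s sb); rewrite normrM ler_wpM2l//.
    rewrite (_ : Re _ = Re (dcauchy_kernel z s - truncated_kernel z s)); first exact: Re_le_cabs.
    by rewrite ReB truncated_kernelE ReM /=; ring.
  have h2 : `|pi * D * (1 - Re z)| <= pi * `|D| * eps.
    by rewrite !normrM (ger0_norm (ltW pi0)) ler_wpM2l// mulr_ge0// ltW.
  by rewrite (le_trans (ler_normD _ _))//; lra.
rewrite [Im _]/= decomp// /trunc_hilbert.
have -> : intg (- pi) pi (fun s => 1 * Im (dcauchy_kernel z s)) = 0.
  by have := congr1 (@complex.Im R) c1.
have -> : intg (- pi) pi (fun s => sin s * Im (dcauchy_kernel z s)) = - pi * Im z.
  by have := congr1 (@complex.Im R) c2; rewrite ImM /= => ->; ring.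
have b1 : bm (- pi) pi (fun s => F s * trunc_inv_4sin2 eps s) by exact: bmM.
have b3 : bm (- pi) pi (fun s => D * (sin s * trunc_inv_4sin2 eps s)).
  by apply: bmZ; exact: bmM.
have -> : intg (- pi) pi (fun s => (f s - f 0) * trunc_inv_4sin2 eps s) =
    intg (- pi) pi (fun s => F s * trunc_inv_4sin2 eps s).
  transitivity (intg (- pi) pi (fun s => F s * trunc_inv_4sin2 eps s + D * (sin s * trunc_inv_4sin2 eps s))).
    by apply: eq_intg => s _; rewrite /F; ring.
  by rewrite intgD// intgZ ?intg_sin_trunc ?mulr0 ?addr0//; exact: bmM.
have -> : forall I J, I + f 0 * 0 + D * (- pi * Im z) - J = (I - J) - pi * D * Im z.
  by move=> I J; ring.
rewrite -intgB//; last exact: bmM.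
have h1 : `|intg (- pi) pi (fun s => F s * Im (dcauchy_kernel z s) - F s * trunc_inv_4sin2 eps s)|
    <= intg (- pi) pi m.
  apply: intg_norm_le => //; first by apply: bmB => //; exact: bmM.
  move=> s sb; apply: le_trans (Fm s sb); rewrite -mulrBr normrM ler_wpM2l//.
  rewrite (_ : _ - _ = Im (dcauchy_kernel z s - truncated_kernel z s)); first exact: Im_le_cabs.
  by rewrite ImB truncated_kernelE -/eps ImM /=; ring.
have h2 : `|pi * D * Im z| <= pi * `|D| * eps.
  by rewrite !normrM (ger0_norm (ltW pi0)) ler_wpM2l// mulr_ge0// ltW.
by rewrite (le_trans (ler_normB _ _))//; lra.
Qed.

End Comparison.

(** * The conjugate function of a Lipschitz function *)

Section TrigPolynomials.
Variable R : realType.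
Local Notation pi := (@pi R).
Implicit Types (f g : R -> R) (a b : nat -> R) (x s t h tau : R) (n m N M : nat).

Let pipi : - pi <= pi. Proof. by have := pi_ge0 R; lra. Qed.

(** Index n carries the frequency n + 1: there is no constant term, and coefficients can be divided
    by the frequency. *)
Definition trig_poly a b M N s : R :=
  \sum_(M <= n < N) (a n * cos (n.+1%:R * s) + b n * sin (n.+1%:R * s)).

Lemma bm_trig_poly a b M N x y : bm x y (trig_poly a b M N).
Proof.
apply: bm_sum => n _; apply: bmD; apply: bmZ; first exact: bm_cos_lin.
exact: bm_sin_lin.
Qed.

Lemma cos_coef_trig_poly a b M N m : cos_coef (trig_poly a b M N) m.+1 =
  \sum_(M <= n < N) (pi * a n *+ (n == m)).
Proof.
have E s : - pi <= s <= pi -> trig_poly a b M N s * cos (m.+1%:R * s) =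
   \sum_(M <= n < N) (a n * (cos (n.+1%:R * s) * cos (m.+1%:R * s)) +
                      b n * (sin (n.+1%:R * s) * cos (m.+1%:R * s))).
  by move=> _; rewrite mulr_suml; apply: eq_bigr => n _; ring.
have bcc n : bm (- pi) pi (fun s => cos (n.+1%:R * s) * cos (m.+1%:R * s)).
  by apply: bmM; exact: bm_cos_lin.
have bsc n : bm (- pi) pi (fun s => sin (n.+1%:R * s) * cos (m.+1%:R * s)).
  by apply: bmM; [exact: bm_sin_lin|exact: bm_cos_lin].
rewrite /cos_coef (eq_intg E) intg_sum => [|n _]; last by apply: bmD; exact: bmZ.
apply: eq_bigr => n _; rewrite intgD ?intgZ//; try exact: bmZ.
rewrite intg_cos_cos intg_sin_cos addSn eqSS/= mulr0n addr0 mulr0 addr0.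
by rewrite mulrC mulrnAl.
Qed.

Lemma sin_coef_trig_poly a b M N m : sin_coef (trig_poly a b M N) m.+1 =
  \sum_(M <= n < N) (pi * b n *+ (n == m)).
Proof.
have E s : - pi <= s <= pi -> trig_poly a b M N s * sin (m.+1%:R * s) =
   \sum_(M <= n < N) (a n * (sin (m.+1%:R * s) * cos (n.+1%:R * s)) +
                      b n * (sin (n.+1%:R * s) * sin (m.+1%:R * s))).
  by move=> _; rewrite mulr_suml; apply: eq_bigr => n _; ring.
have bcc n : bm (- pi) pi (fun s => sin (n.+1%:R * s) * sin (m.+1%:R * s)).
  by apply: bmM; exact: bm_sin_lin.
have bsc n : bm (- pi) pi (fun s => sin (m.+1%:R * s) * cos (n.+1%:R * s)).
  by apply: bmM; [exact: bm_sin_lin|exact: bm_cos_lin].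
rewrite /sin_coef (eq_intg E) intg_sum => [|n _]; last by apply: bmD; exact: bmZ.
apply: eq_bigr => n _; rewrite intgD ?intgZ//; try exact: bmZ.
rewrite intg_sin_sin intg_sin_cos addSn eqSS/= mulr0n subr0 mulr0 add0r.
by rewrite mulrC mulrnAl.
Qed.

Lemma intg_trig_poly f a b M N : bm (- pi) pi f ->
  intg (- pi) pi (fun s => f s * trig_poly a b M N s) =
  \sum_(M <= n < N) (a n * cos_coef f n.+1 + b n * sin_coef f n.+1).
Proof.
move=> bf.
have E s : - pi <= s <= pi -> f s * trig_poly a b M N s =
   \sum_(M <= n < N) (a n * (f s * cos (n.+1%:R * s)) + b n * (f s * sin (n.+1%:R * s))).
  by move=> _; rewrite mulr_sumr; apply: eq_bigr => n _; ring.
have bc n : bm (- pi) pi (fun s => f s * cos (n.+1%:R * s)).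
  by apply: bmM => //; exact: bm_cos_lin.
have bs n : bm (- pi) pi (fun s => f s * sin (n.+1%:R * s)).
  by apply: bmM => //; exact: bm_sin_lin.
rewrite (eq_intg E) intg_sum => [|n _]; last by apply: bmD; exact: bmZ.
by apply: eq_bigr => n _; rewrite intgD ?intgZ//; exact: bmZ.
Qed.

Lemma intg_sqr_trig_poly a b M N : intg (- pi) pi (fun s => trig_poly a b M N s ^+ 2) =
  pi * \sum_(M <= n < N) (a n ^+ 2 + b n ^+ 2).
Proof.
have -> : intg (- pi) pi (fun s => trig_poly a b M N s ^+ 2) =
    intg (- pi) pi (fun s => trig_poly a b M N s * trig_poly a b M N s).
  by apply: eq_intg => s _; rewrite expr2.
rewrite intg_trig_poly; last exact: bm_trig_poly.
rewrite mulr_sumr big_nat [RHS]big_nat; apply: eq_bigr => n /andP[Mn nN].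
have pick (F : nat -> R) : \sum_(M <= i < N) (pi * F i *+ (i == n)) = pi * F n.
  rewrite (bigD1_seq n) ?mem_index_iota ?Mn ?iota_uniq//= eqxx mulr1n big1 ?addr0//.
  by move=> i /negbTE ->; rewrite mulr0n.
by rewrite cos_coef_trig_poly sin_coef_trig_poly !pick; ring.
Qed.

(** Expand the integral of (pi f - P)^2 >= 0, where P has the unnormalized coefficients of f; the
    factor pi in front of f makes up for the missing 1/pi. *)
Lemma bessel f N : bm (- pi) pi f ->
  \sum_(0 <= n < N) (cos_coef f n.+1 ^+ 2 + sin_coef f n.+1 ^+ 2) <=
  pi * intg (- pi) pi (fun s => f s ^+ 2).
Proof.
move=> bf; set Q := \sum_(_ <= _ < _) _.
pose c n := cos_coef f n.+1; pose d n := sin_coef f n.+1.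
have pi0 := pi_gt0 R.
have bP := bm_trig_poly c d 0 N (- pi) pi.
have h : 0 <= intg (- pi) pi (fun s => (pi * f s - trig_poly c d 0 N s) ^+ 2).
  by apply: intg_ge0 => s _; exact: sqr_ge0.
have bf2 : bm (- pi) pi (fun s => f s ^+ 2).
  by apply: bm_eq (bmM bf bf) => s _; rewrite expr2.
have bP2 : bm (- pi) pi (fun s => trig_poly c d 0 N s ^+ 2).
  by apply: bm_eq (bmM bP bP) => s _; rewrite expr2.
have bfP : bm (- pi) pi (fun s => f s * trig_poly c d 0 N s) by exact: bmM.
have e2 : intg (- pi) pi (fun s => (pi * f s - trig_poly c d 0 N s) ^+ 2) =
    pi ^+ 2 * intg (- pi) pi (fun s => f s ^+ 2) - 2 * pi * Q + pi * Q.
  transitivity (intg (- pi) pi (fun s => pi ^+ 2 * f s ^+ 2 -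
      2 * pi * (f s * trig_poly c d 0 N s) + trig_poly c d 0 N s ^+ 2)).
    by apply: eq_intg => s _; ring.
  rewrite intgD//; last by apply: bmB; exact: bmZ.
  rewrite intgB; [|exact: bmZ..].
  rewrite !intgZ// intg_sqr_trig_poly intg_trig_poly//.
move: h; rewrite e2 => h.
rewrite -(@ler_pM2l _ pi)//.
by move: h; rewrite expr2; lra.
Qed.

Lemma periodic_cos_lin n : periodic (fun s : R => cos (n%:R * s)) (2 * pi).
Proof.
move=> s; have -> : n%:R * (s + 2 * pi) = n%:R * s + n%:R * (pi *+ 2).
  by rewrite -mulr_natl; ring.
elim: n (n%:R * s) => [|k IHk] y; first by rewrite mul0r addr0.
by rewrite -natr1 mulrDl mul1r addrA cosD2pi IHk.
Qed.

Lemma periodic_sin_lin n : periodic (fun s : R => sin (n%:R * s)) (2 * pi).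
Proof.
move=> s; have -> : n%:R * (s + 2 * pi) = n%:R * s + n%:R * (pi *+ 2).
  by rewrite -mulr_natl; ring.
elim: n (n%:R * s) => [|k IHk] y; first by rewrite mul0r addr0.
by rewrite -natr1 mulrDl mul1r addrA sinD2pi IHk.
Qed.

Section Translation.
Variables (G : R -> R).
Hypotheses (bG : bounded_borel G) (pG : periodic G (2 * pi)).

Let intgT (u : R -> R) h : bounded_borel u -> periodic u (2 * pi) ->
  intg (- pi) pi (fun s => u (s + h)) = intg (- pi) pi u.
Proof.
move=> bu pu; have := @intg_periodic R (- pi) (2 * pi) h u _ bu pu.
have -> : - pi + 2 * pi = pi by ring.
by apply; have := pi_ge0 R; lra.
Qed.

Let bb_cos n : bounded_borel (fun s : R => cos (n%:R * s)).
Proof.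
split; first by apply: continuous_measurable_fun; exact: continuous_cos_lin.
by exists 1 => x; exact: cos_max.
Qed.

Let bb_sin n : bounded_borel (fun s : R => sin (n%:R * s)).
Proof.
split; first by apply: continuous_measurable_fun; exact: continuous_sin_lin.
by exists 1 => x; exact: sin_max.
Qed.

Let bmG : bm (- pi) pi G. Proof. exact: bounded_borel_bm. Qed.
Let bGc n : bm (- pi) pi (fun s => G s * cos (n%:R * s)).
Proof. by apply: bmM => //; exact: bm_cos_lin. Qed.
Let bGs n : bm (- pi) pi (fun s => G s * sin (n%:R * s)).
Proof. by apply: bmM => //; exact: bm_sin_lin. Qed.

Lemma cos_coef_shift h n : cos_coef (fun s => G (s + h)) n =
  cos (n%:R * h) * cos_coef G n + sin (n%:R * h) * sin_coef G n.
Proof.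
rewrite /cos_coef /sin_coef -!intgZ// -intgD; [|exact: bmZ..].
rewrite -(intgT (u := fun u => cos (n%:R * h) * (G u * cos (n%:R * u)) +
   sin (n%:R * h) * (G u * sin (n%:R * u))) h).
- apply: eq_intg => s _.
  have -> : n%:R * s = n%:R * (s + h) - n%:R * h by ring.
  by rewrite cosB; ring.
- split; last first.
    have [_ [A uA]] := bounded_borelM bG (bb_cos n); have [_ [B vB]] := bounded_borelM bG (bb_sin n).
    exists (A + B) => x; rewrite (le_trans (ler_normD _ _))// lerD// normrM.
      by rewrite -[X in _ <= X]mul1r ler_pM// cos_max.
    by rewrite -[X in _ <= X]mul1r ler_pM// sin_max.
  have [m1 _] := bounded_borelM bG (bb_cos n); have [m2 _] := bounded_borelM bG (bb_sin n).
  by apply: measurable_funD; apply: measurable_funM => //; exact: measurable_cst.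
- by move=> u; rewrite pG periodic_cos_lin periodic_sin_lin.
Qed.

Lemma sin_coef_shift h n : sin_coef (fun s => G (s + h)) n =
  cos (n%:R * h) * sin_coef G n - sin (n%:R * h) * cos_coef G n.
Proof.
rewrite /cos_coef /sin_coef -!intgZ// -intgB; [|exact: bmZ..].
rewrite -(intgT (u := fun u => cos (n%:R * h) * (G u * sin (n%:R * u)) -
   sin (n%:R * h) * (G u * cos (n%:R * u))) h).
- apply: eq_intg => s _.
  have -> : n%:R * s = n%:R * (s + h) - n%:R * h by ring.
  by rewrite sinB; ring.
- split; last first.
    have [_ [A uA]] := bounded_borelM bG (bb_cos n); have [_ [B vB]] := bounded_borelM bG (bb_sin n).
    exists (B + A) => x; rewrite (le_trans (ler_normB _ _))// lerD// normrM.
      by rewrite -[X in _ <= X]mul1r ler_pM// cos_max.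
    by rewrite -[X in _ <= X]mul1r ler_pM// sin_max.
  have [m1 _] := bounded_borelM bG (bb_cos n); have [m2 _] := bounded_borelM bG (bb_sin n).
  by apply: measurable_funB; apply: measurable_funM => //; exact: measurable_cst.
- by move=> u; rewrite pG periodic_cos_lin periodic_sin_lin.
Qed.

(* Bessel's inequality for the difference [G (s + h) - G (s - h)] with [h = 1 / N],
   so that [sin (n h) >= n h / 4] for the frequencies [n <= N]. *)
Lemma lipschitz_coef_bound L N : (forall x y, `|G x - G y| <= L * `|x - y|) ->
  \sum_(0 <= n < N) n.+1%:R ^+ 2 * (cos_coef G n.+1 ^+ 2 + sin_coef G n.+1 ^+ 2) <=
  32 * pi ^+ 2 * L ^+ 2.
Proof.
move=> GL.
have [->|N0] := posnP N.
  rewrite big_geq//; apply: mulr_ge0; last exact: sqr_ge0.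
  by apply: mulr_ge0 => //; exact: sqr_ge0.
pose h : R := N%:R^-1; have h0 : 0 < h by rewrite invr_gt0 ltr0n.
pose f s := G (s + h) - G (s + - h).
have bs c : bm (- pi) pi (fun s => G (s + c)) by exact/bounded_borel_bm/bounded_borel_shift.
have bf : bm (- pi) pi f by exact: bmB.
have cf n : cos_coef f n = 2 * sin (n%:R * h) * sin_coef G n.
  have := cos_coef_shift h n; have := cos_coef_shift (- h) n.
  rewrite mulrN cosN sinN => e1 e2.
  transitivity (cos_coef (fun s => G (s + h)) n - cos_coef (fun s => G (s + - h)) n).
    rewrite /cos_coef -intgB; [|by apply: bmM => //; exact: bm_cos_lin..].
    by apply: eq_intg => s _; rewrite mulrBl.
  by rewrite e1 e2; ring.
have sf n : sin_coef f n = - 2 * sin (n%:R * h) * cos_coef G n.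
  have := sin_coef_shift h n; have := sin_coef_shift (- h) n.
  rewrite mulrN cosN sinN => e1 e2.
  transitivity (sin_coef (fun s => G (s + h)) n - sin_coef (fun s => G (s + - h)) n).
    rewrite /sin_coef -intgB; [|by apply: bmM => //; exact: bm_sin_lin..].
    by apply: eq_intg => s _; rewrite mulrBl.
  by rewrite e1 e2; ring.
have B := bessel N bf.
have up : intg (- pi) pi (fun s => f s ^+ 2) <= 4 * L ^+ 2 * h ^+ 2 * (2 * pi).
  have -> : 2 * pi = pi - - pi by ring.
  rewrite -intg_cst//; apply: le_intg; last 1 first.
  - move=> s _; rewrite -[f s ^+ 2]real_normK ?num_real//.
    have : `|f s| <= 2 * L * h.
      have := GL (s + h) (s + - h); rewrite (_ : s + h - (s + - h) = 2 * h); last by ring.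
      rewrite [`|2 * h|]ger0_norm; last by rewrite mulr_ge0// ltW.
      by rewrite (_ : L * (2 * h) = 2 * L * h)//; ring.
    move=> hf; have : `|f s| ^+ 2 <= (2 * L * h) ^+ 2.
      by rewrite ler_pXn2r ?nnegrE// (le_trans _ hf).
    by move=> /le_trans; apply; rewrite !exprMn; lra.
  - by apply: bm_eq (bmM bf bf) => s _; rewrite expr2.
  - exact: bm_cst.
have low : \sum_(0 <= n < N) n.+1%:R ^+ 2 * (cos_coef G n.+1 ^+ 2 + sin_coef G n.+1 ^+ 2) <=
    4 * (h ^+ 2)^-1 * \sum_(0 <= n < N) (cos_coef f n.+1 ^+ 2 + sin_coef f n.+1 ^+ 2).
  rewrite mulr_sumr big_nat [X in _ <= X]big_nat; apply: ler_sum => n /andP[_ nN].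
  rewrite cf sf !exprMn.
  have -> : forall S C D : R, 4 * (h ^+ 2)^-1 * (2 ^+ 2 * S * C + (- 2) ^+ 2 * S * D) =
      (16 * (h ^+ 2)^-1 * S) * (D + C) by move=> *; ring.
  rewrite ler_wpM2r ?addr_ge0 ?sqr_ge0//.
  have nh0 : 0 <= n.+1%:R * h by rewrite mulr_ge0// ltW.
  have nh : n.+1%:R * h <= 1 by rewrite ler_pdivrMr ?ltr0n// mul1r ler_nat.
  have : n.+1%:R * h / 4 <= sin (n.+1%:R * h).
    apply: sin_ge_quarter; rewrite nh0/= (le_trans nh)//.
    by have := pi_ge2 R; lra.
  move=> hs; have : (n.+1%:R * h / 4) ^+ 2 <= sin (n.+1%:R * h) ^+ 2.
    by rewrite ler_pXn2r ?nnegrE ?(le_trans _ hs) ?divr_ge0.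
  rewrite !exprMn => hs2.
  have hh : 0 < h ^+ 2 by rewrite exprn_gt0.
  rewrite mulrAC ler_pdivlMr//.
  have e16 : (4 : R)^-1 ^+ 2 = 16^-1 by rewrite exprVn; congr _^-1; ring.
  by move: hs2; rewrite e16; lra.
(* The constant: (4 / h^2) from the lower bound, pi from Bessel, and 4 L^2 h^2 times 2 pi from the
   Lipschitz bound multiply to 32 pi^2 L^2. *)
apply: (le_trans low).
have hh : 0 < h ^+ 2 by rewrite exprn_gt0.
rewrite mulrAC ler_pdivrMr// -mulrA.
have pi0 := pi_gt0 R.
have : pi * intg (- pi) pi (fun s => f s ^+ 2) <= pi * (4 * L ^+ 2 * h ^+ 2 * (2 * pi)).
  by rewrite ler_wpM2l// ltW.
by move: B; rewrite [pi ^+ 2]expr2; lra.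
Qed.

End Translation.
End TrigPolynomials.

(** * Termwise integration of series summable in L^1 *)

Section L1Series.
Variable R : realType.
Notation mu := (@lebesgue_measure R).
Implicit Types (a b x y e C : R) (q : nat -> R) (u : nat -> R -> R) (n m N k : nat).

Lemma nonneg_series_tail q C : (forall n, 0 <= q n) ->
  (forall N, \sum_(0 <= n < N) q n <= C) ->
  forall e, 0 < e -> exists N, forall n m, (N <= n)%N -> \sum_(n <= i < m) q i <= e.
Proof.
move=> q0 qC e e0; pose s N := \sum_(0 <= n < N) q n.
have sm n m : (n <= m)%N -> s m = s n + \sum_(n <= i < m) q i.
  by move=> nm; rewrite /s (@big_cat_nat _ _ _ n).
have ss : has_sup (range s).
  by split; [exists (s 0%N); exists 0%N|exists C => _ [n _ <-]; exact: qC].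
have [_ [N _ <-] hN] := sup_adherent e0 ss.
exists N => n m Nn; have [mn|/ltnW nm] := leqP m n; first by rewrite big_geq// ltW.
have h1 : s m <= sup (range s) by apply: ub_le_sup; [exact: ss.2|exists m].
have h2 : 0 <= \sum_(N <= i < n) q i by apply: sumr_ge0.
by move: h1; rewrite (sm n m nm) (sm N n Nn); lra.
Qed.

(** The sum U of all |u k| has a finite integral, hence is finite a.e.; there the series converges
    absolutely, and U dominates all partial sums on every subinterval. *)
Lemma L1_series u a b C : a <= b ->
  (forall k, measurable_fun setT (u k)) -> (forall k, bm a b (u k)) ->
  (forall n, \sum_(0 <= k < n) intg a b (fun x => `|u k x|) <= C) ->
  exists h : R -> R, mu.-integrable `[a, b] (EFin \o h) /\
    forall y, a <= y <= b ->
      intg a y (fun x => \sum_(0 <= k < n) u k x) @[n --> \oo] --> intg a y h.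
Proof.
move=> ab mu_ bu uC.
pose s n x := \sum_(0 <= k < n) u k x.
pose U x := (\sum_(0 <= k <oo) (`|u k x|)%:E)%E.
have U0 x : (0 <= U x)%E by apply: nneseries_ge0 => k _ _; rewrite lee_fin.
have mnu k : measurable_fun setT (fun x => `|u k x|).
  by apply: measurableT_comp => //; exact: mu_.
have mU : measurable_fun `[a, b]%classic U.
  apply: ge0_emeasurable_sum => [k x _ _|k _]; first by rewrite lee_fin.
  by apply/measurable_EFinP; apply: measurable_funTS; exact: mnu.
have bnu k : bm a b (fun x => `|u k x|) by exact: bm_norm.
have inu k : (\int[mu]_(x in `[a, b]) (`|u k x|)%:E = (intg a b (fun x => `|u k x|))%:E)%E.
  rewrite /intg /Rintegral fineK//.
  exact: (integrable_fin_num _ (bm_integrable (bnu k))).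
have iU : (\int[mu]_(x in `[a, b]) U x <= C%:E)%E.
  rewrite integral_nneseries//.
  - apply: lime_le; first by apply: is_cvg_nneseries => k _ _; apply: integral_ge0 => x _; rewrite lee_fin.
    apply: nearW => n; under eq_bigr do rewrite inu.
    by rewrite sumEFin lee_fin.
  - by move=> k; apply/measurable_EFinP; apply: measurable_funTS; exact: mnu.
have intU : mu.-integrable `[a, b] U.
  apply/integrableP; split => //; apply: le_lt_trans (ltry C).
  by under eq_integral do rewrite gee0_abs//.
have Ufin : {ae mu, forall x, a <= x <= b -> U x \is a fin_num}.
  have H : {ae mu, forall x, `[a, b]%classic x -> U x \is a fin_num} by apply: integrable_ae intU.
  by apply: ae_mono H => x; rewrite /= in_itv.
have su n x : (`|s n x|%:E <= U x)%E.
  apply: le_trans (nneseries_lim_ge n _); last by move=> k _ _; rewrite lee_fin.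
  by rewrite sumEFin lee_fin; exact: ler_norm_sum.
(* The upper limit is measurable everywhere, whether or not the series converges; it is the sum
   wherever U is finite. *)
pose h x := fine (limn_esup (fun n => (s n x)%:E)).
have ms n : measurable_fun setT (s n).
  by apply: measurable_sum => k; exact: mu_.
have mh : measurable_fun setT h.
  apply: (measurableT_comp (f := @fine R)); first exact: fine_measurable.
  apply: measurable_fun_limn_esup => n.
  by apply/measurable_EFinP; exact: ms.
have cvgs x : U x \is a fin_num -> s n x @[n --> \oo] --> h x.
  move=> Ux.
  have csx : cvgn (s ^~ x).
    rewrite (_ : s ^~ x = series (fun k => u k x)); last first.
      by apply/funext => n; rewrite /s /series/= .
    apply: (@normed_cvg R R); apply: nondecreasing_is_cvgn.
      apply: nondecreasing_series => k _ _; exact: normr_ge0.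
    exists (fine (U x)) => _ [n _ <-]; rewrite -lee_fin fineK//.
    rewrite /series/= -sumEFin.
    by apply: nneseries_lim_ge => k _ _; rewrite lee_fin.
  have ce : (s n x)%:E @[n --> \oo] --> (limn (s ^~ x))%:E.
    by apply: cvg_EFin; [exact: nearW|exact: csx].
  have -> : h x = limn (s ^~ x); last exact: csx.
  rewrite /h is_cvg_limn_esupE; last by apply/cvg_ex; eexists; exact: ce.
  by rewrite (cvg_lim _ ce).
have dct y : a <= y <= b -> mu.-integrable `[a, y] (EFin \o h) /\
    (\int[mu]_(x in `[a, y]) (s n x)%:E)%E @[n --> \oo] --> (\int[mu]_(x in `[a, y]) (h x)%:E)%E.
  move=> /andP[ay yb].
  have sub : `[a, y] `<=` `[a, b].
    by move=> x /=; rewrite !in_itv/= => /andP[-> /le_trans]; apply.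
  have [|||||ih _ ch] := @dominated_convergence _ _ _ mu `[a, y]%classic (measurable_itv _)
    (fun n x => (s n x)%:E) (fun x => (h x)%:E) U.
  - by move=> n; apply/measurable_EFinP; apply: measurable_funTS; exact: ms.
  - by apply/measurable_EFinP; apply: measurable_funTS.
  - apply: ae_mono Ufin => x H; rewrite /= in_itv/= => /andP[ax xy].
    apply: cvg_EFin; first exact: nearW.
    by apply: cvgs; apply: H; rewrite ax (le_trans xy).
  - exact: integrableS intU.
  - by apply: ae_everywhere => x n _; exact: su.
  by split.
have [ih _] := dct b (introT andP (conj ab (lexx b))).
exists h; split=> // y ayb; have [ihy chy] := dct y ayb.
have : (\int[mu]_(x in `[a, y]) (s n x)%:E)%E @[n --> \oo] --> (intg a y h)%:E.
  rewrite /intg /Rintegral fineK//.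
  exact: (integrable_fin_num _ ihy).
by move/fine_cvgP => [_].
Qed.

End L1Series.

(** * Primitives of trigonometric series with square-summable coefficients *)

Section ConjugateSeries.
Variable R : realType.
Notation mu := (@lebesgue_measure R).
Local Notation pi := (@pi R).
Implicit Types (F : R -> R) (x y s e D C : R) (n m N M k : nat).

Let pipi : - pi <= pi. Proof. by have := pi_ge0 R; lra. Qed.

Lemma derivable_at0_quotient F x D :
  (F (x + h) - F x) / h @[h --> 0^'] --> D -> derivable_at0 (fun s => F (s + x)) D.
Proof.
move=> /cvgrPdist_le H e e0; have := H e e0.
rewrite near_withinE => /nbhs_ballP[d /= d0 Hd].
exists d; split => // s sd; rewrite add0r.
have [->|s0] := eqVneq s 0; first by rewrite add0r subrr mulr0 subrr !normr0 mulr0.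
have := Hd s; rewrite -ball_normE /= sub0r normrN => /(_ sd s0).
rewrite distrC addrC => h.
rewrite (_ : F (s + x) - F x - D * s = ((F (x + s) - F x) / s - D) * s); last first.
  by rewrite [x + s]addrC; field.
by rewrite normrM ler_wpM2r// addrC.
Qed.

Lemma derivable_at0_is_derive F x D : is_derive x 1 F D -> derivable_at0 (fun s => F (s + x)) D.
Proof.
move=> [dF FD]; apply: derivable_at0_quotient; rewrite -FD.
apply: cvg_trans dF; apply: near_eq_cvg; near=> h.
by rewrite /GRing.scale/= mulr1 [h + x]addrC mulrC.
Unshelve. all: by end_near. Qed.

Section Coefficients.
Variables (a b : nat -> R) (S : R).
Hypothesis abS : forall N, \sum_(0 <= n < N) (a n ^+ 2 + b n ^+ 2) <= S.

(** Coefficients of the primitive: a cos(kx) + b sin(kx) integrates to (a/k) sin(kx) - (b/k)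
    cos(kx). *)
Let A n : R := - b n / n.+1%:R.
Let B n : R := a n / n.+1%:R.

Let is_derive_conj M N x : is_derive x 1 (trig_poly A B M N) (trig_poly a b M N x).
Proof.
have [MN|NM] := leqP M N; last first.
  rewrite (_ : trig_poly A B M N = cst 0); last first.
    by apply/funext => y; rewrite /trig_poly big_geq// ltnW.
  by rewrite /trig_poly big_geq ?(ltnW NM)//; exact: is_derive_cst.
elim: N MN => [|N IH] MN.
  rewrite (_ : trig_poly A B M 0 = cst 0); last first.
    by apply/funext => y; rewrite /trig_poly big_geq.
  by rewrite /trig_poly big_geq//; exact: is_derive_cst.
move: MN; rewrite leq_eqVlt => /predU1P[->|MN].
  rewrite (_ : trig_poly A B _ _ = cst 0); last first.
    by apply/funext => y; rewrite /trig_poly big_geq.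
  by rewrite /trig_poly big_geq//; exact: is_derive_cst.
rewrite (_ : trig_poly A B M N.+1 = fun y => trig_poly A B M N y +
    (A N * cos (N.+1%:R * y) + B N * sin (N.+1%:R * y))); last first.
  by apply/funext => y; rewrite /trig_poly big_nat_recr.
have h := isdD (IH MN) (isdD (isdZ (A N) (is_derive_cos_lin N.+1%:R x))
  (isdZ (B N) (is_derive_sin_lin N.+1%:R x))).
apply: is_derive_eq h _; rewrite {2}/trig_poly big_nat_recr//=; congr (_ + _).
by rewrite /A /B; field; rewrite addrC natr1 pnatr_eq0.
Qed.

Let w n : R := `|A n| + `|B n|.

(** The inequality |xy| <= (x^2 + y^2) / 2 with y the inverse of the frequency: square-summable a, b
    yield absolutely summable A, B. *)
Let w_le n : w n <= 2^-1 * (a n ^+ 2 + b n ^+ 2) + n.+1%:R^-1 ^+ 2.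
Proof.
have amgm (x y : R) : `|x * y| <= 2^-1 * (x ^+ 2 + y ^+ 2).
  rewrite -[x ^+ 2]real_normK ?num_real// -[y ^+ 2]real_normK ?num_real// normrM.
  by have := sqr_ge0 (`|x| - `|y|); rewrite sqrrB mulr2n; lra.
have h1 := amgm (- b n) n.+1%:R^-1; have h2 := amgm (a n) n.+1%:R^-1.
move: h1 h2; rewrite /w /A /B sqrrN; move: (n.+1%:R^-1) => i h1 h2.
by move: (`|- b n * i|) (`|a n * i|) h1 h2 => u v h1 h2; lra.
Qed.

Let inv_sq_sum N : \sum_(0 <= n < N) (n.+1%:R^-1 ^+ 2 : R) <= 2.
Proof.
(* The bound 2 - 1/N telescopes. N = 0 is kept apart because 1/N is read as 0 there, from which the
   induction would not start. *)
suff H : N = 0%N \/ \sum_(0 <= n < N) (n.+1%:R^-1 ^+ 2 : R) <= 2 - N%:R^-1.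
  case: H => [->|/le_trans]; first by rewrite big_geq.
  by apply; rewrite gerBl invr_ge0.
elim: N => [|N IH]; [by left|right].
rewrite big_nat_recr//=; case: IH => [->|IH].
  by rewrite big_geq// invr1 expr1n; lra.
case: N IH => [|N] IH; first by rewrite big_geq// invr1 expr1n; lra.
apply: (le_trans (lerD IH (lexx _))).
have n1 : 0 < N.+1%:R :> R by rewrite ltr0n.
rewrite -[N.+2%:R]natr1; set p : R := N.+1%:R in n1 *.
have : (p + 1)^-1 ^+ 2 <= p^-1 - (p + 1)^-1.
  have -> : p^-1 - (p + 1)^-1 = (p + 1)^-1 * p^-1.
    by field; rewrite !gt_eqF//; lra.
  have p1 : 0 < p + 1 by lra.
  by rewrite expr2 ler_wpM2l ?invr_ge0 ?(ltW p1)// lef_pV2 ?posrE//; lra.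
by move: (p^-1) ((p + 1)^-1) => i j; lra.
Qed.

Let w_sum N : \sum_(0 <= n < N) w n <= 2^-1 * S + 2.
Proof.
apply: (@le_trans _ _ (\sum_(0 <= n < N) (2^-1 * (a n ^+ 2 + b n ^+ 2) + n.+1%:R^-1 ^+ 2))).
  by apply: ler_sum => n _; exact: w_le.
rewrite big_split/= -mulr_sumr lerD ?inv_sq_sum//.
by rewrite ler_wpM2l.
Qed.

Let w0 n : 0 <= w n. Proof. by rewrite addr_ge0. Qed.

Let T_bound M N x : `|trig_poly A B M N x| <= \sum_(M <= n < N) w n.
Proof.
apply: (le_trans (ler_norm_sum _ _ _)); apply: ler_sum => n _.
rewrite (le_trans (ler_normD _ _))// [`|A n * _|]normrM [`|B n * _|]normrM /w; apply: lerD; rewrite ler_piMr//;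
  [exact: cos_max|exact: sin_max].
Qed.

Let T_split M N x : (M <= N)%N ->
  trig_poly A B 0 N x = trig_poly A B 0 M x + trig_poly A B M N x.
Proof. by move=> MN; rewrite /trig_poly (@big_cat_nat _ _ _ M). Qed.

Let F x : R := limn (fun N => trig_poly A B 0 N x).

Let F_cvg x : trig_poly A B 0 N x @[N --> \oo] --> F x.
Proof.
suff : cvgn (fun N => trig_poly A B 0 N x) by [].
rewrite (_ : (fun N => _) = series (fun n => A n * cos (n.+1%:R * x) + B n * sin (n.+1%:R * x)))//.
apply: (@normed_cvg R R); apply: nondecreasing_is_cvgn.
  by apply: nondecreasing_series => k _ _; exact: normr_ge0.
exists (2^-1 * S + 2) => _ [N _ <-]; apply: le_trans (w_sum N).
apply: ler_sum => n _.
by rewrite (le_trans (ler_normD _ _))// [`|A n * _|]normrM [`|B n * _|]normrM /w; apply: lerD; rewrite ler_piMr//;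
  [exact: cos_max|exact: sin_max].
Qed.

Let F_unif e : 0 < e -> exists N0, forall N, (N0 <= N)%N ->
  forall x, `|F x - trig_poly A B 0 N x| <= e.
Proof.
move=> e0; have [N0 H] := nonneg_series_tail w0 w_sum e0.
exists N0 => N NN x.
have c : `|trig_poly A B 0 M x - trig_poly A B 0 N x| @[M --> \oo] --> `|F x - trig_poly A B 0 N x|.
  by apply: cvg_norm; apply: cvgB; [exact: F_cvg|exact: cvg_cst].
rewrite -(cvg_lim _ c)//; apply: limr_le; first by apply/cvg_ex; eexists; exact: c.
near=> M; rewrite (@T_split N M); last by near: M; exact: nbhs_infty_ge.
by rewrite addrAC subrr add0r (le_trans (T_bound _ _ _))// H.
Unshelve. all: by end_near. Qed.

Let F_bound x : `|F x| <= 2^-1 * S + 2.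
Proof.
have c : `|trig_poly A B 0 M x| @[M --> \oo] --> `|F x| by apply: cvg_norm; exact: F_cvg.
rewrite -(cvg_lim _ c)//; apply: limr_le; first by apply/cvg_ex; eexists; exact: c.
by apply: nearW => N; rewrite (le_trans (T_bound _ _ _)).
Qed.

Let measurable_trig_poly (c d : nat -> R) M N : measurable_fun setT (trig_poly c d M N).
Proof.
apply: measurable_sum => n; apply: measurable_funD; apply: measurable_funM.
- exact: measurable_cst.
- by apply: continuous_measurable_fun; exact: continuous_cos_lin.
- exact: measurable_cst.
- by apply: continuous_measurable_fun; exact: continuous_sin_lin.
Qed.

Let F_borel : bounded_borel F.
Proof.
split; last by exists (2^-1 * S + 2).
apply: (@measurable_fun_cvg _ _ _ _ (fun N => trig_poly A B 0 N)) => [N|x _].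
  exact: measurable_trig_poly.
exact: F_cvg.
Qed.

Let F_periodic : periodic F (2 * pi).
Proof.
move=> x; have E N : trig_poly A B 0 N (x + 2 * pi) = trig_poly A B 0 N x.
  by apply: eq_bigr => n _; rewrite periodic_cos_lin periodic_sin_lin.
have c : trig_poly A B 0 N (x + 2 * pi) @[N --> \oo] --> F x.
  by under eq_cvg do rewrite E; exact: F_cvg.
exact: (cvg_unique _ (@F_cvg (x + 2 * pi)) c).
Qed.

(** The blocks have L^2 norms of order 2^-k and so summable L^1 norms: along K the series of a, b
    converges in L^1. *)
Let block_seq : exists K : nat -> nat,
  (forall k, (K k < K k.+1)%N) /\
  forall k, \sum_(K k <= n < K k.+1) (a n ^+ 2 + b n ^+ 2) <= (4 ^+ k)^-1.
Proof.
have q0 n : 0 <= a n ^+ 2 + b n ^+ 2 by rewrite addr_ge0// sqr_ge0.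
have H k : exists N, forall n m, (N <= n)%N -> \sum_(n <= i < m) (a i ^+ 2 + b i ^+ 2) <= (4 ^+ k)^-1.
  by apply: (nonneg_series_tail q0 abS); rewrite invr_gt0 exprn_gt0.
have [N_ HN] := choice H.
pose fix K k := if k is k'.+1 then (maxn (K k') (N_ k)).+1 else N_ 0%N.
exists K; split=> k; first by rewrite /= ltnS leq_maxl.
apply: HN; case: k => [//|k] /=.
by rewrite (leq_trans (leq_maxr (K k) _)).
Qed.

(** Let h be the L^1 sum of the blocks. Up to the polynomial of frequencies below the first block, F
    is a primitive of h, and so it is differentiable at the Lebesgue points of h. *)
Lemma conjugate_function : exists F,
  [/\ bounded_borel F, periodic F (2 * pi),
    forall e, 0 < e -> exists N0, forall N, (N0 <= N)%N -> forall x,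
      `|F x - trig_poly (fun n => - b n / n.+1%:R) (fun n => a n / n.+1%:R) 0 N x| <= e &
    {ae mu, forall x, - pi < x < pi -> exists D, derivable_at0 (fun s => F (s + x)) D}].
Proof.
exists F; split => //.
have [K [Kincr HK]] := block_seq.
have K_ge k : (k <= K k)%N by elim: k => // k IH; exact: leq_ltn_trans IH (Kincr k).
have pi0 := pi_gt0 R.
pose u k x := trig_poly a b (K k) (K k.+1) x.
have bu k : bm (- pi) pi (u k) by exact: bm_trig_poly.
have mu_ k : measurable_fun setT (u k) by exact: measurable_trig_poly.
have l1 k : intg (- pi) pi (fun x => `|u k x|) <= pi * (3 / 2) / 2 ^+ k.
  have p2 : 0 < 2 ^+ k :> R by rewrite exprn_gt0.
  have bu2 : bm (- pi) pi (fun x => u k x ^+ 2).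
    by apply: bm_eq (bmM (bu k) (bu k)) => x _; rewrite expr2.
  (* From v <= (P v^2 + 1/P) / 2 with P = 2^k, the weight that balances the bound 4^-k on the
     squares. *)
  apply: (@le_trans _ _ (intg (- pi) pi (fun x => 2^-1 * 2 ^+ k * u k x ^+ 2 + 2^-1 * (2 ^+ k)^-1))).
    apply: le_intg; [exact: bm_norm|by apply: bmD; [exact: bmZ|exact: bm_cst]|].
    move=> x _; rewrite -[u k x ^+ 2]real_normK ?num_real//.
    move: (2 ^+ k) `|u k x| p2 => P v p2; rewrite -subr_ge0.
    rewrite (_ : _ - _ = 2^-1 * P^-1 * (P * v - 1) ^+ 2); last by field; rewrite gt_eqF.
    by rewrite mulr_ge0 ?sqr_ge0// mulr_ge0// invr_ge0 ltW.
  rewrite intgD; [|exact: bmZ|exact: bm_cst].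
  rewrite intgZ// intg_cst//.
  rewrite intg_sqr_trig_poly.
  have h := HK k.
  have h2 : 2^-1 * 2 ^+ k * (pi * \sum_(K k <= n < K k.+1) (a n ^+ 2 + b n ^+ 2)) <=
      2^-1 * 2 ^+ k * (pi * (4 ^+ k)^-1).
    by rewrite ler_wpM2l ?mulr_ge0 ?(ltW p2)// ler_wpM2l// ltW.
  have e4 : 2 ^+ k * (4 ^+ k)^-1 = (2 ^+ k)^-1 :> R.
    rewrite (_ : 4 = 2 * 2); last by ring.
    by rewrite exprMn invfM mulrA mulfV ?mul1r// gt_eqF.
  have e5 : 2^-1 * 2 ^+ k * (pi * (4 ^+ k)^-1) = 2^-1 * pi * (2 ^+ k)^-1.
    by rewrite -e4; ring.
  by move: h2; rewrite e5; lra.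
have geo n : \sum_(0 <= k < n) ((2 ^+ k)^-1 : R) <= 2.
  suff : \sum_(0 <= k < n) ((2 ^+ k)^-1 : R) = 2 - 2 / 2 ^+ n.
    by move=> ->; rewrite gerBl divr_ge0// exprn_ge0.
  elim: n => [|n IH]; first by rewrite big_geq// expr0 divr1 subrr.
  by rewrite big_nat_recr//= IH exprS; field; rewrite expf_neq0.
have [|h [ih ch]] := @L1_series R u (- pi) pi (pi * (3 / 2) * 2) pipi mu_ bu.
  move=> n; apply: (@le_trans _ _ (\sum_(0 <= k < n) pi * (3 / 2) / 2 ^+ k)).
    by apply: ler_sum => k _; exact: l1.
  by rewrite -mulr_sumr ler_wpM2l// mulr_ge0// ltW.
(* The fundamental theorem for the polynomials of index between K 0 and K n, in the limit n -> oo: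
   uniform convergence on one side, L^1 convergence on the other. *)
have FE y : - pi <= y <= pi -> F y = (F (- pi) - trig_poly A B 0 (K 0%N) (- pi)) +
    trig_poly A B 0 (K 0%N) y + intg (- pi) y h.
  move=> ypi; have c1 := ch y ypi.
  have [ypi1 ypi2] := andP ypi.
  have e1 n : intg (- pi) y (fun x => \sum_(0 <= k < n) u k x) =
      (trig_poly A B 0 (K n) y - trig_poly A B 0 (K n) (- pi)) -
      (trig_poly A B 0 (K 0%N) y - trig_poly A B 0 (K 0%N) (- pi)).
    have K0n : (K 0 <= K n)%N by elim: n => // n IH; exact: leq_trans IH (ltnW (Kincr n)).
    transitivity (intg (- pi) y (trig_poly a b (K 0%N) (K n))).
      apply: eq_intg => x _; elim: n {K0n} => [|n IH]; first by rewrite big_geq// /trig_poly big_geq.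
      have K0n : (K 0 <= K n)%N by elim: n {IH} => // n IH; exact: leq_trans IH (ltnW (Kincr n)).
      rewrite big_nat_recr//= IH /u /trig_poly.
      by rewrite [RHS](@big_cat_nat _ _ _ (K n))//= ltnW.
    rewrite (intg_FTC ypi1 (fun x _ => is_derive_conj (K 0%N) (K n) x)).
      by rewrite !(@T_split (K 0%N) (K n))//; ring.
    move=> x _.
    have H c d M N z : {for z, continuous (trig_poly c d M N)}.
      apply: cvg_big => [|n' _]; first exact: add_continuous.
      apply: cvgD; apply: cvgM; try exact: cvg_cst.
        exact: continuous_cos_lin.
      exact: continuous_sin_lin.
    exact: H.
  have cK : K n @[n --> \oo] --> \oo.
    by apply/cvgnyPge => M; exists M => // n /= Mn; exact: leq_trans (K_ge n).
  have c2 : (trig_poly A B 0 (K n) y - trig_poly A B 0 (K n) (- pi)) -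
      (trig_poly A B 0 (K 0%N) y - trig_poly A B 0 (K 0%N) (- pi)) @[n --> \oo] -->
     (F y - F (- pi)) - (trig_poly A B 0 (K 0%N) y - trig_poly A B 0 (K 0%N) (- pi)).
    apply: cvgB; last exact: cvg_cst.
    have cF z : trig_poly A B 0 (K n) z @[n --> \oo] --> F z.
      exact: (cvg_comp K (fun N => trig_poly A B 0 N z) cK (@F_cvg z)).
    by apply: cvgB; exact: cF.
  have -> : intg (- pi) y h = (F y - F (- pi)) - (trig_poly A B 0 (K 0%N) y - trig_poly A B 0 (K 0%N) (- pi)).
    have c3 := c1; rewrite (_ : (fun n => intg _ _ _) = (fun n => (trig_poly A B 0 (K n) y - trig_poly A B 0 (K n) (- pi)) -
      (trig_poly A B 0 (K 0%N) y - trig_poly A B 0 (K 0%N) (- pi)))) in c3; last exact/funext/e1.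
    exact: (cvg_unique _ c3 c2).
  by ring.
have := lebesgue_differentiation (integrable_locally (measurable_itv `[- pi, pi]) ih).
apply: ae_mono => x hx /andP[x1 x2].
(* The Lebesgue points are those of h cut off outside the interval; inside, the integrals are the
   same. *)
pose hr := h \_ `[- pi, pi].
have ihr : mu.-integrable `[- pi, pi] (EFin \o hr).
  apply: eq_integrable ih => // z zpi.
  by rewrite /= /hr patchE zpi.
have [dF _] := FTC1_lebesgue_pt x2 ihr (a := BLeft (- pi)) x1 hx.
pose Fb y := (F (- pi) - trig_poly A B 0 (K 0%N) (- pi)) +
    trig_poly A B 0 (K 0%N) y + \int[mu]_(t in `[- pi, y]) hr t.
have FbE y : - pi <= y <= pi -> F y = Fb y.
  move=> ypi; rewrite FE// /Fb; congr (_ + _); apply: eq_Rintegral => z.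
  have [_ yp] := andP ypi.
  rewrite inE/= in_itv/= => /andP[z1 z2]; rewrite /hr patchE mem_set//= in_itv/= z1.
  exact: le_trans yp.
have dFb := isdD (isdD (is_derive_cst (F (- pi) - trig_poly A B 0 (K 0%N) (- pi)) x 1)
  (is_derive_conj 0 (K 0%N) x)) (derivableP dF).
eexists => e e0.
have [d [d0 Hd]] := derivable_at0_is_derive dFb e0.
(* Keeps x + t inside [- pi, pi], the only place where F is known to be the primitive [Fb]. *)
exists (Num.min d (Num.min (x + pi) (pi - x))); split.
  by rewrite !lt_min d0/=; apply/andP; split; lra.
move=> t; rewrite !lt_min => /and3P[td t1 t2].
have := Hd t td; rewrite /= -/(Fb (t + x)) -/(Fb (0 + x)) -!FbE//.
  by rewrite add0r; lra.
by move: t1 t2; rewrite !ltr_norml => /andP[? ?] /andP[? ?]; apply/andP; split; lra.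
by move: t1 t2; rewrite !ltr_norml => /andP[? ?] /andP[? ?]; apply/andP; split; lra.
Qed.

End Coefficients.
End ConjugateSeries.

(** * Radial limits for Lipschitz functions *)

Section LipschitzRadial.
Variable R : realType.
Notation mu := (@lebesgue_measure R).
Local Notation pi := (@pi R).
Implicit Types (f F G : R -> R) (x r e D L : R) (n m N : nat).

Let pipi : - pi <= pi. Proof. by have := pi_ge0 R; lra. Qed.

Lemma coef_of_uniform_limit F (a b : nat -> R) : bounded_borel F ->
  (forall e, 0 < e -> exists N0, forall N, (N0 <= N)%N -> forall x,
      `|F x - trig_poly a b 0 N x| <= e) ->
  forall m, cos_coef F m.+1 = pi * a m /\ sin_coef F m.+1 = pi * b m.
Proof.
move=> bF H m; have pi0 := pi_gt0 R.
have bF' : bm (- pi) pi F by exact: bounded_borel_bm.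
have bT N : bm (- pi) pi (trig_poly a b 0 N) by exact: bm_trig_poly.
have key (k : R -> R) (l : R) : (forall x, `|k x| <= 1) -> bm (- pi) pi k ->
    (forall N, (m < N)%N -> intg (- pi) pi (fun s => trig_poly a b 0 N s * k s) = l) ->
    intg (- pi) pi (fun s => F s * k s) = l.
  move=> k1 bk Hl; apply/eqP; rewrite -subr_eq0 -normr_le0.
  apply/ler_addgt0Pr => e e0; rewrite add0r.
  have e' : 0 < e / (2 * pi) by rewrite divr_gt0// mulr_gt0.
  have [N0 HN] := H _ e'.
  rewrite -(Hl (maxn N0 m.+1) (leq_maxr _ _)) -intgB; [|exact: bmM..].
  have -> : e = (e / (2 * pi)) * (pi - - pi).
    by move: pi0; move: (pi) => p p0; field; rewrite gt_eqF.
  rewrite -intg_cst//; apply: intg_norm_le; [by apply: bmB; exact: bmM|exact: bm_cst|].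
  move=> s _; rewrite -mulrBl normrM -[X in _ <= X]mulr1.
  by apply: ler_pM => //; apply: HN; exact: leq_maxl.
have pick (A : nat -> R) N : (m < N)%N -> \sum_(0 <= i < N) (pi * A i *+ (i == m)) = pi * A m.
  move=> mN; rewrite (bigD1_seq m) ?mem_index_iota ?iota_uniq//= eqxx mulr1n big1 ?addr0//.
  by move=> i /negbTE ->; rewrite mulr0n.
split.
  apply: key => [x||N mN]; [exact: cos_max|exact: bm_cos_lin|].
  by have := cos_coef_trig_poly a b 0 N m; rewrite pick.
apply: key => [x||N mN]; [exact: sin_max|exact: bm_sin_lin|].
by have := sin_coef_trig_poly a b 0 N m; rewrite pick.
Qed.

Lemma mulNi_real (k q c s : R) :
  (- 'i%C * k%:C * q%:C) * (c -i* s) = (- (k * q * s)) -i* (k * q * c) :> R[i].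
Proof.
have -> : - 'i%C * k%:C * q%:C = 0 -i* (k * q) :> R[i].
  have -> : - 'i%C = (0 : R) -i* 1.
    by rewrite -[- 'i%C]/((- 0) +i* (- 1)) oppr0.
  rewrite -[(0 -i* 1) * k%:C]/((0 * k - (- 1) * 0) +i* (0 * 0 + (- 1) * k)).
  rewrite -[(_ +i* _) * q%:C]/((_ * q - _ * 0) +i* (_ * 0 + _ * q)).
  by congr (_ +i* _); ring.
rewrite -[_ * _]/((0 * c - (- (k * q)) * (- s)) +i* (0 * (- s) + (- (k * q)) * c)).
by congr (_ +i* _); ring.
Qed.

(** For real z = r the n-th term of the series is - i n r^n (c_n - i s_n): its imaginary part sees
    only the cosine coefficient, its real part only the sine coefficient, and the term n = 0
    vanishes. *)
Lemma radial_conjugation f g r : bm (- pi) pi f -> bm (- pi) pi g -> 0 <= r < 1 ->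
  (forall n, cos_coef f n.+1 = sin_coef g n.+1) ->
  Im (cintg f (dcauchy_kernel r%:C)) = Re (cintg g (dcauchy_kernel r%:C)).
Proof.
move=> bf bg /andP[r0 r1] fg.
have cr : cabs (r%:C : R[i]) < 1 by rewrite cabs_real ger0_norm.
have /cvg_parts[_ h1] := cintg_kernel_cvg bf cr.
have /cvg_parts[h2 _] := cintg_kernel_cvg bg cr.
have E M : Im (\sum_(n < M) (- 'i%C * n%:R * r%:C ^+ n) * (cos_coef f n -i* sin_coef f n)) =
    Re (\sum_(n < M) (- 'i%C * n%:R * r%:C ^+ n) * (cos_coef g n -i* sin_coef g n)).
  rewrite Im_sum Re_sum; apply: eq_bigr => n _.
  have [->|n0] := eqVneq (val n) 0%N; first by rewrite mulr0 !mul0r.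
  have e1 : cos_coef f n = sin_coef g n.
    by rewrite -(prednK (n := n)) ?fg// lt0n.
  have -> : r%:C ^+ n = (r ^+ n)%:C :> R[i] by rewrite rmorphXn.
  have -> : n%:R = (n%:R)%:C :> R[i] by rewrite rmorph_nat.
  by rewrite !mulNi_real e1.
have h3 := h1; rewrite (_ : (fun M => Im _) = (fun M => Re (\sum_(n < M) (- 'i%C * n%:R * r%:C ^+ n) *
   (cos_coef g n -i* sin_coef g n)))) in h3; last exact/funext/E.
exact: (cvg_unique _ h3 h2).
Qed.

Lemma near_left1 (P : R -> Prop) d : 0 < d -> (forall r, 0 <= r -> 1 - d < r -> r < 1 -> P r) ->
  \forall r \near 1^'-, P r.
Proof.
move=> d0 H; near=> r; apply: H.
- by apply: ltW; near: r; apply: nbhs_left_gt.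
- by near: r; apply: nbhs_left_gt; lra.
- by near: r; exact: nbhs_left_lt.
Unshelve. all: by end_near. Qed.

Lemma lipschitz_radial_limit G L : bounded_borel G -> periodic G (2 * pi) ->
  (forall x y, `|G x - G y| <= L * `|x - y|) ->
  {ae mu, forall x, - pi < x < pi -> exists l : R,
    Im (cintg (fun s => G (s + x)) (dcauchy_kernel r%:C)) @[r --> 1^'-] --> l}.
Proof.
move=> bG pG GL; have pi0 := pi_gt0 R.
(* The series of a, b is up to sign conjugate to that of the derivative of G. The frequency cancels
   the division in [conjugate_function], and 1/pi the factor in [coef_of_uniform_limit]. *)
pose a n := n.+1%:R * cos_coef G n.+1 / pi.
pose b n := n.+1%:R * sin_coef G n.+1 / pi.
have abS N : \sum_(0 <= n < N) (a n ^+ 2 + b n ^+ 2) <= 32 * L ^+ 2.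
  have h := lipschitz_coef_bound bG pG N GL.
  rewrite (_ : \sum_(0 <= n < N) (a n ^+ 2 + b n ^+ 2) = (pi ^+ 2)^-1 *
     \sum_(0 <= n < N) n.+1%:R ^+ 2 * (cos_coef G n.+1 ^+ 2 + sin_coef G n.+1 ^+ 2)); last first.
    rewrite mulr_sumr; apply: eq_bigr => n _; rewrite /a /b !exprMn exprVn.
    by move: ((pi ^+ 2)^-1) => p; ring.
  rewrite mulrC ler_pdivrMr ?exprn_gt0//.
  by rewrite (_ : _ * pi ^+ 2 = 32 * pi ^+ 2 * L ^+ 2)//; ring.
have [F [bF pF Funif Fd]] := conjugate_function abS.
have coefF m : cos_coef F m.+1 = - sin_coef G m.+1 /\ sin_coef F m.+1 = cos_coef G m.+1.
  have [-> ->] := coef_of_uniform_limit bF Funif m.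
  have n0 : m.+1%:R != 0 :> R by rewrite pnatr_eq0.
  rewrite /a /b; move: (m.+1%:R : R) n0 => q q0; move: pi0; move: (pi) => p p0.
  by split; field; rewrite q0 gt_eqF.
apply: ae_mono Fd => x Fx /Fx[D hD]; exists (- (pi * D)).
apply/cvgrPdist_le => e e0.
have [d [d0 Hd]] := kernel_comparison (bounded_borel_shift x bF) hD ler01 e0.
apply: (near_left1 d0) => r r0 rd r1.
have cr : cabs (r%:C : R[i]) = r by rewrite cabs_real ger0_norm.
have cr1 : cabs (r%:C - 1 : R[i]) = 1 - r.
  rewrite (_ : r%:C - 1 = (r - 1)%:C); last by rewrite rmorphB rmorph1.
  by rewrite cabs_real distrC ger0_norm// subr_ge0 ltW.
have [|||h _] := Hd r%:C; rewrite ?cr ?cr1 ?mul1r//; first by lra.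
rewrite (@radial_conjugation _ (fun s => F (s + x))) ?r0//.
- by rewrite -opprD normrN addrC.
- exact/bounded_borel_bm/bounded_borel_shift.
- exact/bounded_borel_bm/bounded_borel_shift.
(* Conjugation commutes with translation: the pairs (cosine, sine) of G and F are rotated by the
   same angle. *)
- move=> n; rewrite cos_coef_shift// sin_coef_shift//.
  by have [-> ->] := coefF n; ring.
Qed.

End LipschitzRadial.

(** * The Marcinkiewicz integral *)

Section Marcinkiewicz.
Variable R : realType.
Notation mu := (@lebesgue_measure R).
Local Notation pi := (@pi R).
Implicit Types (d h : R -> R) (x y s a b c r C : R).

Let pipi : - pi <= pi. Proof. by have := pi_ge0 R; lra. Qed.

Lemma ge0_integral_shift a b c (f : R -> \bar R) : measurable_fun setT f ->
  (forall x, (0 <= f x)%E) ->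
  (\int[mu]_(x in `[a, b]) f (x + c)%R = \int[mu]_(x in `[(a + c)%R, (b + c)%R]) f x)%E.
Proof.
move=> mf f0.
have pre : (fun x : R => x + c) @^-1` `[a + c, b + c] = `[a, b]%classic.
  by apply/seteqP; split => x /=; rewrite !in_itv/= !lerD2r.
have mshift : measurable_fun setT (fun x : R => (x + c : measurableTypeR R)).
  exact: measurable_funD.
have <- : (\int[pushforward mu (fun x : R => (x + c)%R : measurableTypeR R)]_(y in `[(a + c)%R, (b + c)%R])
            f y = \int[mu]_(x in `[(a + c)%R, (b + c)%R]) f x)%E.
  apply: (@eq_measure_integral _ _ _ _ mu) => A mA _.
  exact: lebesgue_measure_shift.
rewrite ge0_integral_pushforward ?pre//.
exact: measurable_funTS.
Qed.

Lemma integral_mul_indic (A : set R) (g : R -> R) :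
  (\int[mu]_x (g x * \1_A x)%:E = \int[mu]_(x in A) (g x)%:E)%E.
Proof.
rewrite [RHS]integral_mkcond; apply: eq_integral => x _; rewrite patchE indicE.
by case: ifP => _; rewrite ?mulr1// mulr0.
Qed.

Lemma integral_cst_itv a b c : a <= b -> (\int[mu]_(x in `[a, b]) c%:E = (c * (b - a))%:E)%E.
Proof.
move=> ab; rewrite integral_cst//= lebesgue_measure_itv/= lte_fin.
by move: ab; rewrite le_eqVlt => /predU1P[->|->]; rewrite ?ltxx ?subrr ?mulr0 ?mule0// -EFinD -EFinM.
Qed.

(** A regularization of d(y) / (x - y)^2 that is at least that large whenever d(y) <= |x - y|. As a
    function of x it is 2 pi times a Poisson kernel of height d(y), whence a mass bound independent
    of y. *)
Definition marcinkiewicz_kernel d x y : R := 2 * d y / ((x - y) ^+ 2 + d y ^+ 2).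

Lemma marcinkiewicz_kernel_ge0 d x y : 0 <= d y -> 0 <= marcinkiewicz_kernel d x y.
Proof. by move=> d0; rewrite divr_ge0 ?mulr_ge0// addr_ge0 ?sqr_ge0. Qed.

Lemma marcinkiewicz_kernel_mass d y : 0 <= d y ->
  (\int[mu]_(x in `[(- pi)%R, pi%R]) (marcinkiewicz_kernel d x y)%:E <= (2 * pi)%:E)%E.
Proof.
rewrite le_eqVlt => /predU1P[d0|d0].
  rewrite integral0_eq; first by rewrite lee_fin mulr_ge0// pi_ge0.
  by move=> x _; rewrite /marcinkiewicz_kernel -d0 mulr0 mul0r.
have den x : 0 < (x - y) ^+ 2 + d y ^+ 2 by rewrite ltr_wpDl ?sqr_ge0// exprn_gt0.
have dF x : - pi <= x <= pi -> is_derive x 1 (fun x => 2 * atan ((d y)^-1 * x + - ((d y)^-1 * y)))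
    (marcinkiewicz_kernel d x y).
  move=> _.
  pose u z := (d y)^-1 * z + - ((d y)^-1 * y).
  have h1 : is_derive x 1 u (d y)^-1 by exact: isd_affine.
  have h2 : is_derive x 1 (fun z => atan (u z)) ((1 + u x ^+ 2)^-1 * (d y)^-1).
    exact: (is_derive1_comp (is_derive1_atan (u x)) h1).
  have h := isdZ 2 h2.
  apply: is_derive_eq h _; rewrite /u /marcinkiewicz_kernel; have := den x.
  move: (d y) d0 => e e0 dx.
  have dx' : e ^+ 2 + (x - y) ^+ 2 != 0 by rewrite addrC gt_eqF.
  have -> : 1 + (e^-1 * x + - (e^-1 * y)) ^+ 2 = (e ^+ 2 + (x - y) ^+ 2) / e ^+ 2.
    by field; rewrite gt_eqF.
  rewrite invf_div [(x - y) ^+ 2 + _]addrC.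
  by field; rewrite dx' gt_eqF.
have cf x : - pi <= x <= pi -> {for x, continuous (fun x => marcinkiewicz_kernel d x y)}.
  move=> _; apply: cvgM; first exact: cvg_cst.
  apply: cvgV; first by rewrite gt_eqF.
  apply: cvgD; last exact: cvg_cst.
  have c1 : {for x, continuous (fun x : R => (x - y) * (x - y))}.
    by apply: cvgM; apply: cvgB; [exact: cvg_id|exact: cvg_cst|exact: cvg_id|exact: cvg_cst].
  by rewrite (_ : (fun _ => _) = (fun x : R => (x - y) * (x - y))).
have bk : bm (- pi) pi (fun x => marcinkiewicz_kernel d x y) by exact: bm_continuous.
have -> : (\int[mu]_(x in `[(- pi)%R, pi%R]) (marcinkiewicz_kernel d x y)%:E =
   (intg (- pi) pi (fun x => marcinkiewicz_kernel d x y))%:E)%E.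
  rewrite /intg /Rintegral fineK//.
  exact: (integrable_fin_num _ (bm_integrable bk)).
rewrite (intg_FTC pipi dF cf) lee_fin.
have h1 := atan_ltpi2 ((d y)^-1 * pi + - ((d y)^-1 * y)).
have h2 := atan_gtNpi2 ((d y)^-1 * - pi + - ((d y)^-1 * y)).
by lra.
Qed.

(** Tonelli: integrating in x first gives at most 2 pi for each y, so the double integral is finite
    and so is almost every inner one. The longer interval for y holds all x + s with |x|, |s| <=
    pi. *)
Lemma marcinkiewicz d : measurable_fun setT d -> (forall y, 0 <= d y) ->
  {ae mu, forall x, - pi <= x <= pi ->
    (\int[mu]_(y in `[(- (2 * pi))%R, (2 * pi)%R]) (marcinkiewicz_kernel d x y)%:E < +oo)%E}.
Proof.
move=> md d0.
have p2 : - (2 * pi) <= 2 * pi by have := pi_ge0 R; lra.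
pose A : set R := `[- pi, pi]%classic; pose B : set R := `[- (2 * pi), 2 * pi]%classic.
have mA : measurable A by exact: measurable_itv.
have mB : measurable B by exact: measurable_itv.
pose k (p : R * R) : R := marcinkiewicz_kernel d p.1 p.2 * \1_A p.1 * \1_B p.2.
have k0 p : 0 <= k p.
  apply: mulr_ge0; last by rewrite indicE.
  by apply: mulr_ge0; [exact: marcinkiewicz_kernel_ge0|rewrite indicE].
have mk : measurable_fun setT k.
  have m2 : measurable_fun setT (fun p : R * R => d p.2).
    by apply: (measurableT_comp md); exact: measurable_snd.
  have iA : measurable_fun setT (\1_A : R -> R) by exact: measurable_indic.
  have iB : measurable_fun setT (\1_B : R -> R) by exact: measurable_indic.
  apply: measurable_funM.
    apply: measurable_funM.
      apply: measurable_funM.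
        by apply: measurable_funM => //; exact: measurable_cst.
      apply: (measurableT_comp (@measurable_invr R)).
      apply: measurable_funD; apply: measurable_funX => //.
      by apply: measurable_funB; [exact: measurable_fst|exact: measurable_snd].
    by apply: (measurableT_comp iA); exact: measurable_fst.
  by apply: (measurableT_comp iB); exact: measurable_snd.
have mkE : measurable_fun setT (fun p => (k p)%:E) by exact/measurable_EFinP.
have kE0 p : (0 <= (k p)%:E)%E by rewrite lee_fin.
have FT := @fubini_tonelli _ _ _ _ R mu mu (fun p => (k p)%:E) mkE kE0.
have mF := @measurable_fun_fubini_tonelli_F _ _ _ _ R mu (fun p => (k p)%:E) mkE kE0.
have fin : (\int[mu]_x \int[mu]_y (k (x, y))%:E <= (2 * pi * (2 * pi - - (2 * pi)))%:E)%E.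
  rewrite FT.
  apply: (@le_trans _ _ (\int[mu]_y (2 * pi * \1_B y)%:E)%E).
    apply: ge0_le_integral.
    - exact: measurableT.
    - by move=> y _; apply: integral_ge0 => x _; exact: kE0.
    - exact: (@measurable_fun_fubini_tonelli_G _ _ _ _ R mu (fun p => (k p)%:E) mkE kE0).
    - apply/measurable_EFinP; apply: measurable_funM; first exact: measurable_cst.
      exact: measurable_indic.
    - move=> y _; rewrite /k/=.
      have [yB|yB] := boolP (y \in B); last first.
        rewrite integral0_eq; last by move=> x _; rewrite [\1_B y]indicE (negbTE yB) mulr0.
        by rewrite lee_fin mulr_ge0 ?mulr_ge0 ?pi_ge0 ?ler0n ?indicE.
      rewrite [\1_B y]indicE yB mulr1.
      under eq_integral do rewrite mulr1.
      rewrite integral_mul_indic; exact: marcinkiewicz_kernel_mass.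
  rewrite integral_mul_indic integral_cst_itv; first exact: lexx.
  exact: p2.
have intF : mu.-integrable setT (fubini_F mu (fun p => (k p)%:E)).
  apply/integrableP; split; [exact: mF|apply: le_lt_trans (ltry (2 * pi * (2 * pi - - (2 * pi))))].
  apply: le_trans fin; rewrite le_eqVlt; apply/orP; left; apply/eqP.
  by apply: eq_integral => x _; rewrite gee0_abs; [|apply: integral_ge0 => y _; exact: kE0].
have : {ae mu, forall x, setT x -> fubini_F mu (fun p => (k p)%:E) x \is a fin_num} by apply: integrable_ae intF.
apply: ae_mono => x /(_ I) H /andP[x1 x2].
move: H; rewrite /fubini_F /k/=.
have xA : x \in A by rewrite inE /A/= in_itv/= x1.
under eq_integral do rewrite [\1_A _]indicE xA mulr1.
rewrite integral_mul_indic ge0_fin_numE; first exact.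
by apply: integral_ge0 => y _; rewrite lee_fin marcinkiewicz_kernel_ge0.
Qed.

End Marcinkiewicz.

Section MarcinkiewiczLimit.
Variable R : realType.
Notation mu := (@lebesgue_measure R).
Local Notation pi := (@pi R).
Implicit Types (f d h G : R -> R) (x y s a b c r C e M L : R).

(** With d = |h| / C the growth hypothesis reads d(y) <= |y - x|. The denominator of the kernel is
    then at most 2 (y - x)^2, which gives |h(y)| / (y - x)^2 <= C times the kernel. *)
Lemma marcinkiewicz_domination h C x : bounded_borel h -> 0 < C -> - pi <= x <= pi ->
  (forall y, `|h y| <= C * `|y - x|) ->
  (\int[mu]_(y in `[(- (2 * pi))%R, (2 * pi)%R])
     (marcinkiewicz_kernel (fun y => `|h y| / C) x y)%:E < +oo)%E ->
  mu.-integrable `[- pi, pi] (fun s => (`|h (s + x)| / s ^+ 2)%:E).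
Proof.
move=> [mh [M hM]] C0 /andP[x1 x2] hx fin.
have mg : measurable_fun setT (fun y : R => `|h y| / (y - x) ^+ 2).
  apply: measurable_funM; first exact: measurableT_comp.
  apply: (measurableT_comp (@measurable_invr R)).
  by apply: measurable_funX; apply: measurable_funB => //; exact: measurable_cst.
have mk : measurable_fun setT (fun y : R => C * marcinkiewicz_kernel (fun y => `|h y| / C) x y).
  have md : measurable_fun setT (fun y : R => `|h y| / C).
    by apply: measurable_funM; [exact: measurableT_comp|exact: measurable_cst].
  apply: measurable_funM; first exact: measurable_cst.
  apply: measurable_funM; first by apply: measurable_funM => //; exact: measurable_cst.
  apply: (measurableT_comp (@measurable_invr R)).
  apply: measurable_funD; apply: measurable_funX => //.
  by apply: measurable_funB => //; exact: measurable_cst.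
have le y : `|h y| / (y - x) ^+ 2 <= C * marcinkiewicz_kernel (fun y => `|h y| / C) x y.
  have [->|yx] := eqVneq y x.
    by rewrite subrr expr0n/= invr0 mulr0 mulr_ge0 ?(ltW C0)// marcinkiewicz_kernel_ge0// divr_ge0 ?(ltW C0).
  rewrite /marcinkiewicz_kernel.
  have y0 : 0 < `|y - x| by rewrite normr_gt0 subr_eq0.
  have := hx y; rewrite -(real_normK (num_real (y - x))) -(real_normK (num_real (x - y))) [`|x - y|]distrC.
  move: y0 (normr_ge0 (h y)); move: `|y - x| `|h y| => u v u0 v0 vu.
  have -> : C * (2 * (v / C) / (u ^+ 2 + (v / C) ^+ 2)) = 2 * v / (u ^+ 2 + (v / C) ^+ 2).
    by move: ((u ^+ 2 + (v / C) ^+ 2)^-1) => q; field; rewrite gt_eqF.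
  have w0 : 0 <= v / C by rewrite divr_ge0// ltW.
  have wu : v / C <= u by rewrite ler_pdivrMr// mulrC.
  rewrite ler_pdivrMr ?exprn_gt0// mulrAC ler_pdivlMr; last by rewrite ltr_wpDr ?exprn_gt0// exprn_ge0.
  have := mulr_ge0 v0 (_ : 0 <= u ^+ 2 - (v / C) ^+ 2); rewrite subr_ge0 ler_sqr// ?nnegrE ?(ltW u0)// => /(_ wu).
  by move: (v / C) => w; lra.
apply/integrableP; split.
  apply/measurable_EFinP; apply: measurable_funTS.
  apply: measurable_funM.
    by apply: measurableT_comp => //; apply: (measurableT_comp mh); exact: measurable_funD.
  by apply: (measurableT_comp (@measurable_invr R)); exact: measurable_funX.
have -> : (\int[mu]_(s in `[(- pi)%R, pi%R]) `|(`|h (s + x)| / s ^+ 2)%:E|)%E =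
    (\int[mu]_(y in `[(- pi + x)%R, (pi + x)%R]) (`|h y| / (y - x) ^+ 2)%:E)%E.
  rewrite -(@ge0_integral_shift _ (- pi) pi x (fun y => (`|h y| / (y - x) ^+ 2)%:E)).
  - by apply: eq_integral => s _; rewrite addrK gee0_abs// lee_fin divr_ge0// sqr_ge0.
  - by apply/measurable_EFinP; exact: mg.
  - by move=> y; rewrite lee_fin divr_ge0// sqr_ge0.
apply: (@le_lt_trans _ _ (\int[mu]_(y in `[(- (2 * pi))%R, (2 * pi)%R])
   (C * marcinkiewicz_kernel (fun y => `|h y| / C) x y)%:E)%E).
  apply: (@le_trans _ _ (\int[mu]_(y in `[(- (2 * pi))%R, (2 * pi)%R])
     (`|h y| / (y - x) ^+ 2)%:E)%E).
    apply: ge0_subset_integral => //.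
    - by apply/measurable_EFinP; exact: measurable_funTS.
    - by move=> y _; rewrite lee_fin divr_ge0// sqr_ge0.
    - by move=> y /=; rewrite !in_itv/= => /andP[]; lra.
  apply: ge0_le_integral => //.
  - by move=> y _; rewrite lee_fin divr_ge0// sqr_ge0.
  - by apply/measurable_EFinP; exact: measurable_funTS.
  - by apply/measurable_EFinP; exact: measurable_funTS.
  - by move=> y _; rewrite lee_fin.
under eq_integral do rewrite EFinM.
rewrite ge0_integralZl//.
- by apply: lte_mul_pinfty => //; rewrite lee_fin ltW.
- apply/measurable_EFinP; apply: measurable_funTS.
  rewrite (_ : marcinkiewicz_kernel _ _ = fun y => C^-1 * (C * marcinkiewicz_kernel (fun y => `|h y| / C) x y)).
    by apply: measurable_funM => //; exact: measurable_cst.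
  by apply/funext => y; rewrite mulKf// gt_eqF.
- by move=> y _; rewrite lee_fin marcinkiewicz_kernel_ge0// divr_ge0// ltW.
- by rewrite lee_fin ltW.
Qed.

Lemma cabs_real_sub1 r : r <= 1 -> cabs (r%:C - 1 : R[i]) = 1 - r.
Proof.
move=> r1; rewrite (_ : r%:C - 1 = (r - 1)%:C); last by rewrite rmorphB rmorph1.
by rewrite cabs_real distrC ger0_norm// subr_ge0.
Qed.

Lemma Im_dcauchy_kernel_cvg (u : nat -> R) s : (forall n, 0 <= u n < 1) ->
  u n @[n --> \oo] --> (1 : R) -> s != 0 -> `|s| <= pi ->
  Im (dcauchy_kernel (u n)%:C s) @[n --> \oo] --> inv_4sin2 s.
Proof.
move=> u01 u1 s0 spi; apply/cvgrPdist_le => e e0.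
have s3 : 0 < `|s| ^+ 3 by rewrite exprn_gt0// normr_gt0.
pose K : R := 64 * (2 + 1) ^+ 2.
have K0 : 0 < K by rewrite /K; lra.
have eK : 0 < e * `|s| ^+ 3 / K by apply: divr_gt0 => //; exact: mulr_gt0.
move/cvgrPdist_le : u1 => /(_ _ eK); apply: filterS => n un.
have /andP[r0 r1] := u01 n.
have cr : cabs ((u n)%:C : R[i]) < 1 by rewrite cabs_real ger0_norm.
have cr1 := cabs_real_sub1 (ltW r1).
have h := @dcauchy_kernel_sub1 R 1 (u n)%:C s ler01 cr _ spi s0.
rewrite cr1 mul1r cabs_real ger0_norm// in h.
have {}h := h (lexx _).
have I1 : Im (dcauchy_kernel 1 s) = inv_4sin2 s.
  by rewrite dcauchy_kernel1/= mul0r add0r mul1r.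
rewrite distrC -I1 -ImB (le_trans (Im_le_cabs _))//.
rewrite -(ler_pM2r s3) (le_trans h)//.
by move: un; rewrite ger0_norm ?subr_ge0 ?(ltW r1)// ler_pdivlMr// mulrC.
Qed.

(** Dominated convergence is for sequences. Replacing r by max(r, 0), harmless near 1, keeps every
    sequence in [0, 1). *)
Lemma cvg_at_left1 (F : R -> R) (l : R) :
  (forall u : nat -> R, (forall n, 0 <= u n < 1) -> u n @[n --> \oo] --> (1 : R) ->
     F (u n) @[n --> \oo] --> l) -> F r @[r --> 1^'-] --> l.
Proof.
move=> H; have near0 : \forall r \near (1 : R)^'-, F (Num.max r 0) = F r.
  by apply: (near_left1 ltr01) => r r0 _ _; rewrite max_l.
apply: cvg_trans (near_eq_cvg near0) _.
apply/cvg_at_leftP => u [u1 cu]; apply: H.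
  by move=> n; rewrite le_max lexx orbT/= gt_max u1 ltr01.
apply/cvgrPdist_le => e e0.
move/cvgrPdist_le : cu => /(_ _ e0); apply: filterS => n; apply: le_trans.
have := u1 n; have [u0|u0] := leP (u n) 0 => un; last by [].
by rewrite !ger0_norm; lra.
Qed.

Lemma marcinkiewicz_radial_limit h C x : bounded_borel h -> 0 < C -> - pi <= x <= pi ->
  (forall y, `|h y| <= C * `|y - x|) ->
  (\int[mu]_(y in `[(- (2 * pi))%R, (2 * pi)%R])
     (marcinkiewicz_kernel (fun y => `|h y| / C) x y)%:E < +oo)%E ->
  exists l : R, Im (cintg (fun s => h (s + x)) (dcauchy_kernel r%:C)) @[r --> 1^'-] --> l.
Proof.
move=> bh C0 xpi hx fin; have intw := marcinkiewicz_domination bh C0 xpi hx fin.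
have bhx := bounded_borel_shift x bh.
exists (intg (- pi) pi (fun s => h (s + x) * inv_4sin2 s)).
apply: cvg_at_left1 => u u01 cu.
(* At s = 0 all integrands vanish, so the pole of the limit kernel causes no trouble. *)
have h0 : h x = 0 by apply/eqP; rewrite -normr_le0 (le_trans (hx x))// subrr normr0 mulr0.
have cr n : cabs ((u n)%:C : R[i]) < 1.
  by have /andP[r0 r1] := u01 n; rewrite cabs_real ger0_norm.
(* On the radius the Stolz constant is 1, and 16 (1 + 1)^2 = 64. *)
pose w s := 64 * (`|h (s + x)| / s ^+ 2).
have iw : mu.-integrable `[- pi, pi] (fun s => (w s)%:E).
  rewrite (_ : (fun s => _) = (fun s => 64%:E * (`|h (s + x)| / s ^+ 2)%:E)%E); last first.
    by apply/funext => s; rewrite -EFinM.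
  by apply: integrableZl intw => //; exact: measurable_itv.
have dom n s : `[- pi, pi]%classic s -> `|h (s + x) * Im (dcauchy_kernel (u n)%:C s)| <= w s.
  move=> sp; have spi : - pi <= s <= pi by move: sp; rewrite /= in_itv.
  rewrite normrM /w [leRHS]mulrCA.
  have [s0|s0] := eqVneq s 0; first by rewrite s0 add0r h0 normr0 !mul0r.
  have s2 : 0 < s ^+ 2 by rewrite exprn_even_gt0.
  apply: ler_wpM2l => //; rewrite (le_trans (Im_le_cabs _))//.
  rewrite ler_pdivlMr// mulrC.
  have /andP[r0 r1] := u01 n.
  have := @sqr_dcauchy_kernel_bound R 1 (u n)%:C s ler01 (cr n).
  rewrite (cabs_real_sub1 (ltW r1)) mul1r cabs_real ger0_norm// => /(_ (lexx _)).
  rewrite ler_norml => /(_ spi) H; rewrite (le_trans H)//; lra.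
have mk n : measurable_fun (`[- pi, pi]%classic : set R) (fun s => Im (dcauchy_kernel (u n)%:C s)).
  by have [_ []] := cbm_dcauchy_kernel (cr n).
have mh : measurable_fun (`[- pi, pi]%classic : set R) (fun s => h (s + x)).
  by apply: measurable_funTS; case: bhx.
have pt s : `[- pi, pi]%classic s ->
    h (s + x) * Im (dcauchy_kernel (u n)%:C s) @[n --> \oo] --> h (s + x) * inv_4sin2 s.
  move=> sp; have spi : - pi <= s <= pi by move: sp; rewrite /= in_itv.
  have [s0|s0] := eqVneq s 0.
    rewrite s0 add0r h0; under eq_fun do rewrite mul0r.
    by rewrite mul0r; exact: cvg_cst.
  apply: cvgM; first exact: cvg_cst.
  by apply: Im_dcauchy_kernel_cvg => //; rewrite ler_norml.
have mhk n : measurable_fun (`[- pi, pi]%classic : set R)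
    (fun s => h (s + x) * Im (dcauchy_kernel (u n)%:C s)).
  by apply: measurable_funM; [exact: mh|exact: mk].
have mlim : measurable_fun (`[- pi, pi]%classic : set R) (fun s => h (s + x) * inv_4sin2 s).
  by apply: measurable_funM => //; apply: measurable_funTS; exact: measurable_inv_4sin2.
have ilim : mu.-integrable `[- pi, pi] (fun s => (h (s + x) * inv_4sin2 s)%:E).
  apply: le_integrable iw; first exact: measurable_itv.
    by apply/measurable_EFinP; exact: mlim.
  move=> s spi; rewrite lee_fin [`|w s|]ger0_norm; last first.
    by rewrite (le_trans _ (dom 0%N _ spi)).
  apply: (cvgr_to_le (cvg_norm (pt _ spi))); apply: nearW => n; exact: dom.
have [|||||_ _ H] := @dominated_convergence _ _ _ mu `[- pi, pi]%classic (measurable_itv _)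
  (fun n s => (h (s + x) * Im (dcauchy_kernel (u n)%:C s))%:E)
  (fun s => (h (s + x) * inv_4sin2 s)%:E) (fun s => (w s)%:E).
- by move=> n; apply/measurable_EFinP; exact: mhk.
- by apply/measurable_EFinP; exact: mlim.
- by apply: ae_everywhere => s spi; apply: cvg_EFin; [exact: nearW|exact: pt].
- exact: iw.
- by apply: ae_everywhere => s n spi; rewrite lee_fin; exact: dom.
have : (\int[mu]_(s in `[(- pi)%R, pi%R]) (h (s + x) * Im (dcauchy_kernel (u n)%:C s))%:E)%E @[n --> \oo] -->
   (intg (- pi) pi (fun s => h (s + x) * inv_4sin2 s))%:E.
  rewrite /intg /Rintegral fineK//; exact: (integrable_fin_num _ ilim).
by move/fine_cvgP => [_].
Qed.

End MarcinkiewiczLimit.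

(** * Radial limits of the conjugate integral *)

Section RadialLimit.
Variable R : realType.
Notation mu := (@lebesgue_measure R).
Local Notation pi := (@pi R).
Implicit Types (f d h G : R -> R) (x y s a b c r C e M L : R).

(** Near x the slope is at most |D| + 1; at distance at least d boundedness gives slope at most 2 B
    / d. *)
Lemma derivable_at0_growth f D x : (exists B, forall y, `|f y| <= B) ->
  derivable_at0 (fun s => f (s + x)) D ->
  exists n : nat, forall y, `|f y - f x| <= n.+1%:R * `|y - x|.
Proof.
move=> [B fB] /(_ _ ltr01)[d [d0 Hd]].
have B0 : 0 <= B by rewrite (le_trans _ (fB 0)).
pose K := `|D| + 1 + (B + B) / d.
have K0 : 0 <= (B + B) / d by rewrite divr_ge0 ?addr_ge0// ltW.
exists (Num.bound K) => y.
have KK : K <= (Num.bound K).+1%:R.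
  rewrite (le_trans (ltW (archi_boundP _)))//; first by rewrite !addr_ge0.
  by rewrite ler_nat.
apply: (@le_trans _ _ (K * `|y - x|)); last exact: ler_wpM2r.
have [yd|yd] := ltP `|y - x| d.
  have := Hd _ yd; rewrite subrK add0r mul1r => H.
  apply: (@le_trans _ _ ((`|D| + 1) * `|y - x|)); last by rewrite ler_wpM2r// lerDl.
  have := ler_normD (f y - f x - D * (y - x)) (D * (y - x)).
  by rewrite subrK [`|D * _|]normrM; lra.
apply: (@le_trans _ _ ((B + B) / d * `|y - x|)); last first.
  by rewrite ler_wpM2r// lerDr addr_ge0.
rewrite (le_trans (ler_normB _ _))// (le_trans (lerD (fB _) (fB _)))//.
by rewrite mulrAC ler_pdivlMr// ler_wpM2l// addr_ge0.
Qed.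

(** The infimal convolution of f with L |.|, as in McShane's extension formula. *)
Definition lipschitz_minorant f L x : R := inf [set f y + L * `|x - y| | y in setT].

Section Minorant.
Variables (f : R -> R) (B L : R).
Hypotheses (fB : forall x, `|f x| <= B) (L0 : 0 <= L).
Local Notation G := (lipschitz_minorant f L).

Let lbG x : has_lbound [set f y + L * `|x - y| | y in setT].
Proof.
exists (- B) => _ [y _ <-]; have := fB y; rewrite ler_norml => /andP[fy _].
by rewrite (le_trans fy)// lerDl mulr_ge0.
Qed.

Lemma lipschitz_minorant_le x y : G x <= f y + L * `|x - y|.
Proof. by apply: ge_inf; [exact: lbG|exists y]. Qed.

Lemma lipschitz_minorant_ge x c : (forall y, c <= f y + L * `|x - y|) -> c <= G x.
Proof.
move=> H; apply: lb_le_inf; last by move=> _ [y _ <-].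
by exists (f x + L * `|x - x|); exists x.
Qed.

Lemma lipschitz_minorant_lipschitz x y : `|G x - G y| <= L * `|x - y|.
Proof.
suff H a b : G a - G b <= L * `|a - b|.
  by rewrite ler_norml lerNl opprB H distrC H.
rewrite lerBlDl -lerBlDr; apply: lipschitz_minorant_ge => u.
rewrite lerBlDr (le_trans (lipschitz_minorant_le a u))// -addrA lerD2l -mulrDr.
by rewrite ler_wpM2l// (le_trans (ler_distD b _ _))// addrC.
Qed.

Lemma lipschitz_minorant_periodic T : periodic f T -> periodic G T.
Proof.
move=> pf x; rewrite /lipschitz_minorant; congr inf; apply/seteqP; split=> _ [u _ <-].
  by exists (u - T) => //; rewrite -(pf (u - T)) subrK (_ : x - (u - T) = x + T - u)//; ring.
by exists (u + T) => //; rewrite pf (_ : x + T - (u + T) = x - u)//; ring.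
Qed.

Lemma lipschitz_minorant_borel : bounded_borel G.
Proof.
split.
  apply: continuous_measurable_fun => x; apply/cvgrPdist_le => e e0.
  near=> y; rewrite (le_trans (lipschitz_minorant_lipschitz _ _))//.
  rewrite (@le_trans _ _ ((L + 1) * `|x - y|))//; first by rewrite ler_wpM2r// lerDl.
  rewrite mulrC -ler_pdivlMr; last by rewrite ltr_wpDl.
  near: y; apply: cvgr_dist_le; first exact: cvg_id.
  by rewrite divr_gt0// ltr_wpDl.
exists B => x; rewrite ler_norml; apply/andP; split.
  apply: lipschitz_minorant_ge => y; have := fB y; rewrite ler_norml => /andP[fy _].
  by rewrite (le_trans fy)// lerDl mulr_ge0.
have := lipschitz_minorant_le x x; rewrite subrr normr0 mulr0 addr0 => /le_trans; apply.
by have := fB x; rewrite ler_norml => /andP[].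
Unshelve. all: by end_near. Qed.

Lemma lipschitz_minorant_diff x : (forall y, `|f y - f x| <= L * `|y - x|) ->
  forall y, `|f y - G y| <= (2 * L) * `|y - x|.
Proof.
move=> H y.
(* The growth condition says that f x is below every competitor f u + L |x - u|. *)
have Gx : G x = f x.
  apply/eqP; rewrite eq_le; apply/andP; split.
    by have := lipschitz_minorant_le x x; rewrite subrr normr0 mulr0 addr0.
  apply: lipschitz_minorant_ge => u; have := H u.
  by rewrite ler_norml [`|u - x|]distrC; lra.
have h1 := H y; have h2 := lipschitz_minorant_lipschitz x y.
rewrite -[f y - G y](_ : (f y - f x) + (G x - G y) = _); last by rewrite Gx; ring.
by rewrite (le_trans (ler_normD _ _))//; rewrite [`|x - y|]distrC in h2; lra.
Qed.

End Minorant.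

Lemma conjugate_radial_limit f : bounded_borel f -> periodic f (2 * pi) ->
  {ae mu, forall x, - pi < x < pi -> (exists D, derivable_at0 (fun s => f (s + x)) D) ->
    exists l : R, Im (cintg (fun s => f (s + x)) (dcauchy_kernel r%:C)) @[r --> 1^'-] --> l}.
Proof.
move=> bf pf; have [mf [B fB]] := bf.
pose G (n : nat) := lipschitz_minorant f n.+1%:R; pose h n y := f y - G n y.
have bG n : bounded_borel (G n) by exact: lipschitz_minorant_borel fB _.
have bh n : bounded_borel (h n).
  have [mG [BG GB]] := bG n; split; first exact: measurable_funB.
  by exists (B + BG) => x; rewrite (le_trans (ler_normB _ _))// lerD.
(* The null sets of all n are united first, since the integer n that suits x is chosen only
   afterwards. *)
have H1 : {ae mu, forall x, forall n, - pi < x < pi -> exists l : R,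
    Im (cintg (fun s => G n (s + x)) (dcauchy_kernel r%:C)) @[r --> 1^'-] --> l}.
  apply: ae_foralln => n; apply: (@lipschitz_radial_limit _ _ n.+1%:R) => //.
    exact: lipschitz_minorant_periodic.
  exact: (lipschitz_minorant_lipschitz fB).
have H2 : {ae mu, forall x, forall n, - pi <= x <= pi ->
    (\int[mu]_(y in `[(- (2 * pi))%R, (2 * pi)%R])
      (marcinkiewicz_kernel (fun y => `|h n y| / (2 * n.+1%:R)) x y)%:E < +oo)%E}.
  apply: ae_foralln => n; apply: marcinkiewicz.
    apply: measurable_funM; last exact: measurable_cst.
    by apply: measurableT_comp => //; case: (bh n).
  by move=> y; rewrite divr_ge0// mulr_ge0.
apply: ae_mono (ae_and H1 H2) => x [{}H1 {}H2] xpi [D fD].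
have [n Hn] := derivable_at0_growth (ex_intro _ B fB) fD.
have xpi' : - pi <= x <= pi by have /andP[x1 x2] := xpi; rewrite !ltW.
have [l1 L1] := H1 n xpi.
have C0 : 0 < 2 * n.+1%:R :> R by rewrite mulr_gt0.
have [l2 L2] := marcinkiewicz_radial_limit (bh n) C0 xpi'
  (lipschitz_minorant_diff fB (ler0n _ _) Hn) (H2 n xpi').
exists (l1 + l2); have L12 := cvgD L1 L2.
suff near0 : \forall r \near (1 : R)^'-,
    Im (cintg (fun s => G n (s + x)) (dcauchy_kernel r%:C)) +
    Im (cintg (fun s => h n (s + x)) (dcauchy_kernel r%:C)) =
    Im (cintg (fun s => f (s + x)) (dcauchy_kernel r%:C)).
  by apply: cvg_trans (near_eq_cvg near0) _; exact: L12.
apply: (near_left1 ltr01) => r r0 _ r1.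
have cr : cabs (r%:C : R[i]) < 1 by rewrite cabs_real ger0_norm.
have [_ bk] := cbm_dcauchy_kernel cr.
have bs g : bounded_borel g -> bm (- pi) pi (fun s => g (s + x)).
  by move=> bg; exact/bounded_borel_bm/bounded_borel_shift.
rewrite /cintg -[LHS]intgD; [|exact: bmM (bs _ _) bk..].
by apply: eq_intg => s _; rewrite /h -mulrDl addrC subrK.
Qed.

(** The comparison read backwards: the point z = 1 - eps is at distance exactly [eps] from 1, so
    every small truncation is reached along the radius. *)
Lemma trunc_hilbert_cvg f D (l : R) : bounded_borel f -> derivable_at0 f D ->
  Im (cintg f (dcauchy_kernel r%:C)) @[r --> 1^'-] --> l ->
  trunc_hilbert f eps @[eps --> 0^'+] --> l.
Proof.
move=> bf fD L; apply/cvgrPdist_le => e e0.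
have e2 : 0 < e / 2 by rewrite divr_gt0.
have [d [d0 Hd]] := kernel_comparison bf fD ler01 e2.
have [d1 d10 Hd1] : exists2 d1, 0 < d1 & forall r, `|1 - r| < d1 -> r < 1 ->
    `|l - Im (cintg f (dcauchy_kernel r%:C))| <= e / 2.
  by move/cvgrPdist_le : L => /(_ _ e2) [d1 d10 Hd1]; exists d1.
near=> eps.
have ep0 : 0 < eps by near: eps; exact: nbhs_right_gt.
have epd : eps < d by near: eps; exact: nbhs_right_lt.
have epd1 : eps < d1 by near: eps; exact: nbhs_right_lt.
have ep1 : eps < 1 by near: eps; exact: nbhs_right_lt.
have cr : cabs ((1 - eps)%:C : R[i]) = 1 - eps by rewrite cabs_real ger0_norm; lra.
have cr1 : cabs ((1 - eps)%:C - 1 : R[i]) = eps by rewrite cabs_real_sub1; lra.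
have [|||_] := Hd (1 - eps)%:C; rewrite ?cr ?cr1; [lra..|].
have d1e : `|1 - (1 - eps)| < d1.
  by rewrite opprB addrCA subrr addr0 ger0_norm ?(ltW ep0).
have := Hd1 _ d1e; rewrite ltrBlDr ltrDl => /(_ ep0).
by rewrite !ler_norml; lra.
Unshelve. all: by end_near. Qed.

End RadialLimit.

(** * Boundary values of Cauchy-Stieltjes integrals *)

Section CauchyStieltjes.
Variable R : realType.
Notation mu := (@lebesgue_measure R).
Local Notation pi := (@pi R).
Implicit Types (f h : R -> R) (x y s a b c r e u D : R) (z : R[i]).

Let pipi : - pi <= pi. Proof. by have := pi_ge0 R; lra. Qed.

Lemma dcauchy_kernel_rotate z (t u : R) : dcauchy_kernel z (t + u) = dcauchy_kernel (z * expi (- u)) t.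
Proof.
rewrite /dcauchy_kernel expiN expiD; have := expi_neq0 u; have := expi_neq0 t.
move: (expi t) (expi u) => a b a0 b0.
have -> : a - z * b^-1 = (a * b - z) / b by field.
rewrite expr_div_n; have [->|d0] := eqVneq (a * b - z) 0.
  by rewrite !expr0n/= mul0r !invr0 !mulr0.
by field; rewrite b0 d0.
Qed.

Lemma expi_2pi : expi (2 * pi) = 1 :> R[i].
Proof. by rewrite /expi mulr_natl cos2pi sin2pi. Qed.

Lemma dcauchy_kernel_periodic z : periodic (dcauchy_kernel z) (2 * pi).
Proof. by move=> t; rewrite /dcauchy_kernel expiD expi_2pi mulr1. Qed.

Lemma bounded_dcauchy_kernel z : cabs z < 1 ->
  bounded_borel (fun t => Re (dcauchy_kernel z t)) /\
  bounded_borel (fun t => Im (dcauchy_kernel z t)).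
Proof.
move=> z1.
have B t : cabs (dcauchy_kernel z t) <= ((1 - cabs z) ^+ 2)^-1.
  have h : 1 - cabs z <= cabs (expi t - z).
    have := cabsD (expi t - z) z; rewrite subrK cabs_expi; lra.
  have h0 : 0 < 1 - cabs z by rewrite subr_gt0.
  have h1 : (cabs (expi t - z) ^+ 2)^-1 <= ((1 - cabs z) ^+ 2)^-1.
    rewrite lef_pV2 ?posrE ?exprn_gt0//; last by rewrite (lt_le_trans h0).
    by rewrite ler_sqr ?nnegrE ?(ltW h0)// cabs_ge0.
  exact: le_trans (cabs_dcauchy_kernel t z1) h1.
have cK t := continuous_dcauchy_kernel (expi_neq t z1).
split; (split; [apply: continuous_measurable_fun => t; by case: (cK t)|]).
  by exists ((1 - cabs z) ^+ 2)^-1 => t; rewrite (le_trans (Re_le_cabs _)).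
by exists ((1 - cabs z) ^+ 2)^-1 => t; rewrite (le_trans (Im_le_cabs _)).
Qed.

Lemma cintg_rotate f z u : bounded_borel f -> periodic f (2 * pi) -> cabs z < 1 ->
  cintg f (dcauchy_kernel z) = cintg (fun s => f (s + u)) (dcauchy_kernel (z * expi (- u))).
Proof.
move=> bf pf z1; have [bR bI] := bounded_dcauchy_kernel z1.
have shift h : bounded_borel h -> periodic h (2 * pi) ->
    intg (- pi) pi (fun s => f s * h s) = intg (- pi) pi (fun s => f (s + u) * h (s + u)).
  move=> bh ph; have p2 : - pi + 2 * pi = pi :> R by ring.
  have := @intg_periodic R (- pi) (2 * pi) u (fun s => f s * h s); rewrite p2 => -> //.
  - by rewrite mulr_ge0// pi_ge0.
  - exact: bounded_borelM.
  - by move=> t; rewrite pf ph.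
by rewrite /cintg; congr (_ +i* _); rewrite shift//;
  [apply: eq_intg => s _; rewrite dcauchy_kernel_rotate|move=> t; rewrite dcauchy_kernel_periodic
  |apply: eq_intg => s _; rewrite dcauchy_kernel_rotate|move=> t; rewrite dcauchy_kernel_periodic].
Qed.

Section Boundary.
Variables (Phi : R -> R[i]) (B : R).
Hypothesis PhiB : forall x, cabs (Phi x) <= B.
Hypothesis cRe : {ae mu, forall x, {for x, continuous (fun x => Re (Phi x))}}.
Hypothesis cIm : {ae mu, forall x, {for x, continuous (fun x => Im (Phi x))}}.
Hypothesis pPhi : periodic Phi (2 * pi).
Local Notation f1 := (usc_env (fun x => Re (Phi x))).
Local Notation f2 := (usc_env (fun x => Im (Phi x))).

(** The kernel and [Phi] have period 2 pi, so the boundary terms at - pi and pi cancel. *)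
Lemma cauchy_RS z : cabs z < 1 ->
  is_RS_integral (- pi) pi (cauchy_kernel z) Phi
    (- (cintg f1 (dcauchy_kernel z) + 'i%C * cintg f2 (dcauchy_kernel z))).
Proof.
move=> z1.
have := complex_RS_integral PhiB cRe cIm
  (fun x (_ : - pi <= x <= pi) => is_cderive_cauchy_kernel (expi_neq x z1))
  (fun x (_ : - pi <= x <= pi) => continuous_dcauchy_kernel (expi_neq x z1)).
congr is_RS_integral; rewrite /complex_RS /real_RS.
have -> : Phi pi = Phi (- pi) by rewrite -(pPhi (- pi)); congr Phi; ring.
have -> : cauchy_kernel z pi = cauchy_kernel z (- pi).
  rewrite /cauchy_kernel (_ : expi pi = expi (- pi))//.
  by rewrite -[expi (- pi)]mulr1 -expi_2pi -expiD; congr expi; ring.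
rewrite /cintg; apply: parts_eq => /=.
  by ring.
by ring.
Qed.

Lemma cauchy_stieltjesE z u : cabs z < 1 ->
  cauchy_stieltjes Phi z = ((2 * pi)^-1)%:C *
    - (cintg (fun s => f1 (s + u)) (dcauchy_kernel (z * expi (- u))) +
       'i%C * cintg (fun s => f2 (s + u)) (dcauchy_kernel (z * expi (- u)))).
Proof.
move=> z1; rewrite /cauchy_stieltjes (RS_integralE pipi (cauchy_RS z1)).
rewrite -!cintg_rotate//.
- by apply: usc_env_borel => t; apply: le_trans (Im_le_cabs _) (PhiB t).
- by apply: usc_env_periodic => t; rewrite pPhi.
- by apply: usc_env_borel => t; apply: le_trans (Re_le_cabs _) (PhiB t).
- by apply: usc_env_periodic => t; rewrite pPhi.
Qed.

End Boundary.
End CauchyStieltjes.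

(** * Differentiability of the envelope, and the half-angle cotangent *)

Section Cotangent.
Variable R : realType.
Notation mu := (@lebesgue_measure R).
Local Notation pi := (@pi R).
Implicit Types (f h : R -> R) (x y s a b c r e u D : R) (z : R[i]).

Lemma derivable_at0_continuous f x D :
  derivable_at0 (fun s => f (s + x)) D -> {for x, continuous f}.
Proof.
move=> /(_ _ ltr01)[d [d0 H]]; apply/cvgrPdist_le => e e0.
have K0 : 0 < `|D| + 1 by rewrite ltr_wpDl.
near=> y; have yd : `|y - x| < d by rewrite distrC; near: y; exact: cvgr_dist_lt.
have yK : `|y - x| <= e / (`|D| + 1).
  by rewrite distrC; near: y; apply: cvgr_dist_le => //; rewrite divr_gt0.
have := H _ yd; rewrite subrK add0r mul1r => h.
have := ler_normD (f y - f x - D * (y - x)) (D * (y - x)).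
rewrite subrK [`|D * _|]normrM distrC => h2.
move: yK; rewrite ler_pdivlMr//; lra.
Unshelve. all: by end_near. Qed.

(** The upper first-order estimate for f on a small ball passes to the supremum over it, and the
    lower one is inherited from f <= usc_env f. Differentiability thus transfers at the very same
    point. *)
Lemma derivable_at0_usc_env f x D M : (forall y, `|f y| <= M) ->
  derivable_at0 (fun s => f (s + x)) D ->
  usc_env f x = f x /\ derivable_at0 (fun s => usc_env f (s + x)) D.
Proof.
move=> fM fD.
have up e d s : 0 < e -> (forall s, `|s| < d -> `|f (s + x) - f (0 + x) - D * s| <= e * `|s|) ->
    `|s| < d -> usc_env f (s + x) <= f x + D * s + e * `|s|.
  move=> e0 H sd; apply/ler_addgt0Pr => r r0.
  (* The first bound keeps u within d of x, where the estimate for f holds; the second makes the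
     extra error (|D| + e) |u - (s + x)| at most r. *)
  pose m := Num.min (d - `|s|) (r / (`|D| + e)).
  have K0 : 0 < `|D| + e by rewrite ltr_wpDl.
  have m0 : 0 < m by rewrite lt_min subr_gt0 sd divr_gt0.
  have [n nm] : exists n : nat, n.+1%:R^-1 < m.
    exists (Num.bound m^-1); rewrite invf_plt ?posrE//.
    by rewrite (lt_trans (archi_boundP _))// ?invr_ge0 ?(ltW m0)// ltr_nat.
  apply: (le_trans (usc_env_le fM n _)); apply: sup_env_le => u us.
  have {}us : `|u - (s + x)| < m by exact: lt_trans us nm.
  have /andP[m1 m2] : (m <= d - `|s|) && (m <= r / (`|D| + e)) by rewrite !ge_min !lexx orbT.
  have us2 : `|u - x| <= `|s| + `|u - (s + x)|.
    by have := ler_normD s (u - (s + x)); rewrite (_ : s + (u - (s + x)) = u - x)//; ring.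
  have ux : `|u - x| < d by lra.
  have := H _ ux; rewrite subrK add0r => Hu.
  have Dn : D * (u - (s + x)) <= `|D| * `|u - (s + x)|.
    by rewrite -normrM ler_norm.
  have eu : e * `|u - x| <= e * (`|s| + `|u - (s + x)|) by rewrite ler_wpM2l// ltW.
  have rr : (`|D| + e) * `|u - (s + x)| <= r.
    by rewrite mulrC -ler_pdivlMr// (le_trans (ltW us)).
  by move: Hu; rewrite ler_norml => /andP[_]; lra.
have fx : usc_env f x = f x.
  apply/eqP; rewrite eq_le (usc_env_gephi fM) andbT.
  have [d [d0 H]] := fD _ ltr01; have := up _ d 0 ltr01 H.
  by rewrite normr0 !mulr0 add0r !addr0; apply.
split => // e e0; have [d [d0 H]] := fD _ e0; exists d; split => // s sd.
rewrite add0r fx ler_norml; apply/andP; split; last by have := up _ _ _ e0 H sd; lra.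
have := H _ sd; have := usc_env_gephi fM (s + x); rewrite add0r ler_norml; lra.
Qed.

Definition cot_half x t : R := cos ((x - t) / 2) / sin ((x - t) / 2).

Lemma hilbert_kernelE x t : hilbert_kernel x t = (cot_half x t)%:C.
Proof. by rewrite /hilbert_kernel /cot_half /tan invf_div. Qed.

Lemma is_derive_cot_half x t : sin ((x - t) / 2) != 0 ->
  is_derive t 1 (cot_half x) (2 * inv_4sin2 (t - x)).
Proof.
move=> s0.
pose w t := (x - t) / 2.
have aff : is_derive t 1 w (- 2^-1).
  have := isd_affine t (- 2^-1 : R) (x / 2); rewrite (_ : (fun y => _) = w)//.
  by apply/funext => y; rewrite /w; lra.
have ds : is_derive t 1 (fun t => sin (w t)) (cos (w t) * - 2^-1).
  exact: is_derive1_comp (is_derive_sin (w t)) aff.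
have dc : is_derive t 1 (fun t => cos (w t)) (- sin (w t) * - 2^-1).
  exact: is_derive1_comp (is_derive_cos (w t)) aff.
have h := isdM dc (isdV s0 ds); apply: is_derive_eq h _; rewrite /w.
have e1 : sin ((t - x) / 2) = - sin ((x - t) / 2) by rewrite -sinN; congr sin; lra.
rewrite /inv_4sin2 e1 sqrrN; have := cos2Dsin2 ((x - t) / 2).
move: s0; move: (sin _) (cos _) => a b a0 ab.
rewrite (_ : _ + _ = 2^-1 * (b ^+ 2 + a ^+ 2) / a ^+ 2); last by field.
by rewrite ab; field.
Qed.

Lemma continuous_inv_4sin2 (s : R) : sin (s / 2) != 0 -> {for s, continuous (@inv_4sin2 R)}.
Proof.
move=> s0; apply: cvgV; first by rewrite mulf_neq0 ?sqrf_eq0// pnatr_eq0.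
apply: cvgM; first exact: cvg_cst.
have cs : {for s, continuous (fun s : R => sin (s / 2))}.
  rewrite (_ : (fun _ => _) = (fun s => sin (2^-1 * s))); first exact: continuous_sin_lin.
  by apply/funext => y; rewrite mulrC.
rewrite (_ : (fun _ => _) = (fun s : R => sin (s / 2) * sin (s / 2))); last first.
  by apply/funext => y; rewrite expr2.
by rewrite expr2; apply: cvgM.
Qed.

Lemma sin_half_neq0 (s : R) : 0 < `|s| <= pi -> sin (s / 2) != 0.
Proof.
move=> /andP[s0 spi].
have h : 0 < sin (`|s| / 2) by rewrite sin_gt0_pi// divr_gt0//=; have := pi_gt0 R; lra.
move: h; have [s1|s1] := leP 0 s; first by rewrite ger0_norm// => /gt_eqF ->.
by rewrite ltr0_norm// mulNr sinN oppr_gt0 => /lt_eqF ->.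
Qed.

End Cotangent.

(** * The truncated Hilbert-Stieltjes integral by parts *)

Section HilbertBoundary.
Variable R : realType.
Notation mu := (@lebesgue_measure R).
Local Notation pi := (@pi R).
Implicit Types (f h : R -> R) (x y s a b c r e u D : R) (z : R[i]).

Let dcot x t : R := 2 * inv_4sin2 (t - x).

Lemma sin_half_sub_neq0 x t : 0 < `|t - x| <= pi -> sin ((x - t) / 2) != 0.
Proof. by move=> h; apply: sin_half_neq0; rewrite distrC. Qed.

Lemma continuous_dcot_half x t : 0 < `|t - x| <= pi ->
  {for t, continuous (fun t => 2 * inv_4sin2 (t - x))}.
Proof.
move=> h; apply: cvgM; first exact: cvg_cst.
apply: (@continuous_comp _ _ _ (fun t => t - x) (@inv_4sin2 R)).
  by apply: cvgB; [exact: cvg_id|exact: cvg_cst].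
by apply: continuous_inv_4sin2; exact: sin_half_neq0.
Qed.

Lemma hilbert_RS Phi B x a b : a <= b -> (forall y, cabs (Phi y) <= B) ->
  {ae mu, forall y, {for y, continuous (fun t => Re (Phi t))}} ->
  {ae mu, forall y, {for y, continuous (fun t => Im (Phi t))}} ->
  (forall t, a <= t <= b -> 0 < `|t - x| <= pi) ->
  is_RS_integral a b (hilbert_kernel x) Phi
    (real_RS a b (cot_half x) (dcot x) (fun t => Re (Phi t)) +i*
     real_RS a b (cot_half x) (dcot x) (fun t => Im (Phi t))).
Proof.
move=> a_b PhiB cR cI ab.
have -> : hilbert_kernel x = fun t => (cot_half x t)%:C by apply/funext => t; exact: hilbert_kernelE.
have := @complex_RS_integral R a b (fun t => (cot_half x t)%:C) (fun t => (dcot x t)%:C) Phi B PhiB cR cI.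
have z0 phi : real_RS a b (fun=> 0) (fun=> 0) phi = 0.
  rewrite /real_RS !mul0r subrr (@eq_intg _ a b _ (fun=> 0)); last by move=> t _; rewrite mulr0.
  by rewrite intg_cst// mul0r subrr.
rewrite /complex_RS/= !z0 addr0 subr0; apply.
  move=> t /ab h; split; last exact: is_derive_cst.
  by apply: is_derive_cot_half; exact: sin_half_sub_neq0.
by move=> t /ab h; split; [exact: continuous_dcot_half|exact: cvg_cst].
Qed.

Lemma cot_half_pi x : cot_half x (x - pi) = 0 /\ cot_half x (x + pi) = 0.
Proof.
rewrite /cot_half; split.
  by rewrite opprB addrCA subrr addr0 cos_pihalf mul0r.
by rewrite opprD addrA subrr add0r mulNr cosN cos_pihalf mul0r.
Qed.

(** The cotangent vanishes at the outer ends x - pi and x + pi. Subtracting the constant f x under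
    the integrals adds cotangent values at the inner ends, and these turn the boundary terms into a
    symmetric second difference. *)
Lemma hilbert_boundary f phi x e : bounded_borel f -> f x = phi x -> 0 < e <= pi ->
  f = usc_env phi ->
  real_RS (x - pi) (x - e) (cot_half x) (dcot x) phi +
  real_RS (x + e) (x + pi) (cot_half x) (dcot x) phi =
  cos (e / 2) / sin (e / 2) * (phi (x + e) + phi (x - e) - 2 * phi x) -
  2 * trunc_hilbert (fun s => f (s + x)) e.
Proof.
move=> bf fx /andP[e0 epi] fE; have [c1 c2] := cot_half_pi x.
rewrite /real_RS c1 c2 !mul0r !subr0 sub0r -fE.
pose c := cos (e / 2) / sin (e / 2).
have k1 y : cot_half y (y - e) = c by rewrite /cot_half opprB addrCA subrr addr0.
have k2 y : cot_half y (y + e) = - c.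
  by rewrite /cot_half opprD addrA subrr add0r mulNr cosN sinN invrN mulrN.
have mj : measurable_fun setT (fun s : R => 2 * inv_4sin2 s).
  by apply: measurable_funM; [exact: measurable_cst|exact: measurable_inv_4sin2].
have bj a b : (forall t, a <= t <= b -> 0 < `|t| <= pi) -> bm a b (fun s => 2 * inv_4sin2 s).
  move=> ab; apply: bm_continuous => t /ab h.
  apply: cvgM; first exact: cvg_cst.
  by apply: continuous_inv_4sin2; exact: sin_half_neq0.
have L t : - pi <= t <= - e -> 0 < `|t| <= pi.
  by move=> /andP[t1 t2]; rewrite ltr0_norm; lra.
have Rt t : e <= t <= pi -> 0 < `|t| <= pi.
  by move=> /andP[t1 t2]; rewrite gtr0_norm; lra.
have bx := bounded_borel_shift x bf.
have bm_x a b : bm a b (fun s => f (s + x)) by exact: bounded_borel_bm.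
have shift a b : (forall t, a <= t <= b -> 0 < `|t| <= pi) ->
    intg (a + x) (b + x) (fun t => f t * dcot x t) =
    intg a b (fun s => f (s + x) * (2 * inv_4sin2 s)).
  move=> ab; rewrite -intg_shift.
  - by apply: eq_intg => s _; rewrite /dcot addrK.
  - apply: measurable_funM; first by case: bf.
    by apply: (measurableT_comp mj); apply: measurable_funB => //; exact: measurable_cst.
  - apply: bmM; first exact: bounded_borel_bm.
    by apply: bm_continuous => t /andP[t1 t2]; apply: continuous_dcot_half; apply: ab; lra.
have bt a b : - pi <= a -> b <= pi -> bm a b (fun s => (f (s + x) - f (0 + x)) * trunc_inv_4sin2 e s).
  move=> a1 b1; apply: bmM; first by apply: bmB; [exact: bm_x|exact: bm_cst].
  exact: bm_sub a1 b1 (bm_trunc e0).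
have int a b : a <= b -> (forall t, a <= t <= b -> 0 < `|t| <= pi) ->
    intg a b (fun s => 2 * inv_4sin2 s) = cot_half 0 b - cot_half 0 a.
  move=> ab H.
  have dF t : a <= t <= b -> is_derive t 1 (cot_half 0) (2 * inv_4sin2 (t - 0)).
    by move=> /H h; apply: is_derive_cot_half; apply: sin_half_sub_neq0; rewrite subr0.
  have cF t : a <= t <= b -> {for t, continuous (fun t => 2 * inv_4sin2 (t - 0))}.
    by move=> /H h; apply: continuous_dcot_half; rewrite subr0.
  by rewrite -(intg_FTC ab dF cF); apply: eq_intg => s _; rewrite subr0.
have piece a b : - pi <= a -> b <= pi -> a <= b -> (forall t, a <= t <= b -> 0 < `|t| <= pi) ->
   (forall t, a <= t <= b -> e <= `|t|) ->
   2 * intg a b (fun s => (f (s + x) - f (0 + x)) * trunc_inv_4sin2 e s) =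
   intg a b (fun s => f (s + x) * (2 * inv_4sin2 s)) - f x * (cot_half 0 b - cot_half 0 a).
  move=> a1 b1 ab H1 H2; rewrite -int// -intgZ; last exact: bt.
  rewrite -intgZ; last exact: bj.
  rewrite -intgB; [|by apply: bmM; [exact: bm_x|exact: bj]|by apply: bmZ; exact: bj].
  apply: eq_intg => s sab; rewrite add0r /trunc_inv_4sin2 H2//.
  by move: (inv_4sin2 s) => u; ring.
(* The truncated kernel vanishes on the open interval but not at its two ends. *)
have mid : intg (- e) e (fun s => (f (s + x) - f (0 + x)) * trunc_inv_4sin2 e s) = 0.
  have ee : - e <= e by lra.
  rewrite (@eq_intg_oo _ _ _ _ (fun=> 0))//; [by rewrite intg_cst// mul0r|by apply: bt; lra|exact: bm_cst|].
  move=> s /andP[s1 s2]; rewrite /trunc_inv_4sin2 ifF ?mulr0//.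
  by apply/negbTE; rewrite -ltNge ltr_norml s1.
have -> : 2 * trunc_hilbert (fun s => f (s + x)) e =
  2 * intg (- pi) (- e) (fun s => (f (s + x) - f (0 + x)) * trunc_inv_4sin2 e s) +
  2 * intg e pi (fun s => (f (s + x) - f (0 + x)) * trunc_inv_4sin2 e s).
  have s1 : - pi <= - e <= pi by apply/andP; split; lra.
  have s2 : - e <= e <= pi by apply/andP; split; lra.
  have e1 : - pi <= - e by lra.
  by rewrite /trunc_hilbert (intg_split s1 (bt _ _ (lexx _) (lexx _)))
    (intg_split s2 (bt _ _ e1 (lexx _))) mid
    [0 + intg _ _ _]add0r mulrDr.
have e1 : - pi <= - e by lra.
have e2 : - e <= pi by lra.
have e3 : - pi <= e by lra.
have L' t : - pi <= t <= - e -> e <= `|t|.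
  by move=> /andP[_ t2]; rewrite ler_normr lerNr t2 orbT.
have R' t : e <= t <= pi -> e <= `|t| by move=> /andP[t1 _]; rewrite ler_normr t1.
rewrite (piece _ _ (lexx _) e2 e1 L L') (piece _ _ e3 (lexx _) epi Rt R').
rewrite -(shift _ _ L) -(shift _ _ Rt) k1 k2 -fx -/c.
have [d1 d2] := cot_half_pi 0; rewrite sub0r in d1; rewrite add0r in d2.
have := k1 0; have := k2 0; rewrite add0r sub0r d1 d2 => -> ->.
by rewrite ![- _ + x]addrC ![_ + x]addrC; ring.
Qed.

End HilbertBoundary.

(** * Limits of truncated integrals and of pairings along nontangential paths *)

Section BoundaryLimits.
Variable R : realType.
Notation mu := (@lebesgue_measure R).
Local Notation pi := (@pi R).
Implicit Types (f h : R -> R) (x y s a b c r e u D : R) (z : R[i]).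

Definition hilbert_sum phi x e : R :=
  real_RS (x - pi) (x - e) (cot_half x) (fun t => 2 * inv_4sin2 (t - x)) phi +
  real_RS (x + e) (x + pi) (cot_half x) (fun t => 2 * inv_4sin2 (t - x)) phi.

(** At a point of differentiability the second difference is o(e), which beats cot(e/2) = O(1/e), so
    the boundary term disappears. *)
Lemma hilbert_sum_cvg phi x D B (l : R) : (forall y, `|phi y| <= B) ->
  derivable_at0 (fun s => phi (s + x)) D ->
  trunc_hilbert (fun s => usc_env phi (s + x)) e @[e --> 0^'+] --> l ->
  hilbert_sum phi x e @[e --> 0^'+] --> - (2 * l).
Proof.
move=> phiB phiD L; have bf := usc_env_borel phiB.
have [fx _] := derivable_at0_usc_env phiB phiD.
have c0 : cos (e / 2) / sin (e / 2) * (phi (x + e) + phi (x - e) - 2 * phi x) @[e --> 0^'+] --> (0 : R).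
  apply/cvgrPdist_le => r r0.
  (* Two one-sided errors of r/16 give a second difference of at most (r/8) e, to be multiplied by
     the bound 8/e for the cotangent. *)
  have r16 : 0 < r / 16 by rewrite divr_gt0.
  have [d [d0 H]] := phiD _ r16.
  near=> e; rewrite sub0r normrN normrM.
  have e0 : 0 < e by near: e; exact: nbhs_right_gt.
  have ed : e < d by near: e; exact: nbhs_right_lt.
  have epi : e <= pi by near: e; apply: nbhs_right_le; exact: pi_gt0.
  have se : e / 8 <= sin (e / 2).
    by have := @sin_ge_quarter R (e / 2); rewrite (_ : e / 2 / 4 = e / 8); [apply; lra|field].
  have s0 : 0 < sin (e / 2) by rewrite (lt_le_trans _ se)// divr_gt0.
  rewrite normrM normfV [`|sin _|]gtr0_norm//.
  have h1 : `|cos (e / 2)| / sin (e / 2) <= 8 / e.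
    rewrite ler_pdivrMr// mulrAC ler_pdivlMr//.
    have := cos_max (e / 2); move: (normr_ge0 (cos (e / 2))) se.
    by move: `|cos _| (sin _) => a b a0 h a1; nra.
  have h2 : `|phi (x + e) + phi (x - e) - 2 * phi x| <= r / 8 * e.
    have := H e; have := H (- e); rewrite normrN gtr0_norm// add0r => /(_ ed) H1 /(_ ed) H2.
    rewrite ![x + _]addrC; have := ler_normD (phi (e + x) - phi x - D * e) (phi (- e + x) - phi x - D * - e).
    rewrite (_ : phi (e + x) - phi x - D * e + _ = phi (e + x) + phi (- e + x) - 2 * phi x); last by ring.
    by lra.
  have e1 : r = 8 / e * (r / 8 * e) by field; rewrite gt_eqF.
  by rewrite [leRHS]e1; apply: ler_pM => //; rewrite mulr_ge0// invr_ge0 ltW.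
suff near0 : \forall e \near (0 : R)^'+,
    cos (e / 2) / sin (e / 2) * (phi (x + e) + phi (x - e) - 2 * phi x) -
    2 * trunc_hilbert (fun s => usc_env phi (s + x)) e = hilbert_sum phi x e.
  apply: cvg_trans (near_eq_cvg near0) _; rewrite -[- (2 * l)]add0r.
  by apply: cvgB => //; apply: cvgM => //; exact: cvg_cst.
near=> e; apply/esym; apply: hilbert_boundary => //; apply/andP; split.
  by near: e; exact: nbhs_right_gt.
by near: e; apply: nbhs_right_le; exact: pi_gt0.
Unshelve. all: by end_near. Qed.

Lemma cintg_kernel_path f D (l : R) q (w : R -> R[i]) : bounded_borel f -> derivable_at0 f D ->
  trunc_hilbert f e @[e --> 0^'+] --> l -> 0 <= q ->
  (forall d, 0 < d -> \forall s \near (1 : R)^'-,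
    [/\ cabs (w s) < 1, cabs (w s - 1) <= q * (1 - cabs (w s)) & cabs (w s - 1) < d]) ->
  Re (cintg f (dcauchy_kernel (w s))) @[s --> 1^'-] --> - (pi * D) /\
  Im (cintg f (dcauchy_kernel (w s))) @[s --> 1^'-] --> l.
Proof.
move=> bf fD L q0 near_w; split; apply/cvgrPdist_le => e e0.
  have [d [d0 Hd]] := kernel_comparison bf fD q0 e0.
  apply: filterS (near_w _ d0) => s [w1 w2 w3]; have [h _] := Hd _ w1 w2 w3.
  by rewrite -opprD normrN addrC.
have e2 : 0 < e / 2 by rewrite divr_gt0.
have [d [d0 Hd]] := kernel_comparison bf fD q0 e2.
have [d1 d10 Hd1] : exists2 d1, 0 < d1 & forall r, 0 < r < d1 -> `|l - trunc_hilbert f r| <= e / 2.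
  move/cvgrPdist_le : L => /(_ _ e2) [d1 d10 Hd1]; exists d1 => // r /andP[r0 rd].
  by apply: Hd1 => //; rewrite /= sub0r normrN gtr0_norm.
have m0 : 0 < Num.min d d1 by rewrite lt_min d0.
apply: filterS (near_w _ m0) => s [w1 w2]; rewrite lt_min => /andP[w3 w4].
have w5 : 0 < cabs (w s - 1).
  rewrite lt_def cabs_ge0 andbT cabs_eq0 subr_eq0; apply: contraTneq w1 => ->.
  by rewrite -expi0 cabs_expi ltxx.
have [_ h1] := Hd _ w1 w2 w3; have := Hd1 (cabs (w s - 1)); rewrite w5 w4 => /(_ isT).
by move: h1; rewrite !ler_norml; lra.
Qed.

Lemma unit_discE z : unit_disc z = (cabs z < 1) :> Prop.
Proof. by rewrite /unit_disc/= normE -(@ltcR R) rmorph1. Qed.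

Lemma sqr_cabs_ray u r (theta : R) : cabs (expi u + r%:C * expi theta) ^+ 2 =
  1 + r ^+ 2 + 2 * r * (cos u * cos theta + sin u * sin theta).
Proof.
rewrite cabs_sqr !partsE /= mul0r subr0 mul0r addr0.
have := cos2Dsin2 u; have := cos2Dsin2 theta.
move: (cos u) (sin u) (cos theta) (sin theta) => a b c d h1 h2.
have -> : (a + r * c) ^+ 2 + (b + r * d) ^+ 2 =
  (a ^+ 2 + b ^+ 2) + r ^+ 2 * (c ^+ 2 + d ^+ 2) + 2 * r * (a * c + b * d) by ring.
by rewrite h1 h2 mulr1.
Qed.

(** That the whole truncated angle lies in the disc forces every direction in it to point inwards by
    a fixed amount, and this gives the Stolz constant 8 / rho. *)
Lemma nontangential_Stolz (gamma : R -> R[i]) u : disc_path_to gamma (expi u) ->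
  nontangential gamma (expi u) -> exists q, 0 <= q /\ forall d, 0 < d ->
  \forall s \near (1 : R)^'-,
    [/\ cabs (gamma s * expi (- u)) < 1,
        cabs (gamma s * expi (- u) - 1) <= q * (1 - cabs (gamma s * expi (- u))) &
        cabs (gamma s * expi (- u) - 1) < d].
Proof.
move=> [_ g1 gz] [alpha [beta [rho [ab rho0 sub near_g]]]].
exists (8 / rho); split; first by rewrite divr_ge0// ltW.
move=> d d0.
have n1 : \forall s \near (1 : R)^'-, 0 <= s < 1.
  by apply: (near_left1 ltr01) => r -> _ ->.
have n2 : \forall s \near (1 : R)^'-, forall t, 0 <= t < 1 -> gamma t = gamma s ->
    angle (expi u) alpha beta rho (gamma s) by exact: (gz _ near_g).
have n3 e : 0 < e -> \forall s \near (1 : R)^'-, cabs (gamma s - expi u) < e.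
  move=> e0; have e2 : 0 < e / 2 by rewrite divr_gt0.
  have [/cvgrPdist_lt/(_ _ e2) h1 /cvgrPdist_lt/(_ _ e2) h2] := (cvg_parts _ _).1 gz.
  apply: filterS2 h1 h2 => s; rewrite -ReB -ImB => h1 h2.
  by rewrite cabsBC (le_lt_trans (cabs_le_parts _))//; lra.
have rho4 : 0 < rho / 4 by rewrite divr_gt0.
near=> s.
have s01 : 0 <= s < 1 by near: s; exact: n1.
have [r [theta [/andP[r0 rr] tt gE]]] : angle (expi u) alpha beta rho (gamma s).
  have H : forall t, 0 <= t < 1 -> gamma t = gamma s ->
    angle (expi u) alpha beta rho (gamma s) by near: s; exact: n2.
  exact: (H s).
have gd : cabs (gamma s - expi u) < d by near: s; exact: n3.
have g4 : cabs (gamma s - expi u) < rho / 4 by near: s; exact: n3.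
have w1 : gamma s * expi (- u) - 1 = (gamma s - expi u) * expi (- u).
  by rewrite mulrBl -expiD subrr expi0.
have g1s : cabs (gamma s) < 1 by rewrite -unit_discE; exact: g1.
rewrite w1 !cabsM cabs_expi !mulr1; split=> //.
have gr : cabs (gamma s - expi u) = r.
  by rewrite gE addrC addKr cabsM cabs_expi mulr1 cabs_real gtr0_norm.
rewrite gr in g4 *.
pose c := cos u * cos theta + sin u * sin theta.
(* Here c is the cosine between the direction and the outer normal. The point at radius rho/2 has
   modulus below 1, which reads rho^2 / 4 + rho c < 0. *)
have crho : c < - (rho / 4).
  have : angle (expi u) alpha beta rho (expi u + (rho / 2)%:C * expi theta).
    by exists (rho / 2), theta; split => //; apply/andP; split; lra.
  move/sub; rewrite unit_discE -(@ltr_pXn2r _ 2)// ?nnegrE ?cabs_ge0// sqr_cabs_ray expr1n -/c.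
  move: c => c h.
  have : rho * (rho / 4 + c) < 0 by lra.
  by rewrite pmulr_rlt0//; lra.
have := sqr_cabs_ray u r theta; rewrite -gE -/c.
move: g1s (cabs_ge0 (gamma s)); move: (cabs (gamma s)) => m m1 m0 mE.
have rc : r * (c + rho / 4) <= 0 by rewrite pmulr_rle0//; lra.
have rr4 : r * (r - rho / 4) <= 0 by rewrite pmulr_rle0//; lra.
rewrite mulrAC ler_pdivlMr//.
(* Gives 1 - m^2 <= 2 (1 - m), while 1 - m^2 = - r^2 - 2 r c >= r rho / 4 for r < rho / 4. *)
have : (1 - m) * (1 - m) >= 0 by rewrite mulr_ge0// subr_ge0 ltW.
by lra.
Unshelve. all: by end_near. Qed.

Lemma arg_expi u : - pi < u <= pi -> arg (expi u) = u.
Proof.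
move=> upi; rewrite /arg.
have [] := getPex (P := [set t | - pi < t <= pi /\ expi u = expi t]) (ex_intro _ u (conj upi erefl)).
move: (get _) => v vpi uv.
have : expi (u - v) - 1 = 0 :> R[i] by rewrite expiD uv -expiD subrr expi0 subrr.
move/eqP; rewrite -cabs_eq0 expi_sub1 !cabsM cabs_expi mulr1 cabs_real.
rewrite cabs_i.
rewrite mulr1 mulf_eq0 cabs_eq0 pnatr_eq0/= normr_eq0 => h.
apply/eqP; rewrite eq_sym -subr_eq0; apply: contraTT h => uv0.
have /andP[u1 u2] := upi; have /andP[v1 v2] := vpi.
have [uv1|uv1] := ltP v u.
  by rewrite gt_eqF// sin_gt0_pi//; apply/andP; split; lra.
have {uv1}uv1 : u < v by rewrite lt_neqAle uv1 andbT -subr_eq0.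
rewrite -oppr_eq0 -sinN gt_eqF// sin_gt0_pi//; apply/andP; split; lra.
Qed.

End BoundaryLimits.

Section NontangentialLimit.
Variable R : realType.
Notation mu := (@lebesgue_measure R).
Local Notation pi := (@pi R).
Implicit Types (f h : R -> R) (x y s a b c r e u D : R) (z : R[i]).

Lemma diff_quotient_parts (Phi : R -> R[i]) x : differentiable_at Phi x ->
  derivable_at0 (fun s => Re (Phi (s + x))) (Re (derivative Phi x)) /\
  derivable_at0 (fun s => Im (Phi (s + x))) (Im (derivative Phi x)).
Proof.
move=> dPhi; have /cvg_parts[h1 h2] : diff_quotient Phi x h @[h --> 0^'] --> derivative Phi x by exact: dPhi.
have quot (v w : R[i]) (y : R) : Re ((v - w) / y%:C) = (Re v - Re w) / y /\
   Im ((v - w) / y%:C) = (Im v - Im w) / y.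
  by rewrite -fmorphV ReM ImM ReB ImB /= !mulr0 subr0 add0r.
split; [apply: (@derivable_at0_quotient R (fun s => Re (Phi s)))|
  apply: (@derivable_at0_quotient R (fun s => Im (Phi s)))].
  have E : (fun y => Re (diff_quotient Phi x y)) = (fun y => (Re (Phi (x + y)) - Re (Phi x)) / y).
    by apply/funext => y; exact: (quot _ _ _).1.
  by rewrite E in h1.
have E : (fun y => Im (diff_quotient Phi x y)) = (fun y => (Im (Phi (x + y)) - Im (Phi x)) / y).
  by apply/funext => y; exact: (quot _ _ _).2.
by rewrite E in h2.
Qed.

Lemma hilbert_truncatedE Phi B x e : (forall y, cabs (Phi y) <= B) ->
  {ae mu, forall y, {for y, continuous (fun t => Re (Phi t))}} ->
  {ae mu, forall y, {for y, continuous (fun t => Im (Phi t))}} ->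
  0 < e <= pi ->
  [/\ RS_integrable (x - pi) (x - e) (hilbert_kernel x) Phi,
      RS_integrable (x + e) (x + pi) (hilbert_kernel x) Phi &
      hilbert_truncated Phi x e = ((2 * pi)^-1)%:C *
        (hilbert_sum (fun t => Re (Phi t)) x e +i* hilbert_sum (fun t => Im (Phi t)) x e)].
Proof.
move=> PhiB cR cI /andP[e0 epi].
have l1 : x - pi <= x - e by lra.
have l2 : x + e <= x + pi by lra.
have t1 t : x - pi <= t <= x - e -> 0 < `|t - x| <= pi.
  by move=> /andP[? ?]; rewrite ltr0_norm; lra.
have t2 t : x + e <= t <= x + pi -> 0 < `|t - x| <= pi.
  by move=> /andP[? ?]; rewrite gtr0_norm; lra.
have h1 := hilbert_RS l1 PhiB cR cI t1; have h2 := hilbert_RS l2 PhiB cR cI t2.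
split; [by eexists; exact: h1|by eexists; exact: h2|].
by rewrite /hilbert_truncated (RS_integralE l1 h1) (RS_integralE l2 h2).
Qed.

Lemma ae_neq x : {ae mu, forall t, t != x}.
Proof.
exists [set x]; split; [exact: measurable_set1|exact: lebesgue_measure_set1|].
by move=> t /= /negP; rewrite negbK => /eqP.
Qed.

Lemma Re_Im_scale c a b :
  Re (c%:C * (a +i* b)) = c * a /\ Im (c%:C * (a +i* b)) = c * b.
Proof.
have [p1 p2] : Re (a +i* b) = a /\ Im (a +i* b) = b by [].
by split; rewrite !(ReM, ImM) p1 p2 !(ReC, ImC); ring.
Qed.

Lemma Re_Im_boundary c (v w : R[i]) :
  Re (c%:C * - (v + 'i%C * w)) = c * - (Re v - Im w) /\
  Im (c%:C * - (v + 'i%C * w)) = c * - (Im v + Re w).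
Proof.
have [i1 i2] : Re 'i%C = 0 :> R /\ Im 'i%C = 1 :> R by [].
by split; rewrite !(ReM, ImM, ReN, ImN, ReD, ImD) i1 i2 !(ReC, ImC); ring.
Qed.

Lemma Re_Im_half c a b (v : R[i]) :
  Re (2^-1 * (v + 'i%C * (c%:C * (a +i* b)))) = 2^-1 * (Re v - c * b) /\
  Im (2^-1 * (v + 'i%C * (c%:C * (a +i* b)))) = 2^-1 * (Im v + c * a).
Proof.
have -> : 2^-1 = (2^-1)%:C :> R[i] by rewrite fmorphV rmorph_nat.
have [i1 i2] : Re 'i%C = 0 :> R /\ Im 'i%C = 1 :> R by [].
have [p1 p2] : Re (a +i* b) = a /\ Im (a +i* b) = b by [].
by split; rewrite !(ReM, ImM, ReN, ImN, ReD, ImD) p1 p2 i1 i2 !(ReC, ImC); ring.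
Qed.

Lemma nontangential_limit Phi B x (l1 l2 : R) (gamma : R -> R[i]) :
  (forall y, cabs (Phi y) <= B) -> periodic Phi (2 * pi) ->
  {ae mu, forall y, {for y, continuous (fun t => Re (Phi t))}} ->
  {ae mu, forall y, {for y, continuous (fun t => Im (Phi t))}} ->
  differentiable_at Phi x ->
  trunc_hilbert (fun s => usc_env (fun t => Re (Phi t)) (s + x)) e @[e --> 0^'+] --> l1 ->
  trunc_hilbert (fun s => usc_env (fun t => Im (Phi t)) (s + x)) e @[e --> 0^'+] --> l2 ->
  disc_path_to gamma (expi x) -> nontangential gamma (expi x) ->
  cauchy_stieltjes Phi (gamma s) @[s --> 1^'-] -->
    2^-1 * (derivative Phi x + 'i%C * (((2 * pi)^-1)%:C * ((- (2 * l1)) +i* (- (2 * l2))))).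
Proof.
move=> PhiB pPhi cR cI dPhi L1 L2 gp gn.
have RB y : `|Re (Phi y)| <= B by exact: le_trans (Re_le_cabs _) (PhiB y).
have IB y : `|Im (Phi y)| <= B by exact: le_trans (Im_le_cabs _) (PhiB y).
have [d1 d2] := diff_quotient_parts dPhi.
have [_ D1] := derivable_at0_usc_env (f := fun t => Re (Phi t)) RB d1.
have [_ D2] := derivable_at0_usc_env (f := fun t => Im (Phi t)) IB d2.
have b1 := bounded_borel_shift x (usc_env_borel RB).
have b2 := bounded_borel_shift x (usc_env_borel IB).
have [q [q0 near_w]] := nontangential_Stolz gp gn.
have [R1 I1] := cintg_kernel_path b1 D1 L1 q0 near_w.
have [R2 I2] := cintg_kernel_path b2 D2 L2 q0 near_w.
pose k1 s := cintg (fun s => usc_env (fun t => Re (Phi t)) (s + x))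
   (dcauchy_kernel (gamma s * expi (- x))).
pose k2 s := cintg (fun s => usc_env (fun t => Im (Phi t)) (s + x))
   (dcauchy_kernel (gamma s * expi (- x))).
have near0 : \forall s \near (1 : R)^'-,
    ((2 * pi)^-1)%:C * - (k1 s + 'i%C * k2 s) = cauchy_stieltjes Phi (gamma s).
  apply: (near_left1 ltr01) => s s0 _ s1; apply/esym; apply: (cauchy_stieltjesE PhiB) => //.
  by rewrite -unit_discE; case: gp => _ g1 _; apply: g1; rewrite s0.
apply: cvg_trans (near_eq_cvg near0) _; apply/cvg_parts; split.
  under eq_fun do rewrite (Re_Im_boundary _ _ _).1.
  rewrite (Re_Im_half _ _ _ _).1.
  rewrite (_ : 2^-1 * _ = (2 * pi)^-1 * - (- (pi * Re (derivative Phi x)) - l2)).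
    by apply: cvgM; [exact: cvg_cst|apply: cvgN; apply: cvgB].
  by move: (Re _) (pi_gt0 R) => D; move: (pi) => p p0; field; rewrite gt_eqF.
under eq_fun do rewrite (Re_Im_boundary _ _ _).2.
rewrite (Re_Im_half _ _ _ _).2.
rewrite (_ : 2^-1 * _ = (2 * pi)^-1 * - (l1 + - (pi * Im (derivative Phi x)))).
  by apply: cvgM; [exact: cvg_cst|apply: cvgN; apply: cvgD].
by move: (Im _) (pi_gt0 R) => D; move: (pi) => p p0; field; rewrite gt_eqF.
Qed.

End NontangentialLimit.

Theorem corollary9 (R : realType) (Phi : R -> R[i])
  (Phi_periodic : periodic Phi (2 * pi))
  (Phi_bounded : exists M : R, forall t, `|Phi t| <= M%:C)
  (Phi_diff : {ae (@lebesgue_measure R), forall t, differentiable_at Phi t}) :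
  (forall z : R[i], unit_disc z ->
     RS_integrable (- pi) pi (cauchy_kernel z) Phi) /\
  ae_circle (fun zeta : R[i] =>
    hilbert_stieltjes_exists Phi (arg zeta) /\
    forall gamma : R -> R[i],
      disc_path_to gamma zeta -> nontangential gamma zeta ->
      cauchy_stieltjes Phi (gamma s) @[s --> 1^'-] -->
        2^-1 * (derivative Phi (arg zeta) +
                'i%C * hilbert_stieltjes Phi (arg zeta))).
Proof.
have [B PhiB'] := Phi_bounded.
have PhiB t : cabs (Phi t) <= B by have := PhiB' t; rewrite normE lecR.
have RB y : `|Re (Phi y)| <= B by exact: le_trans (Re_le_cabs _) (PhiB y).
have IB y : `|Im (Phi y)| <= B by exact: le_trans (Im_le_cabs _) (PhiB y).
have cR : {ae @lebesgue_measure R, forall y, {for y, continuous (fun t => Re (Phi t))}}.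
  apply: ae_mono Phi_diff => t /diff_quotient_parts[h _].
  exact: (derivable_at0_continuous (f := fun s => Re (Phi s)) h).
have cI : {ae @lebesgue_measure R, forall y, {for y, continuous (fun t => Im (Phi t))}}.
  apply: ae_mono Phi_diff => t /diff_quotient_parts[_ h].
  exact: (derivable_at0_continuous (f := fun s => Im (Phi s)) h).
split=> [z|].
  by rewrite unit_discE => z1; eexists; exact: (cauchy_RS PhiB cR cI Phi_periodic z1).
have pR : periodic (usc_env (fun t => Re (Phi t))) (2 * pi).
  by apply: usc_env_periodic => t; rewrite Phi_periodic.
have pI : periodic (usc_env (fun t => Im (Phi t))) (2 * pi).
  by apply: usc_env_periodic => t; rewrite Phi_periodic.
have H1 := conjugate_radial_limit (usc_env_borel RB) pR.
have H2 := conjugate_radial_limit (usc_env_borel IB) pI.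
(* The point pi is discarded because the radial limits are known on the open interval only. *)
apply: ae_mono (ae_and (ae_and Phi_diff (ae_neq pi)) (ae_and H1 H2)) => x [[dPhi xpi] [{}H1 {}H2]] x_pi.
have x_pi' : - pi < x < pi by have /andP[-> x1] := x_pi; rewrite lt_neqAle xpi.
rewrite (arg_expi x_pi).
have [d1 d2] := diff_quotient_parts dPhi.
have [_ D1] := derivable_at0_usc_env (f := fun t => Re (Phi t)) RB d1.
have [_ D2] := derivable_at0_usc_env (f := fun t => Im (Phi t)) IB d2.
have [l1 L1] := H1 x_pi' (ex_intro _ _ D1).
have [l2 L2] := H2 x_pi' (ex_intro _ _ D2).
(* From here on only the limits of the truncated integrals are used; [nontangential_limit] recovers
   from them the limits along every path. *)
have {}L1 := trunc_hilbert_cvg (bounded_borel_shift x (usc_env_borel RB)) D1 L1.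
have {}L2 := trunc_hilbert_cvg (bounded_borel_shift x (usc_env_borel IB)) D2 L2.
have T : hilbert_truncated Phi x e @[e --> 0^'+] -->
    ((2 * pi)^-1)%:C * ((- (2 * l1)) +i* (- (2 * l2))).
  have near0 : \forall e \near (0 : R)^'+, ((2 * pi)^-1)%:C *
      (hilbert_sum (fun t => Re (Phi t)) x e +i* hilbert_sum (fun t => Im (Phi t)) x e) =
      hilbert_truncated Phi x e.
    near=> e; have epi : 0 < e <= pi.
      by apply/andP; split; near: e; [exact: nbhs_right_gt|apply: nbhs_right_le; exact: pi_gt0].
    by have [_ _ ->] := hilbert_truncatedE x PhiB cR cI epi.
  apply: cvg_trans (near_eq_cvg near0) _.
  have S1 := hilbert_sum_cvg RB d1 L1; have S2 := hilbert_sum_cvg IB d2 L2.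
  apply/cvg_parts; split.
    under eq_fun do rewrite (Re_Im_scale _ _ _).1.
    by rewrite (Re_Im_scale _ _ _).1; apply: cvgM => //; exact: cvg_cst.
  under eq_fun do rewrite (Re_Im_scale _ _ _).2.
  by rewrite (Re_Im_scale _ _ _).2; apply: cvgM => //; exact: cvg_cst.
split.
  split; last by apply/cvg_ex; eexists; exact: T.
  by move=> e epi; have [] := hilbert_truncatedE x PhiB cR cI epi.
move=> gamma gp gn.
have -> : hilbert_stieltjes Phi x = ((2 * pi)^-1)%:C * ((- (2 * l1)) +i* (- (2 * l2))).
  by apply: cvg_lim T; exact: norm_hausdorff.
exact: nontangential_limit PhiB Phi_periodic cR cI dPhi L1 L2 gp gn.
Unshelve. all: by end_near. Qed.
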